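(* Let $n\ge 2$ be an integer, $\nu=n/2-1$, and let $0<\varepsilon<1/3$. Let $\varphi$ be a complex-valued infinitely differentiable function on the open interval $(0,1)$ and let $\phi$ be the function on $(0,1)$ such that $$\varphi(s)=s^{n/2}\phi(s^{2}),\qquad 0<s<1 .$$ Assume the following. (1) (Behaviour at $0$.) There are $\mu\in\mathbb{C}$ with $\operatorname{Re}(\mu+\nu)>-1$ and complex numbers $c_0,c_1,c_2,\dots$ with $c_0\neq 0$ such that for every $j=0,1,2,\dots$ $$\varphi^{(j)}(s)\sim\sum_{k=0}^{\infty}c_k\frac{d^{j}}{ds^{j}}s^{\mu+k},\qquad s\to+0 .$$ (2) (Behaviour at $1$.) There are nonnegative integers $N,m$, complex numbers $\lambda_0,\dots,\lambda_m,\Lambda,a_0,\dots,a_m$ with $$-1<\operatorname{Re}\lambda_0<\operatorname{Re}\lambda_1<\cdots<\operatorname{Re}\lambda_m<\operatorname{Re}\Lambda,\qquad N\le\operatorname{Re}\Lambda,\qquad \operatorname{Re}\lambda_0\le N-1,\qquad a_0\ne 0,$$ and an infinitely differentiable function $\psi$ on $(0,1)$ such that $\psi^{(k)}$ is integrable on $(1-2\varepsilon,1)$ for $0\le k\le N$ and $$\phi(t)=\sum_{k=0}^{m}a_k(1-t)^{\lambda_k}+(1-t)^{\Lambda}\psi(t),\qquad 1-2\varepsilon<t<1 .$$ Then $$f(x)=|x|^{-n/2}\varphi(|x|)\chi_{[0,1]}(|x|)=\phi(|x|^{2})\chi_{[0,1]}(|x|),\qquad x\in\mathbb{R}^{n},$$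 is an invertible distribution, where $\chi_{[0,1]}$ is the indicator function of $[0,1]$.
   Context: The Fourier transform of a compactly supported distribution $u\in\mathcal{E}'(\mathbb{R}^n)$ is $\hat u(\zeta)=\langle u(x),e^{-i\zeta\cdot x}\rangle$, an entire function of $\zeta\in\mathbb{C}^n$. A distribution $u\in\mathcal{E}'(\mathbb{R}^n)$ is called invertible if there is a constant $A>0$ such that $$\sup\{|\hat u(\eta)|;\ \eta\in\mathbb{R}^n,\ |\eta-\xi|<A\log(2+|\xi|)\}>(A+|\xi|)^{-A}\quad\text{for all }\xi\in\mathbb{R}^n .$$ (By a known theorem of Ehrenpreis and Hörmander this is equivalent to surjectivity of the convolution map $u*\colon\mathcal{C}^\infty(\mathbb{R}^n)\to\mathcal{C}^\infty(\mathbb{R}^n)$, and to surjectivity of $u*\colon\mathcal{D}'(\mathbb{R}^n)\to\mathcal{D}'(\mathbb{R}^n)$.) The asymptotic expansion $\varphi^{(j)}(s)\sim\sum_{k\ge0}c_k\frac{d^j}{ds^j}s^{\mu+k}$ as $s\to+0$ means that for every integer $M\ge0$, $\varphi^{(j)}(s)-\sum_{k=0}^{M-1}c_k\frac{d^j}{ds^j}s^{\mu+k}=O(s^{\operatorname{Re}\mu+M-j})$ as $s\to+0$. Individual coefficients $c_k$ with $k\ge1$ may vanish. Complex powers of positive reals are $x^{a}=e^{a\log x}$. The function $f$ is defined almost everywhere and regarded as a compactly supported distribution. *)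

(* Defs.v *)
From HB Require Import structures.
From mathcomp Require Import all_boot all_order all_algebra.
From mathcomp Require Import complex.
From mathcomp Require Import all_classical all_reals all_analysis.

Set Implicit Arguments.
Unset Strict Implicit.
Unset Printing Implicit Defensive.

Import Order.TTheory GRing.Theory Num.Theory.
Import ComplexField.Normc.
Import numFieldTopology.Exports numFieldNormedType.Exports.

Local Open Scope classical_set_scope.
Local Open Scope ring_scope.
Local Open Scope complex_scope.

(* [R[i]] carries no normed-space structure over [R], so analytic notions for
   complex-valued functions are taken on real and imaginary parts. *)

Section ComplexValued.
Context {R : realType}.

Definition cexp (z : R[i]) : R[i] :=
  (expR (complex.Re z))%:C * (cos (complex.Im z) +i* sin (complex.Im z)).

Definition cpow (x : R) (a : R[i]) : R[i] := cexp (a * (ln x)%:C).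

Definition cderiv (j : nat) (f : R -> R[i]) (s : R) : R[i] :=
  derive1n j (fun t => complex.Re (f t)) s +i*
  derive1n j (fun t => complex.Im (f t)) s.

Definition csmooth_on (D : set R) (f : R -> R[i]) : Prop :=
  forall j s, D s ->
    derivable (derive1n j (fun t => complex.Re (f t))) s 1 /\
    derivable (derive1n j (fun t => complex.Im (f t))) s 1.

Definition cintegrable d (T : measurableType d)
    (mu : {measure set T -> \bar R}) (D : set T) (f : T -> R[i]) : Prop :=
  mu.-integrable D (fun x => (complex.Re (f x))%:E) /\
  mu.-integrable D (fun x => (complex.Im (f x))%:E).

Definition cintegral d (T : measurableType d)
    (mu : {measure set T -> \bar R}) (D : set T) (f : T -> R[i]) : R[i] :=
  (\int[mu]_(x in D) complex.Re (f x)) +i*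
  (\int[mu]_(x in D) complex.Im (f x)).

(* [g s ~ \sum_(k >= 0) c k * (d/ds)^j s^(mu + k)] as [s] tends to [0^'+]. *)
Definition asymp_expansion_at0 (j : nat) (g : R -> R[i]) (mu : R[i])
    (c : nat -> R[i]) : Prop :=
  forall M : nat,
    (fun s : R => normc
       (g s - \sum_(k < M) c k * cderiv j (fun t => cpow t (mu + k%:R)) s))
    =O_ (at_right (0 : R)) (fun s : R => s `^ (complex.Re mu + M%:R - j%:R)).

End ComplexValued.

Section LebesgueTuple.
Context {R : realType}.
Local Notation T n := (n.-tuple (measurableTypeR R)).

Definition tcons n (p : measurableTypeR R * T n) : T n.+1 :=
  [the n.+1.-tuple _ of p.1 :: p.2].

Lemma measurable_tcons n : measurable_fun setT (@tcons n).
Proof.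
by apply: measurable_cons; [exact: measurable_fst|exact: measurable_snd].
Qed.

Section Step.
Local Open Scope ereal_scope.
Variables (n : nat) (mu : {sigma_finite_measure set (T n) -> \bar R}).

Definition leb_step : set (T n.+1) -> \bar R :=
  pushforward (lebesgue_measure \x mu) (@tcons n).

Lemma leb_step0 : leb_step set0 = 0.
Proof. by rewrite /leb_step /pushforward preimage_set0 measure0. Qed.

Lemma leb_step_ge0 A : 0 <= leb_step A.
Proof. by rewrite /leb_step /pushforward measure_ge0. Qed.

Lemma leb_step_sigma_additive : semi_sigma_additive leb_step.
Proof.
move=> F mF tF mUF; rewrite /leb_step /pushforward preimage_bigcup.
apply: measure_semi_sigma_additive.
- by move=> k; rewrite -[X in measurable X]setTI; exact: measurable_tcons.
- apply/trivIsetP => /= i j _ _ ij; rewrite -preimage_setI.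
  by move/trivIsetP : tF => /(_ _ _ _ _ ij) ->//; rewrite preimage_set0.
- rewrite -preimage_bigcup -[X in measurable X]setTI.
  exact: measurable_tcons.
Qed.

HB.instance Definition _ := isMeasure.Build _ _ _ leb_step
  leb_step0 leb_step_ge0 leb_step_sigma_additive.

Lemma leb_step_sigma_finite : sigma_finite setT leb_step.
Proof.
have [F UF mF] : sigma_finite setT (lebesgue_measure \x mu).
  have /sigma_finiteP[F [TF ndF Foo]] := sigma_finiteT (@lebesgue_measure R).
  have /sigma_finiteP[G [TG ndG Goo]] := sigma_finiteT mu.
  exists (fun k => F k `*` G k).
    rewrite -setXTT TF TG predeqE => -[x y]; split.
      move=> [/= [i _ Fnx] [k _ Gky]]; exists (maxn i k) => //; split.
      - by move: x Fnx; exact/subsetPset/ndF/leq_maxl.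
      - by move: y Gky; exact/subsetPset/ndG/leq_maxr.
    by move=> [i _ []/= ? ?]; split; exists i.
  move=> k; have [? ?] := Foo k; have [? ?] := Goo k.
  split; first exact: measurableX.
  by rewrite product_measure1E// lte_mul_pinfty// ge0_fin_numE.
pose un (t : T n.+1) : measurableTypeR R * T n :=
  (thead t, [tuple of behead t]).
have Kun p : un (tcons p) = p.
  by case: p => a b; congr pair; apply/val_inj.
have mun : measurable_fun setT un.
  apply/measurable_fun_pairP; split.
    exact: (@measurable_tnth _ _ _ ord0).
  exact: measurable_behead.
exists (fun k => un @^-1` F k).
  by rewrite -preimage_bigcup -UF preimage_setT.
move=> k; have [mFk Fk] := mF k; split.
  by rewrite -[X in measurable X]setTI; exact: mun.
rewrite /leb_step /pushforward (_ : _ @^-1` _ = F k)//.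
by apply/seteqP; split => p /=; rewrite Kun.
Qed.

HB.instance Definition _ :=
  Measure_isSigmaFinite.Build _ _ _ leb_step leb_step_sigma_finite.

End Step.

(* Lebesgue measure on the Borel sets of R^n, as an iterated product. *)
Fixpoint lebesgue_tuple (n : nat) : {sigma_finite_measure set (T n) -> \bar R} :=
  match n with
  | 0 => \d_ ([tuple] : T 0)
  | k.+1 => leb_step (lebesgue_tuple k)
  end.

Lemma lebesgue_tuple_box n (A : 'I_n -> set (measurableTypeR R)) :
  (forall i, measurable (A i)) ->
  lebesgue_tuple n [set t | forall i, A i (tnth t i)] =
  (\prod_(i < n) lebesgue_measure (A i))%E.
Proof.
elim: n A => [|n IH] A mA.
  rewrite big_ord0 /= diracE mem_set//=; by case.
rewrite big_ord_recl /= /leb_step /pushforward.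
rewrite (_ : _ @^-1` _ = A ord0 `*`
    [set t : T n | forall i, A (lift ord0 i) (tnth t i)]).
  rewrite -IH; last by move=> i; exact: mA.
  rewrite product_measure1E//.
  rewrite (_ : [set _ | _] = \bigcap_(i in [set: 'I_n])
      ((fun t : T n => tnth t i) @^-1` A (lift ord0 i))); last first.
    by apply/seteqP; split => t /= h i; [move=> _|]; exact: h.
  apply: fin_bigcap_measurable => // i _.
  by rewrite -[X in measurable X]setTI; exact: measurable_tnth.
apply/seteqP; split => -[x t] /=.
  move=> h; split; first by have := h ord0.
  by move=> i; have := h (lift ord0 i); rewrite !(tnth_nth x).
move=> [h0 h] i; have [j ->|->//] := unliftP ord0 i.
by have := h j; rewrite !(tnth_nth x).
Qed.

End LebesgueTuple.

Section Euclidean.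
Context {R : realType} {n : nat}.

(* The library norm of 'rV[R]_n is the sup norm. *)
Definition enorm (x : 'rV[R]_n) : R := Num.sqrt (\sum_(i < n) x 0 i ^+ 2).

Definition rv (t : n.-tuple (measurableTypeR R)) : 'rV[R]_n :=
  \row_(i < n) tnth t i.

Definition cpartial (i : 'I_n) (f : 'rV[R]_n -> R[i]) (x : 'rV[R]_n) : R[i] :=
  'D_(delta_mx 0 i) (fun y => complex.Re (f y)) x +i*
  'D_(delta_mx 0 i) (fun y => complex.Im (f y)) x.

Definition cpartials (s : seq 'I_n) (f : 'rV[R]_n -> R[i]) : 'rV[R]_n -> R[i] :=
  foldr cpartial f s.

Definition csmooth (f : 'rV[R]_n -> R[i]) : Prop :=
  forall s : seq 'I_n,
    [/\ continuous (fun x => complex.Re (cpartials s f x)),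
        continuous (fun x => complex.Im (cpartials s f x)) &
        forall (i : 'I_n) (x : 'rV[R]_n),
          derivable (fun y => complex.Re (cpartials s f y)) x (delta_mx 0 i) /\
          derivable (fun y => complex.Im (cpartials s f y)) x (delta_mx 0 i)].

Definition cseminorm (K : set 'rV[R]_n) (N : nat) (g : 'rV[R]_n -> R[i]) :
    \bar R :=
  (\sum_(k < N.+1) \sum_(s : k.-tuple 'I_n)
    ereal_sup [set (normc (cpartials s g x))%:E | x in K])%E.

(* E'(R^n): continuous linear functionals on C^oo(R^n); the values of [u] off
   the smooth functions are irrelevant. *)
Definition compact_distribution (u : ('rV[R]_n -> R[i]) -> R[i]) : Prop :=
  (forall (a : R[i]) (g h : 'rV[R]_n -> R[i]), csmooth g -> csmooth h ->
    u (fun x => a * g x + h x) = a * u g + u h) /\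
  exists (K : set 'rV[R]_n) (N : nat) (c : R),
    [/\ compact K, 0 <= c &
        forall g, csmooth g -> ((normc (u g))%:E <= c%:E * cseminorm K N g)%E].

Definition fourier (u : ('rV[R]_n -> R[i]) -> R[i]) (zeta : 'rV[R[i]]_n) :
    R[i] :=
  u (fun x => cexp (- ((0 +i* 1) * \sum_(j < n) zeta 0 j * (x 0 j)%:C))).

Definition invertible (u : ('rV[R]_n -> R[i]) -> R[i]) : Prop :=
  exists2 A : R, 0 < A & forall xi : 'rV[R]_n,
    (((A + enorm xi) `^ (- A))%:E <
     ereal_sup [set (normc (fourier u (map_mx (real_complex R) eta)))%:E |
                eta in [set eta | (enorm (eta - xi)%R < A * ln (2 + enorm xi))%R]])%E.

Definition cintegrable_rV (f : 'rV[R]_n -> R[i]) : Prop :=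
  cintegrable (lebesgue_tuple n) setT (fun t => f (rv t)).

Definition distribution_of (f g : 'rV[R]_n -> R[i]) : R[i] :=
  cintegral (lebesgue_tuple n) setT (fun t => f (rv t) * g (rv t)).

End Euclidean.

(* Main.v *)
(* Near the unit sphere f is a sum of terms a_k (1 - |x|^2)_+^lambda_k and a
   remainder.  By Taylor's formula the remainder is a superposition
   int G(tau) (tau - |x|^2)_+^(N-1) dtau, where G has arbitrarily small mass if
   one works close enough to the sphere; the rest of f is integrable and
   supported in a strictly smaller ball.  The Fourier transform of
   (tau - |x|^2)_+^lambda is a constant times a Bessel-type function of |xi|
   decaying exactly like |xi|^(-Re lambda - (n+1)/2).

   The binomial average of the transform over the frequencies r, r-1, ..., r-K
   in a fixed direction w amounts to inserting cos((w.x -+ 1)/2)^K under the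
   integral.  For K of order log r this makes the contribution of the smaller
   ball negligible, whereas for a suitable sign one of the two oscillations
   e^(i r), e^(-i r) of the Bessel asymptotics survives, so that the leading term
   k = 0 dominates all the others.  Hence one of these K + 1 values is bounded
   below by a power of 1/r, which is invertibility.

   The Bessel asymptotics come from an energy estimate for the second order
   equation; that the transform does not vanish identically comes from the
   value beta(a) <> 0 at the origin. *)

Require Import Defs.
From HB Require Import structures.
From mathcomp Require Import all_boot all_order all_algebra.
From mathcomp Require Import complex ring lra.
From mathcomp Require Import all_classical all_reals all_analysis measurable_realfun.

Set Implicit Arguments.
Unset Strict Implicit.
Unset Printing Implicit Defensive.

Import Order.TTheory GRing.Theory Num.Theory.
Import ComplexField.Normc.
Import numFieldTopology.Exports numFieldNormedType.Exports.

Local Open Scope classical_set_scope.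
Local Open Scope ring_scope.
Local Open Scope complex_scope.


Local Notation Re := complex.Re.
Local Notation Im := complex.Im.

(** * Complex-valued functions of a real variable *)

(** Invertibility asks for a single good frequency within distance O(log r), which is why averages
    suffice: if all the averaged values were small, so would be their mean. The obstacle is the
    borderline case Re lambda_0 = N - 1. There the remainder is only known to decay as fast as the
    leading term, both like r^(-b) with b = Re lambda_0 + (n+1)/2, so comparing exponents cannot
    separate them and the mass of G has to be made small instead. This forces the order of the
    choices: the admissible mass depends only on the exponents and coefficients; it determines how
    close to the sphere the cut d is made; the cut determines the ratio cos((1 - sqrt d)/2) < 1 and
    hence the multiple of log r needed for K. Averaging over K + 1 frequencies is harmless for the
    Bessel factor because its slowly varying amplitudes change only by a relative O(K/r). Twisting
    by e^(-isj) freezes one oscillation and turns the other into e^(-2isj), whose average has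
    modulus (cos 1)^K. *)

Section ComplexBasics.
Context {R : realType}.
Implicit Types (z w a b : R[i]) (x y : R).

Lemma complex_ReM z w : Re (z * w) = Re z * Re w - Im z * Im w.
Proof. by case: z; case: w. Qed.

Lemma complex_ImM z w : Im (z * w) = Re z * Im w + Im z * Re w.
Proof. by case: z; case: w. Qed.

Lemma complex_ReD z w : Re (z + w) = Re z + Re w.
Proof. by case: z; case: w. Qed.

Lemma complex_ImD z w : Im (z + w) = Im z + Im w.
Proof. by case: z; case: w. Qed.

Lemma complex_ReN z : Re (- z) = - Re z.
Proof. by case: z. Qed.

Lemma complex_ImN z : Im (- z) = - Im z.
Proof. by case: z. Qed.

Lemma complex_Re_nat n : Re (n%:R : R[i]) = n%:R.
Proof. by rewrite -(rmorph_nat (real_complex R)). Qed.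

Lemma complex_Im_nat n : Im (n%:R : R[i]) = 0.
Proof. by rewrite -(rmorph_nat (real_complex R)). Qed.

Definition complexRI := (complex_ReM, complex_ImM, complex_ReD, complex_ImD,
  complex_ReN, complex_ImN, complex_Re_nat, complex_Im_nat).

Lemma complex_ext z w : Re z = Re w -> Im z = Im w -> z = w.
Proof. by case: z; case: w => /= ? ? ? ? -> ->. Qed.

Lemma normc_ge0 z : 0 <= normc z.
Proof. by case: z => ? ?; exact: sqrtr_ge0. Qed.

Lemma normcE2 z : normc z ^+ 2 = Re z ^+ 2 + Im z ^+ 2.
Proof. by case: z => ? ? /=; rewrite sqr_sqrtr// addr_ge0// sqr_ge0. Qed.

Lemma ler_normc_sqr z x : 0 <= x -> Re z ^+ 2 + Im z ^+ 2 <= x ^+ 2 ->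
  normc z <= x.
Proof. by move=> x0; rewrite -normcE2 ler_sqr// nnegrE ?normc_ge0. Qed.

Lemma normc_geRe z : `|Re z| <= normc z.
Proof.
rewrite -ler_sqr ?nnegrE ?normc_ge0// normcE2 real_normK ?num_real//.
by rewrite lerDl sqr_ge0.
Qed.

Lemma normc_geIm z : `|Im z| <= normc z.
Proof.
rewrite -ler_sqr ?nnegrE ?normc_ge0// normcE2 real_normK ?num_real//.
by rewrite lerDr sqr_ge0.
Qed.

Lemma normc_le_ReIm z : normc z <= `|Re z| + `|Im z|.
Proof.
apply: ler_normc_sqr; first exact: addr_ge0.
rewrite -(real_normK (num_real (Re z))) -(real_normK (num_real (Im z))).
have := normr_ge0 (Re z); have := normr_ge0 (Im z); nra.
Qed.

Lemma normc_real x : normc x%:C = `|x|.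
Proof. by rewrite /= expr0n/= addr0 sqrtr_sqr. Qed.

Lemma normc_nat n : normc (n%:R : R[i]) = n%:R.
Proof. by rewrite -(rmorph_nat (real_complex R)) normc_real normr_nat. Qed.

Lemma normc_eq0 z : (normc z == 0) = (z == 0).
Proof.
apply/eqP/eqP; first exact: eq0_normc.
by move=> ->; exact: normc0.
Qed.

Lemma normc_gt0 z : (0 < normc z) = (z != 0).
Proof. by rewrite lt_neqAle normc_ge0 andbT eq_sym normc_eq0. Qed.

Lemma normcB z w : normc (z - w) = normc (w - z).
Proof. by rewrite -normcN opprB. Qed.

Lemma le_normcB z w : normc z - normc w <= normc (z + w).
Proof.
by rewrite lerBlDr -(normcN w); have := le_normcD (z + w) (- w); rewrite addrK.
Qed.

Lemma le_normc_sum (I : Type) (s : seq I) (P : pred I) (F : I -> R[i]) :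
  normc (\sum_(i <- s | P i) F i) <= \sum_(i <- s | P i) normc (F i).
Proof.
elim/big_rec2: _ => [|i x z _ h]; first by rewrite normc0.
by apply: (le_trans (le_normcD _ _)); rewrite lerD2l.
Qed.

Lemma normcX z n : normc (z ^+ n) = normc z ^+ n.
Proof.
elim: n => [|n IH]; first by rewrite !expr0 normc1.
by rewrite !exprS normcM IH.
Qed.

Lemma cexp0 : cexp 0 = 1 :> R[i].
Proof. by rewrite /cexp /= expR0 cos0 sin0 mul1r. Qed.

Lemma cexpD z w : cexp (z + w) = cexp z * cexp w.
Proof.
rewrite /cexp; apply: complex_ext; rewrite !complexRI /= expRD ?cosD ?sinD; ring.
Qed.

Lemma cexp_real x : cexp x%:C = (expR x)%:C.
Proof. by rewrite /cexp /= cos0 sin0 mulr1. Qed.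

Lemma normc_cexp z : normc (cexp z) = expR (Re z).
Proof.
rewrite /cexp normcM normc_real ger0_norm ?expR_ge0// /normc cos2Dsin2 sqrtr1.
by rewrite mulr1.
Qed.

Lemma cpowD x a b : cpow x (a + b) = cpow x a * cpow x b.
Proof. by rewrite /cpow mulrDl cexpD. Qed.

Lemma cpowM x y a : 0 < x -> 0 < y -> cpow (x * y) a = cpow x a * cpow y a.
Proof. by move=> x0 y0; rewrite /cpow lnM ?posrE// rmorphD mulrDr cexpD. Qed.

Lemma normc_cpow x a : 0 < x -> normc (cpow x a) = x `^ Re a.
Proof.
move=> x0; rewrite /cpow normc_cexp complex_ReM /= mulr0 subr0 /powR.
by rewrite gt_eqF.
Qed.

Lemma cpow_real x y : 0 < x -> cpow x y%:C = (x `^ y)%:C.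
Proof.
by move=> x0; rewrite /cpow -rmorphM cexp_real /powR gt_eqF.
Qed.

Lemma cpow1 x : 0 < x -> cpow x 1 = x%:C.
Proof. by move=> x0; rewrite (cpow_real 1)// powRr1 ?ltW. Qed.

Lemma cpow_nat x n : 0 < x -> cpow x n%:R = (x ^+ n)%:C.
Proof.
move=> x0; rewrite -(rmorph_nat (real_complex R)) cpow_real//.
by rewrite powR_mulrn ?ltW.
Qed.

End ComplexBasics.

Section ComplexDerive.
Context {R : realType}.
Implicit Types (f g : R -> R[i]) (x : R) (c d e : R[i]).

Definition is_cderive x f d :=
  is_derive x 1 (fun t => Re (f t)) (Re d) /\
  is_derive x 1 (fun t => Im (f t)) (Im d).

Lemma is_cderive_eq x f d e : is_cderive x f d -> d = e -> is_cderive x f e.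
Proof. by move=> h <-. Qed.

Lemma is_cderive_ext x f g d : f =1 g -> is_cderive x f d -> is_cderive x g d.
Proof. by move=> /funext ->. Qed.

Lemma is_cderive_cst x c : is_cderive x (fun=> c) 0.
Proof. by split; exact: is_derive_cst. Qed.

Lemma is_cderive_real x (h : R -> R) (dh : R) :
  is_derive x 1 h dh -> is_cderive x (fun t => (h t)%:C) dh%:C.
Proof. by move=> H; split=> //=; exact: is_derive_cst. Qed.

Lemma is_cderiveD x f g d e : is_cderive x f d -> is_cderive x g e ->
  is_cderive x (fun t => f t + g t) (d + e).
Proof.
move=> [fr fi] [gr gi]; split; rewrite !complexRI.
  under [X in is_derive _ _ X _]eq_fun do rewrite complexRI.
  exact: is_deriveD.
under [X in is_derive _ _ X _]eq_fun do rewrite complexRI.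
exact: is_deriveD.
Qed.

Lemma is_cderiveM x f g d e : is_cderive x f d -> is_cderive x g e ->
  is_cderive x (fun t => f t * g t) (d * g x + f x * e).
Proof.
move=> [fr fi] [gr gi]; split; rewrite !complexRI.
  under [X in is_derive _ _ X _]eq_fun do rewrite complexRI.
  apply: is_derive_eq; rewrite /GRing.scale/=; ring.
under [X in is_derive _ _ X _]eq_fun do rewrite complexRI.
apply: is_derive_eq; rewrite /GRing.scale/=; ring.
Qed.

Lemma is_cderiveZ x f c d : is_cderive x f d ->
  is_cderive x (fun t => c * f t) (c * d).
Proof.
move=> H; apply: is_cderive_eq (is_cderiveM (is_cderive_cst x c) H) _.
by rewrite mul0r add0r.
Qed.

Lemma is_cderiveN x f d : is_cderive x f d ->
  is_cderive x (fun t => - f t) (- d).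
Proof.
move=> /(is_cderiveZ (-1)); rewrite mulN1r; apply: is_cderive_ext => t.
by rewrite mulN1r.
Qed.

Lemma is_cderiveB x f g d e : is_cderive x f d -> is_cderive x g e ->
  is_cderive x (fun t => f t - g t) (d - e).
Proof. by move=> F G; exact: is_cderiveD F (is_cderiveN G). Qed.

Lemma is_cderive_cexp x f d : is_cderive x f d ->
  is_cderive x (fun t => cexp (f t)) (d * cexp (f x)).
Proof.
move=> [fr fi].
have er : is_derive x 1 (fun t => expR (Re (f t))) (Re d * expR (Re (f x))).
  apply: is_derive_eq; rewrite /GRing.scale/=; ring.
have cr : is_derive x 1 (fun t => cos (Im (f t))) (- (Im d * sin (Im (f x)))).
  apply: is_derive_eq; rewrite /GRing.scale/=; ring.
have sr : is_derive x 1 (fun t => sin (Im (f t))) (Im d * cos (Im (f x))).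
  apply: is_derive_eq; rewrite /GRing.scale/=; ring.
rewrite /cexp; split.
  under [X in is_derive _ _ X _]eq_fun do rewrite !complexRI /= mul0r subr0.
  apply: is_derive_eq; rewrite !complexRI/= /GRing.scale/=; ring.
under [X in is_derive _ _ X _]eq_fun do rewrite !complexRI /= mul0r addr0.
apply: is_derive_eq; rewrite !complexRI/= /GRing.scale/=; ring.
Qed.

Lemma is_cderive_cpow x (h : R -> R) (dh : R) (a : R[i]) :
  is_derive x 1 h dh -> 0 < h x ->
  is_cderive x (fun t => cpow (h t) a) (dh%:C * a * cpow (h x) (a - 1)).
Proof.
move=> H x0; have lnh : is_derive x 1 (fun t => ln (h t)) (dh / h x).
  have h1 := is_derive1_ln x0.
  apply: is_derive_eq; rewrite /GRing.scale/=; ring.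
have := is_cderive_cexp (is_cderiveZ a (is_cderive_real lnh)).
move/is_cderive_eq; apply.
have -> : cexp (a * (ln (h x))%:C) = cpow (h x) (a - 1) * (h x)%:C.
  by rewrite -(cpow1 x0) -cpowD subrK.
rewrite fmorph_div /=; field; rewrite -(rmorph0 (real_complex R)) (inj_eq (@complexI _)).
by rewrite gt_eqF.
Qed.

Lemma is_cderive_expi x (s : R) :
  is_cderive x (fun t => cexp (0 +i* (s * t))) ((0 +i* s) * cexp (0 +i* (s * x))).
Proof.
apply: is_cderive_cexp; split=> /=; first exact: is_derive_cst.
by apply: is_derive_eq; rewrite /GRing.scale/=; ring.
Qed.

End ComplexDerive.

(** * Integrals of complex-valued functions *)

(** The measure need not be complete, so the measurability of [g] cannot be inherited from [f] and
    is assumed. *)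
Lemma ae_eq_integrable d (T : measurableType d) (R : realType)
    (mu : {measure set T -> \bar R}) (D : set T) (f g : T -> \bar R) :
  measurable D -> ae_eq mu D f g -> measurable_fun D g ->
  mu.-integrable D f -> mu.-integrable D g.
Proof.
move=> mD fg mg /integrableP[mf intf]; apply/integrableP; split => //.
rewrite -(ge0_ae_eq_integral (f := abse \o f))//.
- exact: measurableT_comp.
- exact: measurableT_comp.
- by move=> x _; exact: abse_ge0.
- by apply: filterS fg => x h /h /= ->.
Qed.

Section ComplexIntegral.
Context d (T : measurableType d) (R : realType).
Variable mu : {measure set T -> \bar R}.
Implicit Types (D : set T) (f g : T -> R[i]) (c : R[i]).

Definition cmeasurable D f :=
  measurable_fun D (fun x => Re (f x)) /\ measurable_fun D (fun x => Im (f x)).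

Lemma cmeasurable_cst D c : cmeasurable D (fun=> c).
Proof. by split; exact: measurable_cst. Qed.

Lemma cmeasurable_real D (h : T -> R) :
  measurable_fun D h -> cmeasurable D (fun x => (h x)%:C).
Proof. by move=> mh; split => //=; exact: measurable_cst. Qed.

Lemma cmeasurable_if0 (b : T -> bool) f : measurable_fun setT b ->
  cmeasurable setT f -> cmeasurable setT (fun x => if b x then f x else 0).
Proof.
move=> mb [mr mi]; split.
  rewrite (_ : (fun _ => _) = (fun x => if b x then Re (f x) else 0)).
    exact: measurable_fun_ifT.
  by apply/funext => x; case: ifP.
rewrite (_ : (fun _ => _) = (fun x => if b x then Im (f x) else 0)).
  exact: measurable_fun_ifT.
by apply/funext => x; case: ifP.
Qed.

Lemma cmeasurableD D f g : cmeasurable D f -> cmeasurable D g ->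
  cmeasurable D (fun x => f x + g x).
Proof.
move=> [f1 f2] [g1 g2]; split.
  under eq_fun do rewrite complexRI; exact: measurable_funD.
under eq_fun do rewrite complexRI; exact: measurable_funD.
Qed.

Lemma cmeasurableM D f g : cmeasurable D f -> cmeasurable D g ->
  cmeasurable D (fun x => f x * g x).
Proof.
move=> [f1 f2] [g1 g2]; split.
  under eq_fun do rewrite complexRI.
  by apply: measurable_funB; exact: measurable_funM.
under eq_fun do rewrite complexRI.
by apply: measurable_funD; exact: measurable_funM.
Qed.

Lemma cmeasurable_cexp D f : cmeasurable D f ->
  cmeasurable D (fun x => cexp (f x)).
Proof.
move=> [f1 f2]; apply: cmeasurableM.
  by apply: cmeasurable_real; exact: measurableT_comp.
split => /=.
  by apply: measurableT_comp => //; apply: continuous_measurable_fun; exact: continuous_cos.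
by apply: measurableT_comp => //; apply: continuous_measurable_fun; exact: continuous_sin.
Qed.

Lemma cmeasurable_cpow D (h : T -> R) (a : R[i]) : measurable_fun D h ->
  cmeasurable D (fun x => cpow (h x) a).
Proof.
move=> mh; apply: cmeasurable_cexp; apply: cmeasurableM.
  exact: cmeasurable_cst.
by apply: cmeasurable_real; apply: measurableT_comp.
Qed.

Lemma measurable_normc D f : cmeasurable D f ->
  measurable_fun D (fun x => normc (f x)).
Proof.
move=> [f1 f2].
rewrite (_ : (fun x => normc (f x)) =
    (fun x => Num.sqrt (Re (f x) ^+ 2 + Im (f x) ^+ 2))); last first.
  by apply/funext => x; case: (f x).
apply: measurableT_comp; first by apply: continuous_measurable_fun; exact: sqrt_continuous.
by apply: measurable_funD; exact: measurable_funX.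
Qed.

Lemma cintegrable_cmeasurable D f : cintegrable mu D f -> cmeasurable D f.
Proof.
by move=> [f1 f2]; split; apply/measurable_EFinP; exact: measurable_int f1 || exact: measurable_int f2.
Qed.

Lemma le_cintegrable D f (h : T -> R) : measurable D -> cmeasurable D f ->
  mu.-integrable D (EFin \o h) -> (forall x, D x -> normc (f x) <= h x) ->
  cintegrable mu D f.
Proof.
move=> mD [f1 f2] ih fh; split.
  apply: (le_integrable mD _ _ ih); first exact/measurable_EFinP.
  move=> x Dx /=; rewrite lee_fin (le_trans (normc_geRe _))//.
  by rewrite (le_trans (fh _ Dx))// ler_norm.
apply: (le_integrable mD _ _ ih); first exact/measurable_EFinP.
move=> x Dx /=; rewrite lee_fin (le_trans (normc_geIm _))//.
by rewrite (le_trans (fh _ Dx))// ler_norm.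
Qed.

Lemma cintegrable_normc D f : measurable D -> cintegrable mu D f ->
  mu.-integrable D (fun x => (normc (f x))%:E).
Proof.
move=> mD intf; have [mf1 mf2] := cintegrable_cmeasurable intf.
have [f1 f2] := intf.
have := integrableD mD (integrable_abse f1) (integrable_abse f2).
apply: le_integrable => //.
  exact/measurable_EFinP/measurable_normc.
move=> x Dx /=; rewrite lee_fin ger0_norm ?normc_ge0//.
by rewrite (le_trans (normc_le_ReIm _))// ler_norm.
Qed.

Lemma cintegrableD D f g : measurable D -> cintegrable mu D f ->
  cintegrable mu D g -> cintegrable mu D (fun x => f x + g x).
Proof.
move=> mD [f1 f2] [g1 g2]; split; under eq_fun do rewrite complexRI EFinD.
  exact: integrableD.
exact: integrableD.
Qed.

Lemma cintegrableMl D f g (M : R) : measurable D -> cintegrable mu D f ->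
  cmeasurable D g -> (forall x, D x -> normc (g x) <= M) ->
  cintegrable mu D (fun x => g x * f x).
Proof.
move=> mD intf mg gM.
have mf := cintegrable_cmeasurable intf.
apply: (le_cintegrable (h := fun x => M * normc (f x))) => //.
- exact: cmeasurableM.
- rewrite /comp; under eq_fun do rewrite EFinM.
  by apply: integrableZl => //; exact: cintegrable_normc.
- by move=> x Dx; rewrite normcM ler_wpM2r ?normc_ge0// gM.
Qed.

Lemma cintegrableZ D f c : measurable D -> cintegrable mu D f ->
  cintegrable mu D (fun x => c * f x).
Proof.
move=> mD intf; exact: (cintegrableMl (M := normc c)).
Qed.

Lemma cintegrableN D f : measurable D -> cintegrable mu D f ->
  cintegrable mu D (fun x => - f x).
Proof.
move=> mD /(cintegrableZ (-1) mD).
by rewrite (_ : (fun x => -1 * f x) = (fun x => - f x))//; apply/funext => x; rewrite mulN1r.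
Qed.

Lemma cintegrableB D f g : measurable D -> cintegrable mu D f ->
  cintegrable mu D g -> cintegrable mu D (fun x => f x - g x).
Proof. by move=> mD f1 g1; apply: cintegrableD => //; exact: cintegrableN. Qed.

Lemma cintegrable0 D : cintegrable mu D (fun=> 0).
Proof. by split; exact: integrable0. Qed.

Lemma cintegrable_sum D (I : Type) (s : seq I) (F : I -> T -> R[i]) :
  measurable D -> (forall i, cintegrable mu D (F i)) ->
  cintegrable mu D (fun x => \sum_(i <- s) F i x).
Proof.
move=> mD mF; elim: s => [|i s IH].
  by under eq_fun do rewrite big_nil; exact: cintegrable0.
by under eq_fun do rewrite big_cons; exact: cintegrableD.
Qed.

Lemma eq_cintegral D f g : (forall x, D x -> f x = g x) ->
  cintegral mu D f = cintegral mu D g.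
Proof.
move=> fg; rewrite /cintegral; congr (_ +i* _); apply: eq_Rintegral => x /set_mem Dx;
by rewrite fg.
Qed.

Lemma eq_cintegrable D f g : measurable D -> (forall x, D x -> f x = g x) ->
  cintegrable mu D f -> cintegrable mu D g.
Proof.
move=> mD fg [f1 f2]; split.
  by apply: eq_integrable f1 => // x /set_mem Dx; rewrite fg.
by apply: eq_integrable f2 => // x /set_mem Dx; rewrite fg.
Qed.

Lemma cintegralD D f g : measurable D -> cintegrable mu D f ->
  cintegrable mu D g ->
  cintegral mu D (fun x => f x + g x) = cintegral mu D f + cintegral mu D g.
Proof.
move=> mD [f1 f2] [g1 g2]; apply: complex_ext; rewrite !complexRI /=.
  by under eq_Rintegral do rewrite complexRI; exact: RintegralD.
by under eq_Rintegral do rewrite complexRI; exact: RintegralD.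
Qed.

Lemma cintegralZ D f c : measurable D -> cintegrable mu D f ->
  cintegral mu D (fun x => c * f x) = c * cintegral mu D f.
Proof.
move=> mD [f1 f2]; apply: complex_ext; rewrite !complexRI /=.
  under eq_Rintegral do rewrite complexRI.
  rewrite RintegralB//; last 2 first.
  - by rewrite /comp; under eq_fun do rewrite EFinM; exact: integrableZl.
  - by rewrite /comp; under eq_fun do rewrite EFinM; exact: integrableZl.
  by rewrite !RintegralZl.
under eq_Rintegral do rewrite complexRI.
rewrite RintegralD//; last 2 first.
- by rewrite /comp; under eq_fun do rewrite EFinM; exact: integrableZl.
- by rewrite /comp; under eq_fun do rewrite EFinM; exact: integrableZl.
by rewrite !RintegralZl.
Qed.

Lemma cintegralN D f : measurable D -> cintegrable mu D f ->
  cintegral mu D (fun x => - f x) = - cintegral mu D f.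
Proof.
move=> mD intf; rewrite -mulN1r -cintegralZ//.
by apply: eq_cintegral => x _; rewrite mulN1r.
Qed.

Lemma cintegralB D f g : measurable D -> cintegrable mu D f ->
  cintegrable mu D g ->
  cintegral mu D (fun x => f x - g x) = cintegral mu D f - cintegral mu D g.
Proof.
by move=> mD intf intg; rewrite cintegralD ?cintegralN//; exact: cintegrableN.
Qed.

Lemma cintegral0 D : cintegral mu D (fun=> 0) = 0.
Proof. by rewrite /cintegral/= /Rintegral integral0. Qed.

Lemma cintegral_sum D (I : Type) (s : seq I) (F : I -> T -> R[i]) :
  measurable D -> (forall i, cintegrable mu D (F i)) ->
  cintegral mu D (fun x => \sum_(i <- s) F i x) =
  \sum_(i <- s) cintegral mu D (F i).
Proof.
move=> mD mF; elim: s => [|i s IH].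
  by under eq_cintegral do rewrite big_nil; rewrite cintegral0 big_nil.
under eq_cintegral do rewrite big_cons.
by rewrite cintegralD ?big_cons ?IH//; exact: cintegrable_sum.
Qed.

(* The factor 2 comes from bounding the modulus by |Re| + |Im|. *)
Lemma normc_cintegral_le D f (h : T -> R) : measurable D ->
  cintegrable mu D f -> mu.-integrable D (EFin \o h) ->
  (forall x, D x -> normc (f x) <= h x) ->
  normc (cintegral mu D f) <= 2 * \int[mu]_(x in D) h x.
Proof.
move=> mD [f1 f2] ih fh; apply: (le_trans (normc_le_ReIm _)) => /=.
rewrite mulr2n mulrDl mul1r; apply: lerD.
  apply: (le_trans (le_normr_Rintegral _ _)) => //.
  apply: le_Rintegral => //; first exact: integrable_norm.
  by move=> x Dx; apply: (le_trans (normc_geRe _)); exact: fh.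
apply: (le_trans (le_normr_Rintegral _ _)) => //.
apply: le_Rintegral => //; first exact: integrable_norm.
by move=> x Dx; apply: (le_trans (normc_geIm _)); exact: fh.
Qed.

Lemma cintegral_mkcond D f :
  cintegral mu D f = cintegral mu setT (fun x => f x * (\1_D x)%:C).
Proof.
apply: complex_ext => /=; rewrite Rintegral_mkcond; apply: eq_Rintegral => x _;
by rewrite !complexRI /= patchE indicE; case: (x \in D);
  rewrite /= ?mulr1 ?mulr0 ?subr0 ?add0r ?addr0.
Qed.

Lemma cintegrable_mkcond D f : measurable D ->
  cintegrable mu D f -> cintegrable mu setT (fun x => f x * (\1_D x)%:C).
Proof.
move=> mD [f1 f2]; split.
  move/integrable_mkcond : f1 => /(_ mD); apply: eq_integrable => // x _.
  by rewrite patchE !complexRI/= indicE; case: ifP => _ /=; congr EFin; ring.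
move/integrable_mkcond : f2 => /(_ mD); apply: eq_integrable => // x _.
by rewrite patchE !complexRI/= indicE; case: ifP => _ /=; congr EFin; ring.
Qed.

Lemma cintegral_ae_eq f g : cintegrable mu setT f -> cmeasurable setT g ->
  (exists N, [/\ measurable N, mu N = 0%E & forall x, ~ N x -> f x = g x]) ->
  cintegrable mu setT g /\ cintegral mu setT g = cintegral mu setT f.
Proof.
move=> [f1 f2] [g1 g2] [N [mN N0 fgN]].
have ae1 : ae_eq mu setT (fun x => (Re (f x))%:E) (fun x => (Re (g x))%:E).
  exists N; split => // x /= /not_implyP[_ h].
  by apply: contrapT => /fgN E; apply: h; rewrite E.
have ae2 : ae_eq mu setT (fun x => (Im (f x))%:E) (fun x => (Im (g x))%:E).
  exists N; split => // x /= /not_implyP[_ h].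
  by apply: contrapT => /fgN E; apply: h; rewrite E.
split; last first.
  rewrite /cintegral /Rintegral; congr (fine _ +i* fine _).
    apply/esym/ae_eq_integral => //; apply/measurable_EFinP => //.
    by have [] := cintegrable_cmeasurable (conj f1 f2).
  apply/esym/ae_eq_integral => //; apply/measurable_EFinP => //.
  by have [] := cintegrable_cmeasurable (conj f1 f2).
split.
  by apply: ae_eq_integrable ae1 _ f1 => //; exact/measurable_EFinP.
by apply: ae_eq_integrable ae2 _ f2 => //; exact/measurable_EFinP.
Qed.

End ComplexIntegral.

Section ComplexFubini.
Context d1 d2 (T1 : measurableType d1) (T2 : measurableType d2) (R : realType).
Variables (m1 : {sigma_finite_measure set T1 -> \bar R})
  (m2 : {sigma_finite_measure set T2 -> \bar R}).

(** [fine] sends an infinite inner integral to 0, so the real-valued inner integral agrees with the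
    extended one only almost everywhere. By Fubini the exceptional sections form a null set, and the
    outer integrals coincide. *)
Lemma Rintegral_prod1 (f : T1 * T2 -> R) :
  (m1 \x m2)%E.-integrable setT (EFin \o f) ->
  m1.-integrable setT (fun x => (\int[m2]_y f (x, y))%:E) /\
  (\int[m1]_x \int[m2]_y f (x, y) = \int[(m1 \x m2)%E]_z f z)%R.
Proof.
move=> intf.
have ae : ae_eq m1 setT (fun x => \int[m2]_y (f (x, y))%:E)%E
    (fun x => (\int[m2]_y f (x, y))%:E).
  have := ae_integrable1 intf; apply: filterS => x ix _.
  by rewrite /Rintegral fineK//; exact: integrable_fin_num.
have intF := integrable_fubini_F intf.
have mF := measurable_int _ intF.
have mF' : measurable_fun setT (fun x => (\int[m2]_y f (x, y))%:E).
  apply/measurable_EFinP; exact: measurableT_comp.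
split; first exact: ae_eq_integrable ae mF' intF.
rewrite {1}/Rintegral; congr fine.
rewrite -(integral12_prod_meas1 intf).
by apply/esym/ae_eq_integral.
Qed.

Lemma Rintegral_prod2 (f : T1 * T2 -> R) :
  (m1 \x m2)%E.-integrable setT (EFin \o f) ->
  m2.-integrable setT (fun y => (\int[m1]_x f (x, y))%:E) /\
  (\int[m2]_y \int[m1]_x f (x, y) = \int[(m1 \x m2)%E]_z f z)%R.
Proof.
move=> intf.
have ae : ae_eq m2 setT (fun y => \int[m1]_x (f (x, y))%:E)%E
    (fun y => (\int[m1]_x f (x, y))%:E).
  have := ae_integrable2 intf; apply: filterS => x ix _.
  by rewrite /Rintegral fineK//; exact: integrable_fin_num.
have mG := measurable_fubini_G intf.
have intG : m2.-integrable setT (fubini_G m1 (EFin \o f)).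
  apply/integrableP; split => //.
  have mf := measurable_int _ intf.
  apply: le_lt_trans ((integrable21ltyP m1 m2 mf).1 intf).
  apply: ge0_le_integral => //.
  - exact: measurableT_comp.
  - apply: (measurable_fun_fubini_tonelli_G (abse \o (EFin \o f))) => //=.
    exact: measurableT_comp.
  - by move=> y _; apply: le_abse_integral => //; exact: measurableT_comp.
have mF' : measurable_fun setT (fun y => (\int[m1]_x f (x, y))%:E).
  apply/measurable_EFinP; exact: measurableT_comp.
split; first exact: ae_eq_integrable ae mF' intG.
rewrite {1}/Rintegral; congr fine.
rewrite -(integral21_prod_meas1 intf).
by apply/esym/ae_eq_integral.
Qed.

Lemma cFubini1 (f : T1 * T2 -> R[i]) : cintegrable (m1 \x m2)%E setT f ->
  cintegrable m1 setT (fun x => cintegral m2 setT (fun y => f (x, y))) /\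
  cintegral m1 setT (fun x => cintegral m2 setT (fun y => f (x, y))) =
  cintegral (m1 \x m2)%E setT f.
Proof.
move=> [/Rintegral_prod1[i1 e1] /Rintegral_prod1[i2 e2]].
by split; [split|rewrite /cintegral/= e1 e2].
Qed.

Lemma cFubini2 (f : T1 * T2 -> R[i]) : cintegrable (m1 \x m2)%E setT f ->
  cintegrable m2 setT (fun y => cintegral m1 setT (fun x => f (x, y))) /\
  cintegral m2 setT (fun y => cintegral m1 setT (fun x => f (x, y))) =
  cintegral (m1 \x m2)%E setT f.
Proof.
move=> [/Rintegral_prod2[i1 e1] /Rintegral_prod2[i2 e2]].
by split; [split|rewrite /cintegral/= e1 e2].
Qed.

(** Tonelli's criterion in the form in which it is applied to truncated powers, whose slice
    integrals are known in closed form. *)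
Lemma integrable_prod_bound (g : T1 * T2 -> R) (F : T1 -> R) :
  measurable_fun setT g -> (forall z, 0 <= g z) ->
  (forall x, \int[m2]_y (g (x, y))%:E = (F x)%:E)%E ->
  m1.-integrable setT (EFin \o F) ->
  (m1 \x m2)%E.-integrable setT (EFin \o g).
Proof.
move=> mg g0 gF /integrableP[mF intF].
apply/integrable12ltyP; first exact/measurable_EFinP.
under eq_integral => x _.
  under eq_integral => y _ do rewrite /= ger0_norm//.
  rewrite gF; over.
apply: le_lt_trans intF; apply: ge0_le_integral => //.
- move=> x _; rewrite -gF; apply: integral_ge0 => y _; exact: g0.
- exact: measurableT_comp.
- by move=> x _ /=; rewrite lee_fin ler_norm.
Qed.

End ComplexFubini.

(** * Change of variables along a map carrying one measure to another *)

Section Transport.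
Context d1 d2 (T1 : measurableType d1) (T2 : measurableType d2) (R : realType).
Variables (mu : {measure set T1 -> \bar R}) (nu : {measure set T2 -> \bar R}).
Variable phi : T1 -> T2.
Hypothesis mphi : measurable_fun setT phi.
Hypothesis nuE : forall A, measurable A -> nu A = mu (phi @^-1` A).

Let integralE_nu (g : T2 -> \bar R) :
  (\int[nu]_x g x = \int[pushforward mu phi]_x g x)%E.
Proof. by apply: eq_measure_integral => // A mA _; exact: nuE. Qed.

Lemma ge0_integral_transport (g : T2 -> \bar R) :
  measurable_fun setT g -> (forall x, 0 <= g x)%E ->
  (\int[nu]_x g x = \int[mu]_x g (phi x))%E.
Proof.
by move=> mg g0; rewrite integralE_nu ge0_integral_pushforward.
Qed.

Lemma integrable_transport (g : T2 -> \bar R) : measurable_fun setT g ->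
  nu.-integrable setT g <-> mu.-integrable setT (g \o phi).
Proof.
move=> mg; have E : (\int[nu]_x `|g x| = \int[mu]_x `|g (phi x)|)%E.
  by rewrite ge0_integral_transport//; exact: measurableT_comp.
split=> /integrableP[_ h]; apply/integrableP; split => //.
- exact: measurableT_comp.
- by rewrite -E.
- by rewrite E.
Qed.

Lemma integral_transport (g : T2 -> \bar R) : measurable_fun setT g ->
  mu.-integrable setT (g \o phi) ->
  (\int[nu]_x g x = \int[mu]_x g (phi x))%E.
Proof.
move=> mg ig; rewrite integralE_nu (integral_pushforward mphi)//.
Qed.

Lemma cintegrable_transport (f : T2 -> R[i]) : cmeasurable setT f ->
  cintegrable nu setT f <-> cintegrable mu setT (f \o phi).
Proof.
move=> [mf1 mf2]; split=> -[h1 h2]; split.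
- by apply/(integrable_transport _).1 : h1; exact/measurable_EFinP.
- by apply/(integrable_transport _).1 : h2; exact/measurable_EFinP.
- by apply/(integrable_transport _).2 => //; exact/measurable_EFinP.
- by apply/(integrable_transport _).2 => //; exact/measurable_EFinP.
Qed.

Lemma cintegral_transport (f : T2 -> R[i]) : cmeasurable setT f ->
  cintegrable mu setT (f \o phi) ->
  cintegral nu setT f = cintegral mu setT (f \o phi).
Proof.
move=> [mf1 mf2] [i1 i2]; rewrite /cintegral /Rintegral.
congr (fine _ +i* fine _); apply: integral_transport => //;
  exact/measurable_EFinP.
Qed.

End Transport.

Section LebesgueSubstitution.
Context {R : realType}.
Local Notation leb := (@lebesgue_measure R).

(** By uniqueness of Lebesgue measure it is enough to evaluate the push-forward on half-open
    intervals. *)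
Lemma lebesgue_measure_shift (t : R) (A : set (measurableTypeR R)) :
  measurable A ->
  leb A = leb ((fun x : measurableTypeR R => x + t : measurableTypeR R) @^-1` A).
Proof.
move=> mA; have mphi : measurable_fun [set: measurableTypeR R]
  (fun x : measurableTypeR R => x + t : measurableTypeR R).
  exact: measurable_funD.
pose phi := fun x : measurableTypeR R => x + t : measurableTypeR R.
have [M ME] : exists M : {measure set (measurableTypeR R) -> \bar R},
    forall B, M B = leb (phi @^-1` B).
  by exists (measure_function_pushforward__canonical__measure_function_Measure leb mphi).
rewrite -ME; apply: lebesgue_measure_unique => // _ [[a b]] _ <-.
rewrite ME (_ : _ @^-1` _ = `]a - t, b - t]%classic); last first.
  by apply/seteqP; split => x /=; rewrite !in_itv/= ltrBlDr lerBrDr.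
by rewrite /= !lebesgue_measure_itv/= !lte_fin ltrD2r -!EFinB opprB addrA subrK.
Qed.

Lemma lebesgue_measure_scale (c : R) (A : set (measurableTypeR R)) :
  0 < c -> measurable A -> (leb A = c%:E *
    leb ((fun x : measurableTypeR R => (c * x)%R : measurableTypeR R) @^-1` A))%E.
Proof.
move=> c0 mA; have mphi : measurable_fun [set: measurableTypeR R]
  (fun x : measurableTypeR R => c * x : measurableTypeR R).
  exact: measurable_funM.
pose phi := fun x : measurableTypeR R => c * x : measurableTypeR R.
have [M ME] : exists M : {measure set (measurableTypeR R) -> \bar R},
    forall B, M B = leb (phi @^-1` B).
  by exists (measure_function_pushforward__canonical__measure_function_Measure leb mphi).
rewrite -[leb (_ @^-1` _)]ME -[RHS]/(mscale (NngNum (ltW c0)) M A).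
apply: lebesgue_measure_unique => // _ [[a b]] _ <-.
rewrite /= /mscale /= ME.
rewrite (_ : _ @^-1` _ = `]a / c, b / c]%classic); last first.
  by apply/seteqP; split => x /=; rewrite !in_itv/= ltr_pdivrMr// ler_pdivlMr// mulrC.
rewrite /= !lebesgue_measure_itv/= !lte_fin ltr_pM2r ?invr_gt0//.
case: ifP => ab; last by rewrite mule0.
by rewrite -!EFinB -EFinM -mulrBl mulrC divfK// gt_eqF.
Qed.

Lemma cintegral_opp (f : measurableTypeR R -> R[i]) : cmeasurable setT f ->
  cintegrable leb setT f ->
  cintegrable leb setT (fun x : measurableTypeR R => f (- x)) /\
  cintegral leb setT (fun x : measurableTypeR R => f (- x)) = cintegral leb setT f.
Proof.
move=> mf intf.
have mphi : measurable_fun [set: measurableTypeR R]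
  (fun x : measurableTypeR R => - x : measurableTypeR R).
  exact: measurable_funN.
have nuE (A : set (measurableTypeR R)) : measurable A ->
    leb A = leb ((fun x : measurableTypeR R => - x : measurableTypeR R) @^-1` A).
  by move=> mA; rewrite -[LHS]lebesgue_measureN.
have h := (cintegrable_transport mphi nuE mf).1 intf.
by split; [exact: h|]; exact/esym/(cintegral_transport mphi nuE mf h).
Qed.

Lemma cintegral_scale (f : measurableTypeR R -> R[i]) (c : R) : 0 < c -> cmeasurable setT f ->
  cintegrable leb setT f ->
  cintegrable leb setT (fun x : measurableTypeR R => f (c * x)) /\
  cintegral leb setT f = c%:C * cintegral leb setT (fun x : measurableTypeR R => f (c * x)).
Proof.
move=> c0 mf intf.
have mphi : measurable_fun [set: measurableTypeR R]
  (fun x : measurableTypeR R => c * x : measurableTypeR R).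
  exact: measurable_funM.
pose k := NngNum (ltW c0).
have nuE (A : set (measurableTypeR R)) : measurable A ->
    leb A = mscale k leb ((fun x : measurableTypeR R => c * x : measurableTypeR R) @^-1` A).
  by move=> mA; rewrite /mscale/=; exact: lebesgue_measure_scale.
have h := (cintegrable_transport (mu := mscale k leb) mphi nuE mf).1 intf.
have mfc : cmeasurable setT (fun x => f (c * x)).
  by case: mf => mf1 mf2; split; [apply: (measurableT_comp mf1)|
    apply: (measurableT_comp mf2)].
(* Integrals against the scaled measure are brought back to Lebesgue measure; c > 0 is what lets
   finiteness pass in this direction. *)
have E (g : R -> R) : (mscale k leb).-integrable setT (EFin \o g) ->
    measurable_fun setT g -> leb.-integrable setT (EFin \o g) /\
    \int[mscale k leb]_x g x = c * \int[leb]_x g x.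
  move=> /integrableP[mg ig] mg'.
  have ig' : leb.-integrable setT (EFin \o g).
    apply/integrableP; split => //; move: ig.
    rewrite ge0_integral_mscale//; last exact: measurableT_comp.
    have : (0 <= \int[leb]_x `|(EFin \o g) x|)%E by exact: integral_ge0.
    case: (\int[leb]_x `|(EFin \o g) x|)%E => [r _ _|_|//]; first exact: ltry.
    by rewrite gt0_muley// lte_fin.
  split => //; rewrite /Rintegral integralE [in RHS]integralE.
  rewrite !ge0_integral_mscale//; last 2 first.
  - exact: measurable_funeneg.
  - exact: measurable_funepos.
  have /fineK <- := integrable_pos_fin_num measurableT ig'.
  have /fineK <- := integrable_neg_fin_num measurableT ig'.
  by rewrite /= mulrBr.
case: h => /= h1 h2; case: mfc => m1 m2.
have [e1 e1'] := E _ h1 m1; have [e2 e2'] := E _ h2 m2.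
split => //; rewrite (cintegral_transport (mu := mscale k leb) mphi nuE)//.
by apply: complex_ext; rewrite !complexRI /= ?e1' ?e2' mul0r ?subr0 ?addr0.
Qed.

End LebesgueSubstitution.

(** * Improper integrals *)

Section RealImproper.
Context {R : realType}.
Local Notation leb := (@lebesgue_measure R).
Implicit Types (a b x y : R) (f F : R -> R).

Lemma is_derive_continuous F x (l : R) : is_derive x 1 F l ->
  {for x, continuous F}.
Proof. by move=> H; apply: differentiable_continuous; apply/derivable1_diffP. Qed.

Lemma FTC_cc a b f F : a < b ->
  (forall x, a <= x <= b -> is_derive x 1 F (f x)) ->
  (forall x, a <= x <= b -> {for x, continuous f}) ->
  (\int[leb]_(x in `[a, b]) (f x)%:E = (F b - F a)%:E)%E.
Proof.
move=> ab dF cf; rewrite EFinB; apply: continuous_FTC2 => //.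
- apply: continuous_in_subspaceT => x; rewrite inE/= in_itv/= => xab.
  exact: cf.
- split.
  + move=> x; rewrite in_itv/= => /andP[ax xb].
    by have := dF x; rewrite !ltW// => /(_ isT) [].
  + apply: cvg_at_right_filter; apply: (@is_derive_continuous F a (f a)).
    by apply: dF; rewrite lexx ltW.
  + apply: cvg_at_left_filter; apply: (@is_derive_continuous F b (f b)).
    by apply: dF; rewrite lexx ltW.
- move=> x; rewrite in_itv/= => /andP[ax xb].
  rewrite derive1E; have := dF x; rewrite !ltW// => /(_ isT) dFx.
  exact: derive_val.
Qed.

Lemma open_continuous_measurable_oo a b f :
  (forall x, a < x < b -> {for x, continuous f}) ->
  measurable_fun `]a, b[ f.
Proof.
move=> cf; apply: open_continuous_measurable_fun; first exact: interval_open.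
by move=> x; rewrite inE/= in_itv/=; exact: cf.
Qed.

(** No control of [f] at the endpoints is required: on compact subintervals the integral is a
    difference of values of the primitive, hence at most 2M, and monotone convergence exhausts the
    open interval. *)
Lemma primitive_bounded_integrable a b f F (M : R) : a < b ->
  (forall x, a < x < b -> 0 <= f x) ->
  (forall x, a < x < b -> is_derive x 1 F (f x)) ->
  (forall x, a < x < b -> {for x, continuous f}) ->
  (forall x, a < x < b -> `|F x| <= M) ->
  leb.-integrable `]a, b[ (EFin \o f).
Proof.
move=> ab f0 dF cf FM.
have mf : measurable_fun `]a, b[ (EFin \o f).
  by apply/measurable_EFinP; exact: open_continuous_measurable_oo.
apply/integrableP; split => //.
pose c := (a + b) / 2.
(* The denominator n + 2 keeps the margin strictly below half the length, so the exhausting segments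
   are nondegenerate already for n = 0. *)
pose d (n : nat) := (b - a) / 2 * (n.+2%:R)^-1.
have d0 n : 0 < d n by rewrite mulr_gt0// ?invr_gt0// divr_gt0// subr_gt0.
have dlt n : d n < (b - a) / 2.
  rewrite /d ltr_pdivrMr// ltr_pMr ?divr_gt0 ?subr_gt0//.
  by rewrite (ltr_nat _ 1).
pose S n : set R := `[a + d n, b - d n]%classic.
have Sab n x : S n x -> a < x < b.
  rewrite /S/= in_itv/= => /andP[h1 h2]; apply/andP; split.
    by apply: lt_le_trans h1; rewrite ltrDl.
  by apply: le_lt_trans h2 _; rewrite ltrBlDr ltrDl.
have dnincr m n : (m <= n)%N -> d n <= d m.
  move=> mn; rewrite /d ler_pM2l ?divr_gt0 ?subr_gt0//.
  by rewrite lef_pV2 ?posrE// ler_nat.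
have Sincr m n : (m <= n)%N -> S m `<=` S n.
  move=> mn x; rewrite /S/= !in_itv/= => /andP[h1 h2]; apply/andP; split.
    by apply: le_trans h1; rewrite lerD2l dnincr.
  by apply: le_trans h2 _; rewrite lerD2l lerN2 dnincr.
have US : \bigcup_n S n = `]a, b[%classic.
  apply/seteqP; split=> x /=.
    by move=> [n _ /Sab]; rewrite in_itv.
  rewrite in_itv/= => /andP[ax xb].
  have dcvg : d n @[n --> \oo] --> 0.
    rewrite -[0](mulr0 ((b - a) / 2)); apply: cvgMr.
    by have := @cvg_harmonic R; rewrite -cvg_shiftS.
  have e0 : 0 < Num.min (x - a) (b - x) by rewrite lt_min !subr_gt0 ax.
  have /cvgrPdist_lt/(_ _ e0)[n _ /(_ n (leqnn n))] := dcvg.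
  rewrite sub0r normrN gtr0_norm// lt_min => /andP[h1 h2].
  exists n => //; rewrite /S/= in_itv/=; apply/andP; split.
    by rewrite -lerBrDl ltW.
  by rewrite lerBrDr -lerBrDl ltW.
have mS n : measurable (S n) by exact: measurable_itv.
rewrite -US.
have H : (\int[leb]_(x in S n) `|(f x)%:E| @[n --> \oo] -->
   \int[leb]_(x in \bigcup_n S n) `|(f x)%:E|)%E.
  apply: ge0_nondecreasing_set_cvg_integral.
  - by move=> m n mn; apply/subsetPset; exact: Sincr.
  - exact: mS.
  - by move=> n; apply: measurableT_comp => //; apply: measurable_funS mf => // x /Sab; rewrite /= in_itv.
  - by move=> n x _; exact: abse_ge0.
apply: (@le_lt_trans _ _ (2 * M)%:E); last exact: ltry.
rewrite -(cvg_lim _ H)//; apply: lime_le.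
  by apply/cvg_ex; eexists; exact: H.
apply: nearW => n /=.
have ->: (\int[leb]_(x in S n) `|(f x)%:E| = \int[leb]_(x in S n) (f x)%:E)%E.
  by apply: eq_integral => x /set_mem /Sab xab; rewrite gee0_abs// lee_fin f0.
have abn : a + d n < b - d n.
  by have := dlt n; have := d0 n; rewrite /d; move: (_ * _) => u; lra.
have HF x : a + d n <= x <= b - d n -> is_derive x 1 F (f x).
  by move=> xn; apply: dF; apply: (@Sab n); rewrite /S/= in_itv.
have HC x : a + d n <= x <= b - d n -> {for x, continuous f}.
  by move=> xn; apply: cf; apply: (@Sab n); rewrite /S/= in_itv.
rewrite (FTC_cc abn HF HC).
have hb : a < b - d n < b by have := dlt n; have := d0 n; move: (d n) => u; lra.
have ha : a < a + d n < b by have := dlt n; have := d0 n; move: (d n) => u; lra.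
have := FM _ hb; have := FM _ ha; rewrite lee_fin !ler_norml; lra.
Qed.

(** The fundamental theorem is applied on compact subintervals; continuity of the indefinite
    integral then lets first the right and afterwards the left endpoint tend to its limit. *)
Lemma improper_FTC a b f F (la lb : R) : a < b ->
  (forall x, a < x < b -> is_derive x 1 F (f x)) ->
  (forall x, a < x < b -> {for x, continuous f}) ->
  leb.-integrable `]a, b[ (EFin \o f) ->
  F x @[x --> a^'+] --> la -> F x @[x --> b^'-] --> lb ->
  \int[leb]_(x in `]a, b[) f x = lb - la.
Proof.
move=> ab dF cf intf Fa Fb.
pose g := f \_ `]a, b[.
have intg : leb.-integrable setT (EFin \o g).
  by move/integrable_mkcond : intf => /(_ (measurable_itv _)); rewrite /g restrict_EFin.
have intg' (A : set R) : measurable A -> leb.-integrable A (EFin \o g).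
  by move=> mA; exact: integrableS intg.
pose I x := \int[leb]_(t in `[a, x]) g t.
have IE x y : a < x -> x < y -> y < b -> I y - I x = F y - F x.
  move=> ax xy yb.
  rewrite /I Rintegral_itvB//; last 3 first.
  - exact: intg'.
  - by rewrite bnd_simp ltW.
  - by rewrite bnd_simp ltW.
  rewrite Rintegral_itv_obnd_cbnd; last exact: intg'.
  have E : \int[leb]_(t in `[x, y]) g t = \int[leb]_(t in `[x, y]) f t.
    apply: eq_Rintegral => t /set_mem /=; rewrite in_itv/= => /andP[xt ty].
    rewrite /g patchE mem_set//= in_itv/=.
    by rewrite (lt_le_trans ax)//= (le_lt_trans ty).
  have HF z : x <= z <= y -> is_derive z 1 F (f z).
    by move=> /andP[xz zy]; apply: dF; rewrite (lt_le_trans ax)//= (le_lt_trans zy).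
  have HC z : x <= z <= y -> {for z, continuous f}.
    by move=> /andP[xz zy]; apply: cf; rewrite (lt_le_trans ax)//= (le_lt_trans zy).
  by rewrite E /Rintegral (FTC_cc xy HF HC).
have Ib : I x @[x --> b^'-] --> I b.
  by apply: parameterized_integral_cvg_at_left => //; exact: intg'.
have Ia : I x @[x --> a^'+] --> 0.
  have := @parameterized_integral_cvg_left R a b g ab (intg' _ (measurable_itv _)).
  exact: cvg_at_right_filter.
have E1 x : a < x < b -> I b - I x = lb - F x.
  move=> /andP[ax xb].
  have h1 : (I y - I x) @[y --> b^'-] --> I b - I x by apply: cvgB => //; exact: cvg_cst.
  have h2 : (F y - F x) @[y --> b^'-] --> lb - F x by apply: cvgB => //; exact: cvg_cst.
  have h3 : (I y - I x) @[y --> b^'-] --> lb - F x.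
    apply: cvg_trans h2; apply: near_eq_cvg; near=> y.
    apply/esym/IE => //; by near: y; exact: nbhs_left_gt.
  exact: (cvg_unique _ h1 h3).
have E2 : I b = lb - la.
  have h1 : (I b - I x) @[x --> a^'+] --> I b - 0 by apply: cvgB => //; exact: cvg_cst.
  have h2 : (lb - F x) @[x --> a^'+] --> lb - la by apply: cvgB => //; exact: cvg_cst.
  have h3 : (I b - I x) @[x --> a^'+] --> lb - la.
    apply: cvg_trans h2; apply: near_eq_cvg; near=> x.
    by apply/esym/E1/andP; split; near: x; [exact: nbhs_right_gt|exact: nbhs_right_lt].
  by have := cvg_unique _ h1 h3; rewrite subr0; apply.
rewrite -E2 Rintegral_mkcond -/g.
rewrite /I [in RHS]Rintegral_mkcond; apply: eq_Rintegral => x _.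
rewrite [RHS]patchE; case: ifPn => // /negP xab; rewrite /g patchE.
case: ifPn => // /set_mem /= h; exfalso; apply: xab; apply/mem_set => /=.
by move: h; rewrite !in_itv/= => /andP[/ltW -> /ltW ->].
Unshelve. all: by end_near. Qed.

End RealImproper.

Section ImproperComplex.
Context {R : realType}.
Local Notation leb := (@lebesgue_measure R).

Lemma normc_cvg0_ReIm (F : set_system R) (FF : Filter F) (f : R -> R[i])
    (l : R[i]) : normc (f x - l) @[x --> F] --> 0 ->
  Re (f x) @[x --> F] --> Re l /\ Im (f x) @[x --> F] --> Im l.
Proof.
move=> H; split; apply/cvgrPdist_lt => e e0;
move/cvgrPdist_lt : H => /(_ e e0); apply: filterS => x;
rewrite sub0r normrN ger0_norm ?normc_ge0//; apply: le_lt_trans.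
  by rewrite distrC -complex_ReN -complex_ReD normc_geRe.
by rewrite distrC -complex_ImN -complex_ImD normc_geIm.
Qed.

Lemma cimproper_FTC (a b : R) (f F : R -> R[i]) (la lb : R[i]) : a < b ->
  (forall x, a < x < b -> is_cderive x F (f x)) ->
  (forall x, a < x < b -> {for x, continuous (fun t => Re (f t))} /\
    {for x, continuous (fun t => Im (f t))}) ->
  cintegrable leb `]a, b[ f ->
  normc (F x - la) @[x --> a^'+] --> 0 ->
  normc (F x - lb) @[x --> b^'-] --> 0 ->
  cintegral leb `]a, b[ f = lb - la.
Proof.
move=> ab dF cf [i1 i2] /normc_cvg0_ReIm[a1 a2] /normc_cvg0_ReIm[b1 b2].
apply: complex_ext; rewrite /cintegral /= !complexRI.
  apply: (improper_FTC ab _ _ i1 a1 b1) => x xab; first exact: (dF x xab).1.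
  exact: (cf x xab).1.
apply: (improper_FTC ab _ _ i2 a2 b2) => x xab; first exact: (dF x xab).2.
exact: (cf x xab).2.
Qed.

Lemma is_cderive_continuous (x : R) (f : R -> R[i]) d : is_cderive x f d ->
  {for x, continuous (fun t => Re (f t))} /\
  {for x, continuous (fun t => Im (f t))}.
Proof. by move=> [h1 h2]; split; exact: is_derive_continuous. Qed.

Lemma near_eq_continuous_at (f g : R -> R) (x : R) :
  (\forall t \near x, f t = g t) -> {for x, continuous g} ->
  {for x, continuous f}.
Proof.
move=> E cg; rewrite /prop_for /continuous_at (nbhs_singleton E).
apply: cvg_trans cg; apply: near_eq_cvg; apply: filterS E => t; exact: esym.
Qed.

Lemma cvg_powR0 (F : set_system R) (FF : Filter F) (g : R -> R) (q : R) :
  0 < q -> (\forall x \near F, 0 <= g x) ->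
  g x @[x --> F] --> 0 -> (g x) `^ q @[x --> F] --> 0.
Proof.
move=> q0 g0 H; apply/cvgrPdist_lt => e e0.
have e0' : 0 < e `^ q^-1 by rewrite powR_gt0.
move/cvgrPdist_lt : H => /(_ _ e0'); apply: filterS2 g0 => x gx.
rewrite !sub0r !normrN ger0_norm// (ger0_norm (powR_ge0 _ _)) => h.
rewrite -[e](powRr1 (ltW e0)) -(mulVf (lt0r_neq0 q0)) powRrM.
by apply: gt0_ltr_powR => //; rewrite nnegrE ?powR_ge0.
Qed.

Lemma is_derive_powR_comp (x : R) (g : R -> R) (dg q : R) :
  is_derive x 1 g dg -> 0 < g x ->
  is_derive x 1 (fun t => g t `^ q) (dg * (q * g x `^ (q - 1))).
Proof.
move=> dgx gx0; have h := @is_derive1_powR R q (g x) gx0.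
have := @is_derive1_comp R (@powR R ^~ q) g x _ _ h dgx.
by move=> H; apply: is_derive_eq H _; rewrite mulrC.
Qed.

Lemma cos_ge1B (t : R) : 1 - `|t| <= cos t.
Proof.
rewrite -cos_norm; have := normr_ge0 t; move: `|t| => u u0.
have [|c _] := @MVT_segment R cos (fun x => - sin x) 0 u u0.
  by apply: continuous_subspaceT => x; exact: continuous_cos.
rewrite cos0 subr0 => /eqP; rewrite subr_eq => /eqP ->.
have := sin_le1 c; nra.
Qed.

End ImproperComplex.

(** * Truncated powers and the beta integral *)

Section Kpow.
Context {R : realType}.
Local Notation leb := (@lebesgue_measure R).
Implicit Types (a : R[i]) (s T : R).

(** The truncated power [T_+^a]. The test imposes the value 0 for T <= 0, where [cpow] has no
    meaning. *)
Definition kpow a T : R[i] := if 0 < T then cpow T a else 0.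

Lemma kpow_gt0 a T : 0 < T -> kpow a T = cpow T a.
Proof. by rewrite /kpow => ->. Qed.

Lemma kpow_le0 a T : T <= 0 -> kpow a T = 0.
Proof. by rewrite /kpow ltNge => ->. Qed.

Lemma normc_kpow a T : normc (kpow a T) = if 0 < T then T `^ Re a else 0.
Proof. by rewrite /kpow; case: ifPn => T0; rewrite ?normc0// normc_cpow. Qed.

Lemma kpowM a (c T : R) : 0 < c -> kpow a (c * T) = cpow c a * kpow a T.
Proof.
move=> c0; rewrite /kpow pmulr_rgt0//; case: ifPn => T0; last by rewrite mulr0.
by rewrite cpowM.
Qed.

Lemma kpowS a T : kpow (a + 1) T = T%:C * kpow a T.
Proof.
rewrite /kpow; case: ifPn => T0; last by rewrite mulr0.
by rewrite cpowD cpow1// mulrC.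
Qed.

Lemma cmeasurable_kpow d (S : measurableType d) (D : set S) (h : S -> R) a :
  measurable_fun D h -> cmeasurable D (fun x => kpow a (h x)).
Proof.
move=> mh.
rewrite (_ : (fun x => kpow a (h x)) =
    (fun x => (\1_[set t : R | 0 < t] (h x))%:C * cpow (h x) a)); last first.
  apply/funext => x; rewrite /kpow indicE; case: ifPn => hx.
    by rewrite mem_set// mul1r.
  by rewrite memNset ?mul0r//; exact/negP.
apply: cmeasurableM; last exact: cmeasurable_cpow.
apply: cmeasurable_real; apply: measurableT_comp => //.
apply: measurable_indic; apply: open_measurable; exact: open_gt.
Qed.

(** In 1 - s^2 = (1 - s)(1 + s) one factor is at least 1, so for a negative exponent the power is
    dominated by a power of the other factor; for a nonnegative exponent it is at most 1. The
    majorant [g] adds all three bounds and has an elementary bounded primitive. *)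
Lemma kpow_unit_integrable a : -1 < Re a ->
  cintegrable leb setT (fun s => kpow a (1 - s ^+ 2)).
Proof.
set p := Re a => pN1; have p1 : 0 < p + 1 by lra.
pose g s : R := 1 + (1 - s) `^ p + (1 + s) `^ p.
have ig : leb.-integrable `](-1), 1[ (EFin \o g).
  pose F s : R := s - (1 - s) `^ (p + 1) / (p + 1) + (1 + s) `^ (p + 1) / (p + 1).
  apply: (@primitive_bounded_integrable _ _ _ _ F (1 + 2 `^ (p + 1) / (p + 1) *+ 2)).
  - by lra.
  - by move=> x _; rewrite !addr_ge0// powR_ge0.
  - move=> x /andP[x1 x2].
    have h1 : is_derive x 1 (fun s => (1 - s) `^ (p + 1)) (- ((p + 1) * (1 - x) `^ p)).
      have h0 : 0 < 1 - x by lra.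
      have h : is_derive x 1 (fun s : R => 1 - s) (- 1).
        by apply: is_derive_eq; rewrite /GRing.scale/=; ring.
      by apply: is_derive_eq (is_derive_powR_comp (p + 1) h h0) _; rewrite addrK; ring.
    have h2 : is_derive x 1 (fun s => (1 + s) `^ (p + 1)) ((p + 1) * (1 + x) `^ p).
      have h0 : 0 < 1 + x by lra.
      have h : is_derive x 1 (fun s : R => 1 + s) ( 1).
        by apply: is_derive_eq; rewrite /GRing.scale/=; ring.
      by apply: is_derive_eq (is_derive_powR_comp (p + 1) h h0) _; rewrite addrK; ring.
    rewrite /F /g; apply: is_derive_eq; rewrite /GRing.scale/=; field; lra.
  - move=> x /andP[x1 x2]; rewrite /g.
    have h1 : is_derive x 1 (fun s => (1 - s) `^ p) (-1 * (p * (1 - x) `^ (p - 1))).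
      apply: is_derive_powR_comp; last by lra.
      by apply: is_derive_eq; rewrite /GRing.scale/=; ring.
    have h2 : is_derive x 1 (fun s => (1 + s) `^ p) (1 * (p * (1 + x) `^ (p - 1))).
      apply: is_derive_powR_comp; last by lra.
      by apply: is_derive_eq; rewrite /GRing.scale/=; ring.
    apply: (is_derive_continuous (l := -1 * (p * (1 - x) `^ (p - 1)) +
      1 * (p * (1 + x) `^ (p - 1)))).
    by apply: is_derive_eq; rewrite /GRing.scale/=; ring.
  - move=> x /andP[x1 x2]; rewrite /F.
    have b1 : 0 <= (1 - x) `^ (p + 1) <= 2 `^ (p + 1).
      rewrite powR_ge0/=; apply: ge0_ler_powR; rewrite ?nnegrE; lra.
    have b2 : 0 <= (1 + x) `^ (p + 1) <= 2 `^ (p + 1).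
      rewrite powR_ge0/=; apply: ge0_ler_powR; rewrite ?nnegrE; lra.
    have w0 : 0 < (p + 1)^-1 by rewrite invr_gt0.
    have {b1} [b1 b1'] := andP b1; have {b2} [b2 b2'] := andP b2.
    have := mulr_ge0 b1 (ltW w0); have := mulr_ge0 b2 (ltW w0).
    have := ler_wpM2r (ltW w0) b1'; have := ler_wpM2r (ltW w0) b2'.
    rewrite ler_norml mulr2n.
    set A := (1 - x) `^ _ / _; set B := (1 + x) `^ _ / _; set C := 2 `^ _ / _.
    by move=> h1 h2 h3 h4; apply/andP; split; lra.
have igT : leb.-integrable setT (EFin \o (g \_ `](-1), 1[)).
  by move/integrable_mkcond : ig => /(_ (measurable_itv _)); rewrite restrict_EFin.
apply: (le_cintegrable _ _ igT) => //.
  by apply: cmeasurable_kpow; apply: measurable_funB => //; exact: measurable_funX.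
move=> s _; rewrite normc_kpow patchE.
case: ifPn => s1; last by case: ifP => // _; rewrite /g !addr_ge0// powR_ge0.
have s2 : -1 < s < 1 by nra.
rewrite mem_set /=; last by rewrite in_itv.
rewrite /g; have := powR_ge0 (1 - s) p; have := powR_ge0 (1 + s) p.
have [p0|p0] := leP 0 p.
  suff : (1 - s ^+ 2) `^ p <= 1 by lra.
  apply: (@le_trans _ _ (1 `^ p)); last by rewrite powR1.
  by apply: ge0_ler_powR; rewrite ?nnegrE//; nra.
have E : 1 - s ^+ 2 = (1 - s) * (1 + s) by ring.
have neg u v : 0 < u -> u <= v -> v `^ p <= u `^ p.
  move=> u0 uv; rewrite -[p]opprK !(powRN _ (- p)) lef_pV2 ?posrE ?powR_gt0//; last lra.
  by apply: ge0_ler_powR; rewrite ?nnegrE; lra.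
have [s0|s0] := leP 0 s.
  suff : (1 - s ^+ 2) `^ p <= (1 - s) `^ p by lra.
  by apply: neg; nra.
suff : (1 - s ^+ 2) `^ p <= (1 + s) `^ p by lra.
by apply: neg; nra.
Qed.

(** Euler's beta value B(1/2, a + 1). *)
Definition beta a := cintegral leb setT (fun s => kpow a (1 - s ^+ 2)).

(* Substitution s = sqrt T * s' in the integral of (T - s^2)_+^a. *)
Lemma kpow_sq_scale a T (h : R -> R[i]) (M : R) : -1 < Re a -> 0 < T ->
  cmeasurable setT h -> (forall s, normc (h s) <= M) ->
  cintegrable leb setT (fun s => kpow a (T - s ^+ 2) * h s) /\
  cintegral leb setT (fun s => kpow a (T - s ^+ 2) * h s) =
  cpow T (a + (2^-1)%:C) *
  cintegral leb setT (fun s => kpow a (1 - s ^+ 2) * h (Num.sqrt T * s)).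
Proof.
move=> aN1 T0 mh hM.
pose c := Num.sqrt T; have c0 : 0 < c by rewrite sqrtr_gt0.
have cT : c ^+ 2 = T by rewrite sqr_sqrtr// ltW.
pose f s := kpow a (1 - s ^+ 2) * h (c * s).
have mf : cmeasurable setT f.
  apply: cmeasurableM.
    by apply: cmeasurable_kpow; apply: measurable_funB => //; exact: measurable_funX.
  have mc : measurable_fun [set: measurableTypeR R] (fun s : measurableTypeR R => c * s : measurableTypeR R).
    exact: measurable_funM.
  by case: mh => m1 m2; split; [exact: (measurableT_comp m1 mc)|exact: (measurableT_comp m2 mc)].
have intf : cintegrable leb setT f.
  rewrite /f; under eq_fun do rewrite mulrC.
  apply: (cintegrableMl (M := M)) => //.
    exact: kpow_unit_integrable.
  have mc : measurable_fun [set: measurableTypeR R] (fun s : measurableTypeR R => c * s : measurableTypeR R).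
    exact: measurable_funM.
  by case: mh => m1 m2; split; [exact: (measurableT_comp m1 mc)|exact: (measurableT_comp m2 mc)].
have [i1 e1] := cintegral_scale (c := c^-1) (f := f) ltac:(by rewrite invr_gt0) mf intf.
have E s : cpow T a * f (c^-1 * s) = kpow a (T - s ^+ 2) * h s.
  rewrite /f mulrA -kpowM// mulrA divff ?gt_eqF// mul1r; congr (kpow _ _ * _).
  rewrite exprMn exprVn cT; field; exact: lt0r_neq0.
split.
  have H := cintegrableZ (cpow T a) measurableT i1.
  by apply: eq_cintegrable H => // s _; exact: E.
under eq_cintegral do rewrite -E.
rewrite cintegralZ// -/f.
have -> : cintegral leb setT (fun s => f (c^-1 * s)) = c%:C * cintegral leb setT f.
  rewrite e1 mulrA -rmorphM divff ?gt_eqF// mul1r//.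
rewrite mulrA cpowD cpow_real// powR12_sqrt// ltW//.
Qed.

(** Integrating out one coordinate yields again a truncated power, with exponent larger by 1/2; this
    drives the inductions on the dimension. *)
Lemma kpow_sq_integral a T : -1 < Re a ->
  cintegrable leb setT (fun s => kpow a (T - s ^+ 2)) /\
  cintegral leb setT (fun s => kpow a (T - s ^+ 2)) =
  beta a * kpow (a + (2^-1)%:C) T.
Proof.
move=> aN1; have [T0|T0] := ltP 0 T; last first.
  rewrite (kpow_le0 _ T0) mulr0.
  have -> : (fun s => kpow a (T - s ^+ 2)) = fun=> 0.
    by apply/funext => s; rewrite kpow_le0//; have := sqr_ge0 s; lra.
  by split; [exact: cintegrable0|exact: cintegral0].
have [] := @kpow_sq_scale a T (fun=> 1) 1 aN1 T0.
- exact: cmeasurable_cst.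
- by move=> _; rewrite normc1.
under eq_fun do rewrite mulr1.
move=> i1 e1; split => //; rewrite e1 kpow_gt0// mulrC; congr (_ * _).
by apply: eq_cintegral => s _; rewrite mulr1.
Qed.

(** Integration by parts: the difference of the two integrands is the derivative of (1 - s^2)^(a+1)
    h(s), which tends to 0 at both endpoints because Re (a + 1) > 0 and [h] is bounded. The
    existence of [h''] makes [h'] continuous. *)
Lemma kpow_unit_IBP a (h h' h'' : R -> R) (M : R) : -1 < Re a ->
  (forall x : R, is_derive x 1 h (h' x)) ->
  (forall x : R, is_derive x 1 h' (h'' x)) ->
  (forall x, -1 < x < 1 -> `|h x| <= M /\ `|h' x| <= M) ->
  cintegral leb setT (fun s => kpow (a + 1) (1 - s ^+ 2) * (h' s)%:C) =
  2 * (a + 1) *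
  cintegral leb setT (fun s => kpow a (1 - s ^+ 2) * (s * h s)%:C).
Proof.
move=> aN1 dh dh' hM.
have a1N1 : -1 < Re (a + 1) by rewrite !complexRI /=; lra.
have m1 : measurable_fun setT (fun s : R => 1 - s ^+ 2).
  by apply: measurable_funB => //; exact: measurable_funX.
have mh : measurable_fun setT h.
  by apply: continuous_measurable_fun => x; exact: is_derive_continuous.
have mh' : measurable_fun setT h'.
  by apply: continuous_measurable_fun => x; exact: is_derive_continuous.
have ind b (g : R -> R) : -1 < Re b -> measurable_fun setT g ->
    (forall x, -1 < x < 1 -> `|g x| <= M) ->
    cintegrable leb setT (fun s => kpow b (1 - s ^+ 2) * (g s)%:C).
  move=> bN1 mg gM.
  have M0 : 0 <= M by rewrite (le_trans _ (gM 0 _))//; lra.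
  have := cintegrable_normc measurableT (kpow_unit_integrable bN1).
  move=> /(integrableZl measurableT M) H.
  apply: (le_cintegrable _ _ H) => //.
    apply: cmeasurableM; first exact: cmeasurable_kpow.
    exact: cmeasurable_real.
  move=> s _; rewrite normcM normc_real mulrC normc_kpow.
  case: ifPn => [s1|_]; last by rewrite !mulr0.
  by rewrite ler_wpM2r ?powR_ge0// gM//; nra.
have i1 := ind _ _ a1N1 mh' (fun x hx => (hM x hx).2).
have i2 : cintegrable leb setT (fun s => kpow a (1 - s ^+ 2) * (s * h s)%:C).
  apply: ind => //; first exact: measurable_funM.
  move=> x hx; rewrite normrM -[M]mul1r ler_pM// ?(hM x hx).1//.
  by rewrite ler_norml; lra.
pose f s := kpow (a + 1) (1 - s ^+ 2) * (h' s)%:C -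
  2 * (a + 1) * (kpow a (1 - s ^+ 2) * (s * h s)%:C).
have intf : cintegrable leb setT f by apply: cintegrableB => //; exact: cintegrableZ.
suff : cintegral leb setT f = 0.
  rewrite /f cintegralB//; last exact: cintegrableZ.
  by rewrite cintegralZ// => /eqP; rewrite subr_eq0 => /eqP.
have -> : cintegral leb setT f = cintegral leb `](-1), 1[ f.
  rewrite [RHS]cintegral_mkcond; apply: eq_cintegral => s _; rewrite indicE.
  case: (boolP (s \in _)) => s1; first by rewrite mulr1.
  rewrite mulr0 /f kpow_le0 ?kpow_le0; first by rewrite !mul0r mulr0 subr0.
    rewrite leNgt; apply/negP => s2; move/negP : s1; apply; apply/mem_set => /=.
    rewrite in_itv/=; nra.
  rewrite leNgt; apply/negP => s2; move/negP : s1; apply; apply/mem_set => /=.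
  rewrite in_itv/=; nra.
pose F s := cpow (1 - s ^+ 2) (a + 1) * (h s)%:C.
have lim0 (G : set_system R) : Filter G -> (\forall s \near G, -1 < s < 1) ->
    1 - s ^+ 2 @[s --> G] --> 0 -> normc (F s - 0) @[s --> G] --> 0.
  move=> FG nG cG.
  have c1 : M * (1 - s ^+ 2) `^ (Re a + 1) @[s --> G] --> 0.
    rewrite -[X in _ --> X](mulr0 M); apply: cvgMr; apply: cvg_powR0 => //.
      by lra.
    by apply: filterS nG => s hs; nra.
  apply: (squeeze_cvgr _ (cvg_cst 0) c1).
  apply: filterS nG => s hs; apply/andP; split; first exact: normc_ge0.
  rewrite subr0 /F normcM.
  rewrite normc_cpow; last by nra.
  rewrite normc_real !complexRI mulrC ler_wpM2r ?powR_ge0//.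
  exact: (hM s hs).1.
have dF x : -1 < x < 1 -> is_cderive x F (f x).
  move=> hx; have x1 : 0 < 1 - x ^+ 2 by nra.
  have d1 : is_derive x 1 (fun s => 1 - s ^+ 2) (- 2 * x).
    by apply: is_derive_eq; rewrite /GRing.scale/=; ring.
  have := is_cderiveM (is_cderive_cpow (a + 1) d1 x1) (is_cderive_real (dh x)).
  move/is_cderive_eq; apply; rewrite /f !kpow_gt0// addrK.
  by rewrite !rmorphM rmorphN rmorph_nat; ring.
rewrite -[RHS](subr0 0).
apply: (cimproper_FTC _ dF) => //.
- move=> x hx; have x1 : 0 < 1 - x ^+ 2 by nra.
  have d1 : is_derive x 1 (fun s => 1 - s ^+ 2) (- 2 * x).
    by apply: is_derive_eq; rewrite /GRing.scale/=; ring.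
  have dsh : is_derive x 1 (fun s => s * h s) (h x + x * h' x).
    by apply: is_derive_eq; rewrite /GRing.scale/=; ring.
  have D := is_cderiveB (is_cderiveM (is_cderive_cpow (a + 1) d1 x1)
     (is_cderive_real (dh' x))) (is_cderiveZ (2 * (a + 1)) (is_cderiveM
      (is_cderive_cpow a d1 x1) (is_cderive_real dsh))).
  have [c1 c2] := is_cderive_continuous D.
  have nx : \forall s \near x, -1 < s < 1.
    have : x \in `](-1), 1[ by rewrite in_itv.
    by move=> /near_in_itvoo; apply: filterS => s; rewrite in_itv.
  have E : \forall s \near x, f s = cpow (1 - s ^+ 2) (a + 1) * (h' s)%:C -
      2 * (a + 1) * (cpow (1 - s ^+ 2) a * (s * h s)%:C).
    by apply: filterS nx => s hs; rewrite /f !kpow_gt0//; nra.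
  split.
    by apply: near_eq_continuous_at c1; apply: filterS E => s ->.
  by apply: near_eq_continuous_at c2; apply: filterS E => s ->.
- rewrite (_ : f = fun x => f x); last by [].
  by case: intf => j1 j2; split; [exact: integrableS j1|exact: integrableS j2].
- apply: lim0.
    near=> s; apply/andP; split; near: s.
      exact: nbhs_right_gt.
    by apply: nbhs_right_lt; lra.
  apply: cvg_at_right_filter.
  have -> : (0 : R) = 1 - (-1) ^+ 2 by ring.
  by apply: cvgB; [exact: cvg_cst|exact: exprn_continuous].
- apply: lim0.
    near=> s; apply/andP; split; near: s.
      by apply: nbhs_left_gt; lra.
    exact: nbhs_left_lt.
  apply: cvg_at_left_filter.
  have -> : (0 : R) = 1 - 1 ^+ 2 by ring.
  by apply: cvgB; [exact: cvg_cst|exact: exprn_continuous].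
Unshelve. all: by end_near. Qed.

End Kpow.

(** * Nonvanishing of the beta integral *)

Section BetaNonzero.
Context {R : realType}.
Local Notation leb := (@lebesgue_measure R).
Implicit Types a : R[i].

Lemma complex_ReZ (r : R) (z : R[i]) : Re (r%:C * z) = r * Re z.
Proof. by case: z => x y /=; rewrite mul0r subr0. Qed.

(** Integration by parts with h(s) = s, after writing s^2 = 1 - (1 - s^2). *)
Lemma betaS a : -1 < Re a -> beta (a + 1) = 2 * (a + 1) * (beta a - beta (a + 1)).
Proof.
move=> aN1.
have a1N1 : -1 < Re (a + 1) by rewrite !complexRI /=; lra.
have := @kpow_unit_IBP R a id (fun=> 1) (fun=> 0) 1 aN1.
have -> : cintegral leb setT (fun s : R => kpow (a + 1) (1 - s ^+ 2) * 1%:C) =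
    beta (a + 1).
  by apply: eq_cintegral => s _; rewrite mulr1.
have -> : cintegral leb setT (fun s : R => kpow a (1 - s ^+ 2) * (s * s)%:C) =
    beta a - beta (a + 1).
  rewrite -cintegralB//; [|exact: kpow_unit_integrable..].
  apply: eq_cintegral => s _.
  by rewrite kpowS rmorphM rmorphB rmorph1 rmorphXn/=; ring.
apply=> x hx; rewrite normr1 ler_norml; split => //; lra.
Qed.

Lemma beta_real (p : R) : -1 < p ->
  beta p%:C = (\int[leb]_s (Re (kpow p%:C (1 - s ^+ 2))))%:C.
Proof.
move=> pN1; apply: complex_ext => //=.
rewrite (_ : (fun _ => _) = fun=> 0); first by rewrite /Rintegral integral0.
by apply/funext => s; rewrite /kpow; case: ifPn => // s1; rewrite cpow_real.
Qed.

Lemma beta_real_gt0 (p : R) : 0 <= p -> 0 < Re (beta p%:C).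
Proof.
move=> p0; have pN1 : -1 < Re p%:C by rewrite /=; lra.
have [i1 _] := kpow_unit_integrable pN1.
rewrite beta_real//=.
have k0 s : 0 <= Re (kpow p%:C (1 - s ^+ 2)).
  by rewrite /kpow; case: ifPn => // s1; rewrite cpow_real//= powR_ge0.
have q0 : 0 < (3 / 4) `^ p by rewrite powR_gt0//; lra.
(* On [0, 1/2] one has 1 - s^2 >= 3/4, which already gives a positive contribution. *)
apply: (@lt_le_trans _ _ (\int[leb]_(s in `[0, 2^-1]) (3 / 4) `^ p)).
  rewrite Rintegral_cst//= lebesgue_measure_itv/= lte_fin ifT; last by lra.
  by rewrite -EFinB /= mulr_gt0//; lra.
rewrite Rintegral_mkcond; apply: le_Rintegral => //.
  rewrite -restrict_EFin.
  have : leb.-integrable `[0, 2^-1] (EFin \o fun=> (3 / 4) `^ p : R).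
    apply: measurable_bounded_integrable => //; last exact: bounded_cst.
    by rewrite /= lebesgue_measure_itv/= lte_fin ifT ?ltry//; lra.
  by move/integrable_mkcond; apply.
move=> s _; rewrite patchE; case: ifPn => [/set_mem/=|_]; last exact: k0.
rewrite in_itv/= => /andP[s0 s1]; have s2 : 3 / 4 <= 1 - s ^+ 2 by nra.
rewrite kpow_gt0; last by lra.
rewrite cpow_real/=; last by lra.
apply: ge0_ler_powR; rewrite ?nnegrE//; lra.
Qed.

(* For large Re a the phase Im a * ln (1 - s^2) is small where the weight
   (1 - s^2)^(Re a) is concentrated. *)
Lemma beta_neq0_large a : 0 < Re a -> `|Im a| <= Re a -> beta a != 0.
Proof.
set p := Re a; set q := Im a => p0 qp.
have aN1 : -1 < Re a by rewrite -/p; lra.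
have pN1 : -1 < Re p%:C by rewrite /=; lra.
have p1N1 : -1 < Re (p%:C - 1) by rewrite !complexRI/=; lra.
suff : 0 < Re (beta a) by apply: contraTneq => ->; rewrite ltxx.
have [i1 _] := kpow_unit_integrable aN1.
have ip := kpow_unit_integrable pN1; have ip1 := kpow_unit_integrable p1N1.
have E1 : cintegral leb setT (fun s => kpow (p%:C - 1) (1 - s ^+ 2) - kpow p%:C (1 - s ^+ 2)) =
    beta (p%:C - 1) - beta p%:C by rewrite cintegralB.
have E2 := betaS p1N1; rewrite subrK in E2.
have B0 := beta_real_gt0 (ltW p0).
(* With u = 1 - s^2, the bound cos(q ln u) >= 1 - |q| |ln u| >= 1 - |q| (1/u - 1) makes g a minorant
   of the real part of the integrand. Its integral is computed by the recursion at p - 1, which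
   gives beta(p) = 2p (beta(p-1) - beta(p)); since |q| <= p, the subtracted part is at most half of
   beta(p). *)
pose g s := kpow p%:C (1 - s ^+ 2) -
  `|q|%:C * (kpow (p%:C - 1) (1 - s ^+ 2) - kpow p%:C (1 - s ^+ 2)).
have ig : cintegrable leb setT g.
  by apply: cintegrableB => //; apply: cintegrableZ => //; exact: cintegrableB.
have Eg : cintegral leb setT g = beta p%:C - `|q|%:C * (beta (p%:C - 1) - beta p%:C).
  rewrite /g cintegralB//; last by apply: cintegrableZ => //; exact: cintegrableB.
  by rewrite cintegralZ ?E1//; exact: cintegrableB.
have RE2 : Re (beta p%:C) = 2 * p * Re (beta (p%:C - 1) - beta p%:C).
  by rewrite {1}E2 !complexRI /=; ring.
apply: (@lt_le_trans _ _ (Re (cintegral leb setT g))).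
  rewrite Eg complex_ReD complex_ReN complex_ReZ.
  move: RE2; set D := Re (_ - _) => RE2.
  have D0 : 0 < D by nra.
  by rewrite RE2; nra.
rewrite /cintegral /=; apply: le_Rintegral => //; first by case: ig.
move=> s _; rewrite /g /kpow; case: ifPn => [s1|_]; last first.
  by rewrite !complexRI/=; lra.
set u := 1 - s ^+ 2 in s1 *.
have u1 : u <= 1 by rewrite /u; have := sqr_ge0 s; lra.
have -> : Re (cpow u a) = u `^ p * cos (q * ln u).
  rewrite /cpow /cexp !complexRI/= !mulr0 subr0 add0r mul0r subr0.
  by rewrite /powR gt_eqF.
have -> : cpow u (p%:C - 1) = (u `^ p / u)%:C.
  rewrite -(rmorph1 (real_complex R)) -rmorphB cpow_real//; congr (_%:C).
  by rewrite powRB ?powRr1 ?(ltW s1)// (gt_eqF s1) implybT.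
rewrite cpow_real// -!rmorphB -!rmorphM -!rmorphB /=.
have ln0 : ln u <= 0 by rewrite ln_le0.
have h1 := cos_ge1B (q * ln u); rewrite normrM (ler0_norm ln0) in h1.
have h2 : - ln u <= u^-1 - 1.
  rewrite -lnV ?posrE//.
  have e : 1 + (u^-1 - 1) = u^-1 by ring.
  have := @le_ln1Dx R (u^-1 - 1); rewrite e; apply.
  by rewrite ltrBrDl subrr invr_gt0.
have -> : u `^ p / u - u `^ p = u `^ p * (u^-1 - 1) by ring.
rewrite mulrCA -{1}[u `^ p]mulr1 -mulrBr ler_wpM2l ?powR_ge0//.
apply: le_trans h1; rewrite lerD2l lerN2 ler_wpM2l//.
Qed.

(** By the recursion (1 + 2(b+1)) beta(b+1) = 2(b+1) beta(b), where the left factor has positive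
    real part, a zero at a would propagate to every a + k; for large k the exponent lies in the
    sector already treated. *)
Lemma beta_neq0 a : -1 < Re a -> beta a != 0.
Proof.
move=> aN1.
have step (b : R[i]) : -1 < Re b -> beta b = 0 -> beta (b + 1) = 0.
  move=> bN1 b0; have := betaS bN1; rewrite b0 sub0r mulrN => /eqP.
  rewrite -subr_eq0 opprK => /eqP.
  have -> : beta (b + 1) + 2 * (b + 1) * beta (b + 1) =
    (1 + 2 * (b + 1)) * beta (b + 1) by ring.
  move/eqP; rewrite mulf_eq0 => /orP[/eqP h|/eqP//].
  by exfalso; have := congr1 (@complex.Re R) h; rewrite !complexRI/=; lra.
apply/eqP => a0.
have H k : -1 < Re (a + k%:R) /\ beta (a + k%:R) = 0.
  elim: k => [|k [IH1 IH2]]; first by rewrite addr0.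
  rewrite -natr1 addrA; split; last exact: step.
  by rewrite complex_ReD/=; lra.
pose k := (Num.truncn (`|Im a| + 1)).+1.
have kb : `|Im a| + 1 < k%:R by exact: truncnS_gt.
have [h1 /eqP] := H k; apply/negP; apply: beta_neq0_large.
  by rewrite !complexRI; have := normr_ge0 (Im a); lra.
by rewrite !complexRI addr0; lra.
Qed.

End BetaNonzero.

(** * The Bessel-type transform and its asymptotics *)

Section CosineTransform.
Context {R : realType}.
Local Notation leb := (@lebesgue_measure R).

(** Differentiation under the integral: since [w] vanishes outside (-1, 1), the factor s brought
    down is at most 1 in modulus there and |w| dominates the differentiated integrand. *)
Lemma Rintegral_trig_derive (w : R -> R) (g g' : R -> R) (x : R) :
  leb.-integrable setT (EFin \o w) ->
  (forall s, ~ (-1 < s < 1) -> w s = 0) ->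
  (forall t : R, is_derive t 1 g (g' t)) ->
  (forall t, `|g t| <= 1) -> (forall t, `|g' t| <= 1) ->
  continuous g' ->
  is_derive x 1 (fun x => \int[leb]_s (w s * g (x * s)))
    (\int[leb]_s (w s * (s * g' (x * s)))).
Proof.
move=> iw w0 dg gM g'M cg'.
have mw : measurable_fun setT w by apply/measurable_EFinP; exact: measurable_int iw.
have mg : measurable_fun setT g.
  by apply: continuous_measurable_fun => t; exact: is_derive_continuous.
have mul y : measurable_fun [set: measurableTypeR R]
    (fun s : measurableTypeR R => y * s : measurableTypeR R).
  exact: measurable_funM.
have ig y : leb.-integrable setT (EFin \o (fun s => w s * g (y * s))).
  apply: (le_integrable measurableT _ _ iw).
    apply/measurable_EFinP; apply: measurable_funM => //.
    exact: (measurableT_comp mg (mul y)).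
  move=> s _ /=; rewrite lee_fin normrM -[leRHS]mulr1 ler_wpM2l//.
have d1 (y s : R) : is_derive y 1 (fun y => w s * g (y * s)) (w s * (s * g' (y * s))).
  have h1 : is_derive y 1 (fun y : R => y * s) s.
    by apply: is_derive_eq; rewrite /GRing.scale/=; ring.
  have h2 := @is_derive1_comp R g (fun y => y * s) y _ _ (dg (y * s)) h1.
  by apply: is_derive_eq; rewrite /GRing.scale/=; ring.
have := @cvg_differentiation_under_integral R _ (measurableTypeR R) leb
  (fun y s => w s * g (y * s)) setT measurableT x (x - 1) (x + 1).
move=> /(_ _ (fun y _ => ig y) (fun y s _ _ => ex_derive) (fun s => `|w s|)).
have xx : `]x - 1, x + 1[%classic x by rewrite /= in_itv/=; lra.
move=> /(_ xx (fun s => normr_ge0 _)).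
have iaw : leb.-integrable setT (EFin \o (fun s => `|w s|)).
  exact: integrable_norm.
move=> /(_ iaw).
have E y s : partial1of2 (fun y s => w s * g (y * s)) y s = w s * (s * g' (y * s)).
  by rewrite partial1of2E; apply: derive_val.
have ub y s : `]x - 1, x + 1[%classic y -> setT s ->
    `|partial1of2 (fun y s => w s * g (y * s)) y s| <= `|w s|.
  move=> _ _; rewrite E; case: (pselect (-1 < s < 1)) => hs; last first.
    by rewrite w0// mul0r normr0.
  rewrite normrM -[leRHS]mulr1 ler_wpM2l// normrM -[1]mulr1 ler_pM//.
  by rewrite ler_norml; lra.
move=> /(_ ub) H.
have {}H : h^-1 *: ((fun x => \int[leb]_s (w s * g (x * s))) (h + x) -
   \int[leb]_s (w s * g (x * s))) @[h --> 0^'] -->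
   \int[leb]_s (w s * (s * g' (x * s))).
  rewrite (_ : \int[leb]_s (w s * (s * g' (x * s))) =
    \int[leb]_s partial1of2 (fun y s => w s * g (y * s)) x s); first exact: H.
  by apply: eq_Rintegral => s _; rewrite E.
have H' : h^-1 *: (((fun x => \int[leb]_s (w s * g (x * s))) \o shift x) (h *: (1 : R)) -
   \int[leb]_s (w s * g (x * s))) @[h --> 0^'] -->
   \int[leb]_s (w s * (s * g' (x * s))).
  by under eq_fun do rewrite /= /GRing.scale/= mulr1; exact: H.
split.
  by apply/cvg_ex; eexists; exact: H'.
by apply/cvg_lim => //; exact: H'.
Qed.

(* Up to a constant, x^(-a-1/2) J_(a+1/2)(x). *)
Definition cosT (a : R[i]) (x : R) : R[i] :=
  cintegral leb setT (fun s => kpow a (1 - s ^+ 2) * (cos (x * s))%:C).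

Lemma kpow_unit_out (a : R[i]) s : ~ (-1 < s < 1) -> kpow a (1 - s ^+ 2) = 0.
Proof.
move=> h; apply: kpow_le0; rewrite leNgt; apply/negP => s1; apply: h.
by apply/andP; split; nra.
Qed.

Lemma cintegrable_kpow_real (a : R[i]) (g : R -> R) : -1 < Re a ->
  measurable_fun setT g -> (forall s, -1 < s < 1 -> `|g s| <= 1) ->
  cintegrable leb setT (fun s => kpow a (1 - s ^+ 2) * (g s)%:C).
Proof.
move=> aN1 mg gM.
have H := cintegrable_normc measurableT (kpow_unit_integrable aN1).
apply: (le_cintegrable _ _ H) => //.
  apply: cmeasurableM; last exact: cmeasurable_real.
  apply: cmeasurable_kpow.
  by apply: measurable_funB => //; exact: measurable_funX.
move=> s _; rewrite normcM normc_real.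
case: (pselect (-1 < s < 1)) => hs; last by rewrite kpow_unit_out// normc0 mul0r.
by rewrite -[leRHS]mulr1 ler_wpM2l ?normc_ge0// gM.
Qed.

Let measurable_mulc (x : R) : measurable_fun [set: measurableTypeR R]
    (fun s : measurableTypeR R => x * s : measurableTypeR R).
Proof. exact: measurable_funM. Qed.

Let mcos (x : R) : measurable_fun [set: measurableTypeR R]
   (fun s : measurableTypeR R => cos (x * s)).
Proof.
apply: (measurableT_comp _ (measurable_mulc x)).
by apply: continuous_measurable_fun; exact: continuous_cos.
Qed.

Let msin (x : R) : measurable_fun [set: measurableTypeR R]
   (fun s : measurableTypeR R => sin (x * s)).
Proof.
apply: (measurableT_comp _ (measurable_mulc x)).
by apply: continuous_measurable_fun; exact: continuous_sin.
Qed.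

Lemma cosT_integrable (a : R[i]) (x : R) : -1 < Re a ->
  cintegrable leb setT (fun s => kpow a (1 - s ^+ 2) * (cos (x * s))%:C).
Proof.
move=> aN1; apply: (@cintegrable_kpow_real a (fun s => cos (x * s))) => //.
  exact: mcos.
by move=> s _; exact: cos_max.
Qed.

Definition sinT (a : R[i]) (x : R) : R[i] :=
  cintegral leb setT (fun s => kpow a (1 - s ^+ 2) * (s * sin (x * s))%:C).

Lemma sinT_integrable (a : R[i]) (x : R) : -1 < Re a ->
  cintegrable leb setT (fun s => kpow a (1 - s ^+ 2) * (s * sin (x * s))%:C).
Proof.
move=> aN1; apply: (@cintegrable_kpow_real a (fun s => s * sin (x * s))) => //.
  by apply: measurable_funM => //; exact: msin.
move=> s hs; rewrite normrM -[1]mulr1 ler_pM// ?sin_max//.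
by rewrite ler_norml; lra.
Qed.

Lemma cintegral_trig_derive (w : R -> R[i]) (g g' : R -> R) (x : R) :
  cintegrable leb setT w -> (forall s, ~ (-1 < s < 1) -> w s = 0) ->
  (forall t : R, is_derive t 1 g (g' t)) ->
  (forall t, `|g t| <= 1) -> (forall t, `|g' t| <= 1) -> continuous g' ->
  is_cderive x (fun x => cintegral leb setT (fun s => w s * (g (x * s))%:C))
    (cintegral leb setT (fun s => w s * (s * g' (x * s))%:C)).
Proof.
move=> [i1 i2] w0 dg gM g'M cg'.
have r1 := @Rintegral_trig_derive (fun s => Re (w s)) g g' x i1
  (fun s hs => congr1 (@complex.Re R) (w0 s hs)) dg gM g'M cg'.
have r2 := @Rintegral_trig_derive (fun s => Im (w s)) g g' x i2
  (fun s hs => congr1 (@complex.Im R) (w0 s hs)) dg gM g'M cg'.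
have E (u : R[i]) (r : R) : Re (u * r%:C) = Re u * r /\ Im (u * r%:C) = Im u * r.
  by rewrite complex_ReM complex_ImM /= !mulr0 subr0 add0r.
split.
  rewrite (_ : (fun _ => _) = (fun x => \int[leb]_s (Re (w s) * g (x * s)))).
    by apply: is_derive_eq r1 _; apply: eq_Rintegral => s _; rewrite (E _ _).1.
  by apply/funext => t; apply: eq_Rintegral => s _; rewrite (E _ _).1.
rewrite (_ : (fun _ => _) = (fun x => \int[leb]_s (Im (w s) * g (x * s)))).
  by apply: is_derive_eq r2 _; apply: eq_Rintegral => s _; rewrite (E _ _).2.
by apply/funext => t; apply: eq_Rintegral => s _; rewrite (E _ _).2.
Qed.

Lemma cosT_derive (a : R[i]) (x : R) : -1 < Re a ->
  is_cderive x (cosT a) (- sinT a x).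
Proof.
move=> aN1.
have cNs : continuous (fun t : R => - sin t).
  by move=> t; apply: continuousN; exact: continuous_sin.
have sN (t : R) : `|- sin t| <= 1 by rewrite normrN sin_max.
have D := cintegral_trig_derive x (kpow_unit_integrable aN1)
  (@kpow_unit_out a) (@is_derive_cos R) (@cos_max R) sN cNs.
apply: is_cderive_eq D _; rewrite /sinT -cintegralN//; last exact: sinT_integrable.
by apply: eq_cintegral => s _; rewrite mulrN rmorphN mulrN.
Qed.

(** Differentiation brings down another s; the exponent a + 1 comes from s^2 = 1 - (1 - s^2). *)
Lemma sinT_derive (a : R[i]) (x : R) : -1 < Re a ->
  is_cderive x (sinT a) (cosT a x - cosT (a + 1) x).
Proof.
move=> aN1; have a1N1 : -1 < Re (a + 1) by rewrite !complexRI /=; lra.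
have iw : cintegrable leb setT (fun s => kpow a (1 - s ^+ 2) * s%:C).
  apply: (@cintegrable_kpow_real a id) => // s hs.
  by rewrite ler_norml; lra.
have w0 (s : R) : ~ (-1 < s < 1) -> kpow a (1 - s ^+ 2) * s%:C = 0.
  by move=> /(kpow_unit_out a) ->; rewrite mul0r.
have D := cintegral_trig_derive x iw w0 (@is_derive_sin R) (@sin_max R)
  (@cos_max R) (@continuous_cos R).
have -> : sinT a = fun x => cintegral leb setT
    (fun s => kpow a (1 - s ^+ 2) * s%:C * (sin (x * s))%:C).
  by apply/funext => t; apply: eq_cintegral => s _; rewrite rmorphM mulrA.
apply: is_cderive_eq D _; rewrite /cosT -cintegralB//; last 2 first.
- exact: cosT_integrable.
- exact: cosT_integrable.
apply: eq_cintegral => s _.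
by rewrite kpowS !rmorphM rmorphB rmorph1 rmorphXn/=; ring.
Qed.

Lemma complex_neq0_Re (z : R[i]) : Re z != 0 -> z != 0.
Proof. by apply: contraNneq => ->. Qed.

(** Integration by parts with h(s) = sin(xs). Together with the two derivative formulas it closes
    the system: eliminating [cosT (a + 1)] leaves Bessel's equation for [cosT a]. *)
Lemma sinTE (a : R[i]) (x : R) : -1 < Re a ->
  sinT a x = x%:C / (2 * (a + 1)) * cosT (a + 1) x.
Proof.
move=> aN1; have a1N1 : -1 < Re (a + 1) by rewrite !complexRI /=; lra.
have a1 : 2 * (a + 1) != 0.
  by apply: complex_neq0_Re; rewrite !complexRI/=; lra.
have dsin (s : R) : is_derive s 1 (fun s => sin (x * s)) (x * cos (x * s)).
  by apply: is_derive_eq; rewrite /GRing.scale/=; ring.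
have dcos (s : R) : is_derive s 1 (fun s => x * cos (x * s)) (- (x * (x * sin (x * s)))).
  by apply: is_derive_eq; rewrite /GRing.scale/=; ring.
have : forall s, -1 < s < 1 -> `|sin (x * s)| <= 1 + `|x| /\
    `|x * cos (x * s)| <= 1 + `|x|.
  move=> s hs; split; first by rewrite (le_trans (sin_max _))// lerDl.
  by rewrite normrM (le_trans (ler_wpM2l (normr_ge0 _) (cos_max _)))// mulr1 lerDr.
move=> /(kpow_unit_IBP aN1 dsin dcos).
have -> : cintegral leb setT (fun s => kpow (a + 1) (1 - s ^+ 2) * (x * cos (x * s))%:C) =
    x%:C * cosT (a + 1) x.
  rewrite /cosT -cintegralZ//; last exact: cosT_integrable.
  by apply: eq_cintegral => s _; rewrite rmorphM; ring.
by move=> E; rewrite mulrAC E mulrAC divff// mul1r.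
Qed.

Lemma cosT0 (a : R[i]) : cosT a 0 = beta a.
Proof. by apply: eq_cintegral => s _; rewrite mul0r cos0 mulr1. Qed.

Lemma cosTN (a : R[i]) x : cosT a (- x) = cosT a x.
Proof. by apply: eq_cintegral => s _; rewrite mulNr cosN. Qed.

End CosineTransform.

(** * Energy estimate for a damped rotation with an integrable perturbation *)

Section EnergyODE.
Context {R : realType}.

Lemma is_derive_within_continuous (f df : R -> R) (x y : R) :
  (forall t, x <= t <= y -> is_derive t 1 f (df t)) ->
  {within `[x, y], continuous f}.
Proof.
move=> H; apply: continuous_in_subspaceT => t; rewrite inE/= in_itv/= => /H.
exact: is_derive_continuous.
Qed.

Lemma is_derive_le0_nincr (f df : R -> R) (x y : R) : x <= y ->
  (forall t, x <= t <= y -> is_derive t 1 f (df t)) ->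
  (forall t, x <= t <= y -> df t <= 0) -> f y <= f x.
Proof.
move=> xy H df0.
have [|c] := @MVT_segment R f df x y xy _ (is_derive_within_continuous H).
  by move=> t; rewrite in_itv/= => /andP[/ltW h1 /ltW h2]; apply: H; rewrite h1.
rewrite in_itv/= => /df0 hc E; have : df c * (y - x) <= 0.
  by rewrite mulr_le0_ge0// subr_ge0.
lra.
Qed.

Lemma is_derive_bound (f df : R -> R) (x y B : R) : x <= y ->
  (forall t, x <= t <= y -> is_derive t 1 f (df t)) ->
  (forall t, x <= t <= y -> `|df t| <= B) -> `|f y - f x| <= B * (y - x).
Proof.
move=> xy H dfB.
have [|c] := @MVT_segment R f df x y xy _ (is_derive_within_continuous H).
  by move=> t; rewrite in_itv/= => /andP[/ltW h1 /ltW h2]; apply: H; rewrite h1.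
rewrite in_itv/= => /dfB hc ->; rewrite normrM (ger0_norm (_ : 0 <= y - x)) ?subr_ge0//.
by rewrite ler_wpM2r// subr_ge0.
Qed.

Lemma is_cderive_bound (f df : R -> R[i]) (x y B : R) : x <= y ->
  (forall t, x <= t <= y -> is_cderive t f (df t)) ->
  (forall t, x <= t <= y -> normc (df t) <= B) ->
  normc (f y - f x) <= 2 * B * (y - x).
Proof.
move=> xy H dfB; apply: (le_trans (normc_le_ReIm _)).
rewrite !complexRI mulr2n !mulrDl mul1r; apply: lerD.
  apply: (is_derive_bound xy (fun t ht => (H t ht).1)) => t ht.
  by rewrite (le_trans (normc_geRe _))// dfB.
apply: (is_derive_bound xy (fun t ht => (H t ht).2)) => t ht.
by rewrite (le_trans (normc_geIm _))// dfB.
Qed.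

Variables (y v : R -> R[i]) (b d : R[i]).
Hypothesis dy : forall x, 0 < x -> is_cderive x y (v x - b / x%:C * y x).
Hypothesis dv : forall x, 0 < x ->
  is_cderive x v (- y x - b / x%:C * v x + d / (x ^+ 2)%:C * y x).

Definition energy (x : R) : R := normc (y x) ^+ 2 + normc (v x) ^+ 2.

(** This is Re (d y conj(v)), through which the perturbation d / x^2 enters the derivative of the
    energy. The rotation itself preserves the energy, and the damping multiplies it by -2 Re b /
    x. *)
Let cross (x : R) : R := Re d * (Re (v x) * Re (y x) + Im (v x) * Im (y x)) -
  Im d * (Re (v x) * Im (y x) - Im (v x) * Re (y x)).

Let cross_le x : `|2 * cross x| <= 2 * normc d * energy x.
Proof.
have E : cross x = Re (d * ((v x)^* * y x)).
  by rewrite /cross; case: d => ? ?; case: (v x) => ? ?; case: (y x) => ? ? /=; ring.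
have nJ : normc ((v x)^*) = normc (v x) by case: (v x) => ? ? /=; rewrite sqrrN.
rewrite normrM ger0_norm// -mulrA ler_wpM2l// E (le_trans (normc_geRe _))//.
rewrite !normcM nJ ler_wpM2l ?normc_ge0// /energy.
have := normc_ge0 (v x); have := normc_ge0 (y x); nra.
Qed.

Let energy_ge0 (x : R) : 0 <= energy x.
Proof. by rewrite addr_ge0// sqr_ge0. Qed.

Lemma energy_derive (x : R) : 0 < x ->
  is_derive x 1 energy (- (2 * Re b / x) * energy x + 2 * cross x / x ^+ 2).
Proof.
move=> x0; have [y1 y2] := dy x0; have [v1 v2] := dv x0.
have -> : energy = (fun t => Re (y t) ^+ 2 + Im (y t) ^+ 2 +
    (Re (v t) ^+ 2 + Im (v t) ^+ 2)).
  by apply/funext => t; rewrite /energy !normcE2.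
have xn0 : x != 0 by rewrite gt_eqF.
have Dx z (r : R) : z / r%:C = (Re z / r) +i* (Im z / r).
  rewrite -fmorphV; apply: complex_ext => /=; rewrite !complexRI/=; ring.
rewrite !Dx in y1 y2 v1 v2.
apply: is_derive_eq; rewrite /GRing.scale/= /cross !complexRI/=.
by field.
Qed.

(** Energy times an integrating factor: the power of x removes the damping, and the exponential
    dominates the perturbation. The result is nonincreasing for s = 1 and nondecreasing for s = -1,
    which yields the upper and the lower bound. *)
Let weight (s x : R) : R := energy x * (x `^ (2 * Re b) * expR (s * (2 * normc d) / x)).

Let weight_derive (s x : R) : 0 < x ->
  is_derive x 1 (weight s) (x `^ (2 * Re b) * expR (s * (2 * normc d) / x) / x ^+ 2 *
    (2 * cross x - s * (2 * normc d) * energy x)).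
Proof.
move=> x0; have xn0 : x != 0 by rewrite gt_eqF.
have h1 := energy_derive x0.
have h2 : is_derive x 1 (fun x => x `^ (2 * Re b)) (2 * Re b * x `^ (2 * Re b - 1)).
  exact: is_derive1_powR.
have h3 : is_derive x 1 (fun x => s * (2 * normc d) / x) (- (s * (2 * normc d) / x ^+ 2)).
  have h := @is_deriveV R id x 1 _ xn0 (is_derive_id _ _).
  by apply: is_derive_eq; rewrite /GRing.scale/=; field.
have h4 : is_derive x 1 (fun x => expR (s * (2 * normc d) / x))
    (- (s * (2 * normc d) / x ^+ 2) * expR (s * (2 * normc d) / x)).
  by apply: is_derive_eq; rewrite /GRing.scale/=; ring.
have E : x `^ (2 * Re b - 1) = x `^ (2 * Re b) / x.
  by rewrite powRB ?powRr1 ?(ltW x0)// xn0 implybT.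
rewrite /weight; apply: is_derive_eq; rewrite /GRing.scale/= E.
by move: (expR _) (x `^ _) => e w; field.
Qed.

Let factor_ge0 (s x : R) : 0 <= x `^ (2 * Re b) * expR (s * (2 * normc d) / x) / x ^+ 2.
Proof. by rewrite divr_ge0 ?sqr_ge0// mulr_ge0 ?powR_ge0 ?expR_ge0. Qed.

Lemma energy_upper : exists C : R, 0 <= C /\
  forall x, 1 <= x -> energy x <= C * x `^ (- (2 * Re b)).
Proof.
exists (weight 1 1); split.
  by rewrite mulr_ge0// mulr_ge0 ?powR_ge0 ?expR_ge0.
move=> x x1; have x0 : 0 < x by lra.
rewrite powRN ler_pdivlMr ?powR_gt0//.
apply: (@le_trans _ _ (weight 1 x)).
  rewrite /weight mulrA ler_peMr ?mulr_ge0 ?powR_ge0// -[leLHS]expR0 ler_expR mul1r.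
  by rewrite divr_ge0 ?mulr_ge0 ?normc_ge0// ltW.
apply: (is_derive_le0_nincr x1 (df := fun x => _)).
  by move=> t /andP[t1 _]; apply: weight_derive; lra.
move=> t _; rewrite mulr_ge0_le0//= subr_le0 mul1r.
exact: le_trans (ler_norm _) (cross_le t).
Qed.

Lemma energy_lower (x1 : R) : 0 < x1 -> 0 < energy x1 -> exists2 c : R, 0 < c &
  forall x, x1 <= x -> c * x `^ (- (2 * Re b)) <= energy x.
Proof.
move=> x10 e0; exists (weight (-1) x1).
  by rewrite mulr_gt0// mulr_gt0 ?powR_gt0 ?expR_gt0.
move=> x x1x; have x0 : 0 < x by lra.
rewrite powRN ler_pdivrMr ?powR_gt0//.
apply: (@le_trans _ _ (weight (-1) x)); last first.
  rewrite /weight mulrA ler_piMr ?mulr_ge0 ?powR_ge0// -[leRHS]expR0 ler_expR mulN1r mulNr.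
  by rewrite oppr_le0 divr_ge0 ?mulr_ge0 ?normc_ge0// ltW.
rewrite -lerN2.
apply: (@is_derive_le0_nincr (fun x => - weight (-1) x) (fun x => - (x `^ (2 * Re b) * expR (-1 * (2 * normc d) / x) / x ^+ 2 *
    (2 * cross x - -1 * (2 * normc d) * energy x))) _ _ x1x).
  by move=> t /andP[t1 _]; apply: is_deriveN; apply: weight_derive; lra.
move=> t _; rewrite oppr_le0 mulr_ge0// mulN1r mulNr opprK.
by have := cross_le t; rewrite ler_norml => /andP[h _]; lra.
Qed.

End EnergyODE.

(** * Binomial averages of exponentials *)

Section BinomialAverage.
Context {R : realType}.

Definition expi (t : R) : R[i] := cexp (0 +i* t).

Lemma expiD s t : expi (s + t) = expi s * expi t.
Proof. by rewrite /expi -cexpD; congr cexp; apply: complex_ext; rewrite /= ?addr0. Qed.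

Lemma expi0 : expi 0 = 1.
Proof. exact: cexp0. Qed.

Lemma normc_expi t : normc (expi t) = 1.
Proof. by rewrite normc_cexp /= expR0. Qed.

Lemma expi_mulrn t j : expi (t *+ j) = expi t ^+ j.
Proof.
elim: j => [|j IH]; first by rewrite mulr0n expr0 expi0.
by rewrite mulrS exprS expiD IH.
Qed.

Lemma expiE t : expi t = cos t +i* sin t.
Proof. by rewrite /expi /cexp /= expR0 mul1r. Qed.

Lemma normc_half_expi t : normc ((1 + expi t) / 2) = `|cos (t / 2)|.
Proof.
have -> : (1 + expi t) / 2 = expi (t / 2) * (cos (t / 2))%:C.
  have {1}-> : t = t / 2 + t / 2 by field.
  rewrite expiD; have n1 : 1 = expi (t / 2) * expi (- (t / 2)).
    by rewrite -expiD subrr expi0.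
  rewrite {1}n1 -mulrDr -mulrA; congr (_ * _).
  rewrite !expiE cosN sinN; apply: complex_ext; rewrite ?complexRI.
    by rewrite -(rmorph_nat (real_complex R)) -fmorphV /=; field.
  by rewrite -(rmorph_nat (real_complex R)) -fmorphV /=; field.
by rewrite normcM normc_expi mul1r normc_real.
Qed.

Definition binavg (K : nat) (u : nat -> R[i]) : R[i] :=
  \sum_(j < K.+1) ('C(K, j)%:R / 2 ^+ K)%:C * u j.

Lemma binavg_weights K : \sum_(j < K.+1) ('C(K, j)%:R / 2 ^+ K) = 1 :> R.
Proof.
rewrite -mulr_suml; have -> : \sum_(j < K.+1) 'C(K, j)%:R = 2 ^+ K :> R.
  rewrite (_ : 2 = 1 + 1)// exprDn; apply: eq_bigr => j _.
  by rewrite !expr1n mul1r.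
by rewrite divff// expf_neq0// pnatr_eq0.
Qed.

(** The reason for binomial weights: an exponential with |w| = 1 is damped exponentially in K,
    except at w = 1, where it is kept unchanged. *)
Lemma binavg_geo K (w : R[i]) : binavg K (fun j => w ^+ j) = ((1 + w) / 2) ^+ K.
Proof.
rewrite expr_div_n exprDn mulr_suml /binavg; apply: eq_bigr => j _.
rewrite expr1n mul1r -[in RHS]mulr_natl rmorphM fmorphV rmorphXn !rmorph_nat.
by rewrite mulrAC.
Qed.

Lemma binavgD K u v : binavg K (fun j => u j + v j) = binavg K u + binavg K v.
Proof. by rewrite /binavg -big_split; apply: eq_bigr => j _; rewrite mulrDr. Qed.

Lemma binavgZ K c u : binavg K (fun j => c * u j) = c * binavg K u.
Proof. by rewrite /binavg mulr_sumr; apply: eq_bigr => j _; rewrite mulrCA. Qed.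

Lemma eq_binavg K u v : (forall j, u j = v j) -> binavg K u = binavg K v.
Proof. by move=> uv; apply: eq_bigr => j _; rewrite uv. Qed.

Lemma binavg_le K u (B : R) : (forall j, (j <= K)%N -> normc (u j) <= B) ->
  normc (binavg K u) <= B.
Proof.
move=> uB; apply: (le_trans (le_normc_sum _ _ _)).
rewrite -[leRHS]mul1r -[1 in leRHS](binavg_weights K) mulr_suml; apply: ler_sum => j _.
rewrite normcM normc_real ger0_norm ?divr_ge0 ?exprn_ge0//.
by rewrite ler_wpM2l ?divr_ge0 ?exprn_ge0// uB// -ltnS.
Qed.

(** For q < 0 the largest value is taken at r / 2, which costs the factor 2^|q|; for q >= 0 it is
    taken at r. *)
Lemma powR_half (r t q : R) : 0 < r -> r / 2 <= t <= r ->
  t `^ q <= 2 `^ `|q| * r `^ q.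
Proof.
move=> r0 /andP[rt tr]; have t0 : 0 < t by lra.
have [q0|q0] := leP 0 q.
  apply: (@le_trans _ _ (r `^ q)); first by apply: ge0_ler_powR; rewrite ?nnegrE; lra.
  rewrite ler_peMl ?powR_ge0// -[leLHS](powRr0 (2 : R)).
  by apply: ler_powR; rewrite ?ler1n.
rewrite ltr0_norm// -[in leLHS](opprK q) -[in r `^ _](opprK q).
rewrite !(powRN _ (- q)) ler_pdivlMr ?powR_gt0//.
rewrite mulrC ler_pdivrMr ?powR_gt0// -powRM//; last lra.
apply: ge0_ler_powR; rewrite ?nnegrE; lra.
Qed.

End BinomialAverage.

Lemma normc_parallelogram (R : realType) (z w : R[i]) :
  normc (z + 'i * w) ^+ 2 + normc (z - 'i * w) ^+ 2 =
  2 * (normc z ^+ 2 + normc w ^+ 2).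
Proof. by case: z => a b; case: w => c d; rewrite !normcE2 /=; ring. Qed.

Section BesselAsymptotics.
Context {R : realType}.
Variable a : R[i].
Hypothesis aN1 : -1 < Re a.

Let b := a + 1.
Let d := a * (a + 1).
Let y := cosT a.
(* v = y' + b y / x turns Bessel's equation for y into a first order system that
   is a rotation up to a damping b / x and a perturbation of order x^-2. *)
Let v (x : R) := - sinT a x + b / x%:C * y x.

Let dy (x : R) : 0 < x -> is_cderive x y (v x - b / x%:C * y x).
Proof. by move=> _; rewrite /v addrK; exact: cosT_derive. Qed.

Let b0 : a + 1 != 0.
Proof.
apply: complex_neq0_Re; rewrite gt_eqF// complex_ReD.
by rewrite -ltrBlDr sub0r.
Qed.

Let dv (x : R) : 0 < x ->
  is_cderive x v (- y x - b / x%:C * v x + d / (x ^+ 2)%:C * y x).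
Proof.
move=> x0; have xn0 : x != 0 by rewrite gt_eqF.
have h3 : is_derive x 1 (fun x : R => x^-1) (- (x ^+ 2)^-1).
  have h := @is_deriveV R id x 1 _ xn0 (is_derive_id _ _).
  by apply: is_derive_eq; rewrite /GRing.scale/=; field.
have D := is_cderiveD (is_cderiveN (sinT_derive x aN1))
   (is_cderiveM (is_cderiveZ b (is_cderive_real h3)) (cosT_derive x aN1)).
have {}D := is_cderive_ext (g := v) _ D.
have xc0 : x%:C != 0 by apply: complex_neq0_Re.
(* This substitution is where Bessel's equation is used: the transform with exponent a + 1
   disappears from the system. *)
have Ey : cosT (a + 1) x = 2 * (a + 1) / x%:C * sinT a x.
  by rewrite sinTE//; field; rewrite b0 xc0.
apply: is_cderive_eq (D _) _.
  by move=> t; rewrite /v fmorphV.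
rewrite Ey /v /d /b -/y rmorphN fmorphV rmorphXn /=.
by rewrite /y; field.
Qed.

Let en := energy y v.

Let p := Re a + 1.

Let pE : Re b = p.
Proof. by rewrite /b !complexRI. Qed.

Let en_bounds : exists C : R, 0 <= C /\ forall x, 1 <= x ->
  normc (y x) <= C * x `^ (- p) /\ normc (v x) <= C * x `^ (- p).
Proof.
have [C [C0 HC]] := energy_upper dy dv.
exists (Num.sqrt C); split; first exact: sqrtr_ge0.
move=> x x1; have := HC x x1; rewrite pE => h.
have E : C * x `^ (- (2 * p)) = (Num.sqrt C * x `^ (- p)) ^+ 2.
  by rewrite exprMn sqr_sqrtr// -powR_mulrn ?powR_ge0// -powRrM; congr (_ * _ `^ _); ring.
have P : 0 <= Num.sqrt C * x `^ (- p) by rewrite mulr_ge0 ?sqrtr_ge0 ?powR_ge0.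
rewrite E in h; split.
  rewrite -ler_sqr ?nnegrE ?normc_ge0//; apply: le_trans h.
  by rewrite /energy lerDl sqr_ge0.
rewrite -ler_sqr ?nnegrE ?normc_ge0//; apply: le_trans h.
by rewrite /energy lerDr sqr_ge0.
Qed.

Lemma cosT_upper : exists C : R, 0 <= C /\ forall x, 1 <= x ->
  normc (cosT a x) <= C * x `^ (- p).
Proof.
have [C [C0 H]] := en_bounds; exists C; split => // x /H[]//.
Qed.

(** The system is singular at 0, so the energy estimate is started at some x1 in (0, 1] where the
    energy is positive; such a point exists by continuity, since y(0) = beta(a) is nonzero. By the
    parallelogram identity one of |y + iv|^2 and |y - iv|^2 is then at least the energy. *)
Let en_lower : exists2 c : R, 0 < c & forall x, 1 <= x ->
  c * x `^ (- p) <= normc (y x + 'i * v x) \/ c * x `^ (- p) <= normc (y x - 'i * v x).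
Proof.
have [x1 [x10 x11] e0] : exists2 x1 : R, 0 < x1 /\ x1 <= 1 & 0 < en x1.
  have [c1 c2] := is_cderive_continuous (cosT_derive 0 aN1).
  have y0 : 0 < normc (y 0) by rewrite normc_gt0 /y cosT0 beta_neq0.
  have m0 : 0 < normc (y 0) / 2 by rewrite divr_gt0.
  move/cvgrPdist_lt : c1 => /(_ _ m0) n1; move/cvgrPdist_lt : c2 => /(_ _ m0) n2.
  have [e e0' H] := filterI n1 n2; have e0 : 0 < e := e0'.
  pose x1 := Num.min (e / 2) 1.
  have x10 : 0 < x1 by rewrite lt_min divr_gt0//= ltr01.
  have x1e : x1 < e by rewrite gt_min; apply/orP; left; lra.
  exists x1; first by split => //; rewrite ge_min lexx orbT.
  have bx : ball_ [eta Num.norm] 0 e x1 by rewrite /ball_/= sub0r normrN gtr0_norm.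
  have [h1' h2'] := H x1 bx.
  have h1 : `|Re (y 0) - Re (y x1)| < normc (y 0) / 2 := h1'.
  have h2 : `|Im (y 0) - Im (y x1)| < normc (y 0) / 2 := h2'.
  have y1 : 0 < normc (y x1).
    have := le_normcD (y x1) (y 0 - y x1); rewrite addrC subrK.
    have := normc_le_ReIm (y 0 - y x1).
    by rewrite complex_ReD complex_ReN complex_ImD complex_ImN; move: h1 h2; lra.
  by rewrite /en /energy ltr_pwDl ?exprn_gt0// sqr_ge0.
have [c c0 H] := energy_lower dy dv x10 e0.
exists (Num.sqrt c); first by rewrite sqrtr_gt0.
move=> x xx; have := H x (le_trans x11 xx); rewrite pE => h.
have E : c * x `^ (- (2 * p)) = (Num.sqrt c * x `^ (- p)) ^+ 2.
  by rewrite exprMn sqr_sqrtr ?(ltW c0)// -powR_mulrn ?powR_ge0// -powRrM; congr (_ * _ `^ _); ring.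
have P : 0 <= Num.sqrt c * x `^ (- p) by rewrite mulr_ge0 ?sqrtr_ge0 ?powR_ge0.
have par := normc_parallelogram (y x) (v x); rewrite -/(energy y v x) in par.
rewrite E in h; move: P h par.
have := normc_ge0 (y x + 'i * v x); have := normc_ge0 (y x - 'i * v x).
move: (normc (y x - 'i * v x)) (normc (y x + 'i * v x)) (Num.sqrt c * x `^ (- p))
  (energy y v x) => B A D e B0 A0 D0 h par.
have [h1|h1] := leP D B; first by right.
left; rewrite leNgt; apply/negP => h2.
have AD : A ^+ 2 < D ^+ 2 by rewrite ltrXn2r// ?nnegrE.
have BD : B ^+ 2 < D ^+ 2 by rewrite ltrXn2r// ?nnegrE.
by lra.
Qed.

(** For s = 1 or -1, y(x) is half the sum of e^(-isx) q(s, x) and e^(isx) q(-s, x). The rotation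
    cancels in these amplitudes, so their derivatives are smaller than the solution by a factor of
    order 1/x. *)
Let q (s x : R) := expi (s * x) * (y x + (0 +i* s) * v x).

Let q_derive (s x : R) : s ^+ 2 = 1 -> 0 < x ->
  is_cderive x (q s) (expi (s * x) * (- (b / x%:C) * (y x + (0 +i* s) * v x)
    + (0 +i* s) * (d / (x ^+ 2)%:C * y x))).
Proof.
move=> s2 x0.
have D := is_cderiveM (is_cderive_expi x s)
  (is_cderiveD (dy x0) (is_cderiveZ (0 +i* s) (dv x0))).
apply: is_cderive_eq D _.
have I2 : (0 +i* s) * (0 +i* s) = -1 :> R[i].
  by apply: complex_ext; rewrite !complexRI/= ?oppr0; nra.
rewrite -/(expi (s * x)); move: (expi _) (d / _) (b / _) (y x) (v x) => e D B Y V.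
set I := 0 +i* s in I2 *.
transitivity (e * (- B * (Y + I * V) + I * (D * Y)) + e * V * (1 + I * I)); first by ring.
by rewrite I2 subrr mulr0 addr0.
Qed.

Let q_var : exists C : R, 0 <= C /\ forall (s r : R) (j : nat), s ^+ 2 = 1 ->
  2 <= r -> 2 * j%:R <= r ->
  normc (q s (r - j%:R) - q s r) <= C * (j%:R / r) * r `^ (- p).
Proof.
have [C [C0 HC]] := en_bounds.
pose M := (2 * normc b + normc d) * C.
have M0 : 0 <= M by rewrite !mulr_ge0// addr_ge0 ?mulr_ge0 ?normc_ge0.
(* The first 2 comes from treating real and imaginary parts separately, the second from 1/t <= 2/r
   on [r - j, r], and the power of 2 from comparing t^(-p) with r^(-p) there. *)
exists (2 * (M * 2 * 2 `^ `|- p|)); split.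
  by rewrite mulr_ge0// mulr_ge0 ?powR_ge0// mulr_ge0.
move=> s r j s2 r2 jr; rewrite normcB.
have j0 : 0 <= j%:R :> R by [].
have nI : normc (0 +i* s) = 1 by rewrite /normc expr0n add0r s2 sqrtr1.
have jr' : r - j%:R <= r by lra.
have B t : r - j%:R <= t <= r -> normc (expi (s * t) * (- (b / t%:C) * (y t + (0 +i* s) * v t)
    + (0 +i* s) * (d / (t ^+ 2)%:C * y t))) <= M * (2 / r) * (2 `^ `|- p| * r `^ (- p)).
  move=> /andP[t1 t2]; have t0 : 1 <= t by lra.
  have [hy hv] := HC t t0; have tP := powR_ge0 t (- p).
  have tp : 0 < t by lra.
  have tv : 0 < t^-1 by rewrite invr_gt0.
  have tv1 : t^-1 <= 1 by rewrite invf_le1.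
  rewrite normcM normc_expi mul1r (le_trans (le_normcD _ _))//.
  have E1 : normc (- (b / t%:C) * (y t + (0 +i* s) * v t)) <= normc b * t^-1 * (2 * (C * t `^ (- p))).
    rewrite normcM normcN normcM normcV normc_real gtr0_norm//.
    apply: ler_wpM2l; first by rewrite mulr_ge0 ?normc_ge0// ltW.
    by rewrite (le_trans (le_normcD _ _))// normcM nI mul1r; lra.
  have E2 : normc ((0 +i* s) * (d / (t ^+ 2)%:C * y t)) <= normc d * t^-1 * (C * t `^ (- p)).
    rewrite normcM nI mul1r normcM [normc (d / _)]normcM normcV normc_real.
    rewrite ger0_norm ?sqr_ge0//.
    apply: ler_pM => //; rewrite ?mulr_ge0 ?normc_ge0 ?invr_ge0 ?sqr_ge0//.
    rewrite ler_wpM2l ?normc_ge0// expr2 invfM; nra.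
  apply: (le_trans (lerD E1 E2)).
  have -> : normc b * t^-1 * (2 * (C * t `^ (- p))) + normc d * t^-1 * (C * t `^ (- p)) =
    M * t^-1 * t `^ (- p) by rewrite /M; ring.
  apply: ler_pM => //; first by rewrite mulr_ge0// ltW.
    rewrite ler_wpM2l// -[2 / r]invrK invf_div lef_pV2 ?posrE//; last lra.
    lra.
  by apply: powR_half; lra.
have qd t : r - j%:R <= t <= r -> is_cderive t (q s) (expi (s * t) * (- (b / t%:C) * (y t + (0 +i* s) * v t)
    + (0 +i* s) * (d / (t ^+ 2)%:C * y t))).
  by move=> /andP[t1 t2]; apply: q_derive => //; lra.
apply: (le_trans (is_cderive_bound jr' qd B)).
by rewrite le_eqVlt; apply/orP; left; apply/eqP; ring.
Qed.

(** The sign s is the one for which the amplitude q(s, r) is large. After the twist by e^(-isj) its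
    oscillation no longer depends on j and survives the average, while the opposite one becomes
    e^(-2isj) and is reduced by (cos 1)^K. The term K / r pays for the variation of the amplitudes
    over the window. *)
Lemma cosT_binavg_lower : exists c C : R, [/\ 0 < c, 0 <= C &
  forall (r : R) (K : nat), 2 <= r -> 2 * K%:R <= r -> exists s : R,
    (s = 1 \/ s = -1) /\
    r `^ (- p) * (c - C * (K%:R / r) - C * cos 1 ^+ K) <=
    normc (binavg K (fun j => expi (- s) ^+ j * cosT a (r - j%:R)))].
Proof.
have [C1 [C10 H1]] := en_bounds; have [C2 [C20 H2]] := q_var.
have [c c0 Hc] := en_lower.
exists (c / 2), (C1 + C2); split; [by rewrite divr_gt0|exact: addr_ge0|].
move=> r K r2 Kr; have r1 : 1 <= r by lra.
have [s [s1 hs]] : exists s : R, (s = 1 \/ s = -1) /\ c * r `^ (- p) <= normc (q s r).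
  have [h|h] := Hc r r1.
    by exists 1; split; [left|rewrite /q normcM normc_expi mul1r].
  exists (-1); split; [by right|rewrite /q normcM normc_expi mul1r].
  by apply: le_trans h _; rewrite le_eqVlt; apply/orP; left; apply/eqP; congr normc;
    congr (_ + _); rewrite -mulNr; congr (_ * _); apply: complex_ext; rewrite /= ?oppr0.
exists s; split => //.
have s2 : s ^+ 2 = 1 by case: s1 => ->; rewrite ?sqrrN expr1n.
have s2' : (- s) ^+ 2 = 1 by rewrite sqrrN.
(* The error made by freezing both amplitudes at r. *)
pose e j := expi (- s) ^+ j * cosT a (r - j%:R) -
  2^-1 * (expi (- (s * r)) * q s r + expi (s * r) * q (- s) r * expi (- (2 * s)) ^+ j).
have eE j : e j = 2^-1 * (expi (- (s * r)) * (q s (r - j%:R) - q s r) +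
    expi (s * r) * expi (- (2 * s)) ^+ j * (q (- s) (r - j%:R) - q (- s) r)).
  rewrite /e; have yE x : cosT a x = 2^-1 * (expi (- (s * x)) * q s x + expi (s * x) * q (- s) x).
    have i1 Z : expi (- (s * x)) * (expi (s * x) * Z) = Z.
      by rewrite mulrA -expiD addNr expi0 mul1r.
    have i2 Z : expi (s * x) * (expi (- s * x) * Z) = Z.
      by rewrite mulrA -expiD mulNr subrr expi0 mul1r.
    rewrite /q i1 i2 /y.
    have -> : (0 +i* - s) = - (0 +i* s) by apply: complex_ext; rewrite /= ?oppr0.
    by rewrite mulNr; field.
  rewrite yE; move: (q s _) (q (- s) _) (q s r) (q (- s) r) => q1 q2 q3 q4.
  have x1 : expi (- (s * (r - j%:R))) = expi (- (s * r)) * expi s ^+ j.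
    by rewrite -expi_mulrn -expiD -mulr_natr; congr expi; ring.
  have x2 : expi (s * (r - j%:R)) = expi (s * r) * expi (- s) ^+ j.
    by rewrite -expi_mulrn -expiD -mulr_natr; congr expi; ring.
  have x3 : expi (- (2 * s)) ^+ j = expi (- s) ^+ j * expi (- s) ^+ j.
    by rewrite -exprMn -expiD; congr (expi _ ^+ j); ring.
  have x4 : expi (- s) ^+ j * expi s ^+ j = 1.
    by rewrite -exprMn -expiD addNr expi0 expr1n.
  rewrite x1 x2 x3; move: x4; move: (expi (- s) ^+ j) (expi s ^+ j) => f g fg.
  move: (expi (- (s * r))) (expi (s * r)) => e1 e2; set h := 2^-1.
  transitivity (h * (e1 * (q1 - q3) + e2 * (f * f) * (q2 - q4)) + h * e1 * q1 * (f * g - 1)).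
    by ring.
  by rewrite fg subrr mulr0 addr0.
have eB j : (j <= K)%N -> normc (e j) <= C2 * (K%:R / r) * r `^ (- p).
  move=> jK; have jK' : j%:R <= K%:R :> R by rewrite ler_nat.
  have jr : 2 * j%:R <= r by lra.
  have h1 := H2 s r j s2 r2 jr; have h2 := H2 (- s) r j s2' r2 jr.
  have h3 : C2 * (j%:R / r) * r `^ (- p) <= C2 * (K%:R / r) * r `^ (- p).
    by rewrite ler_wpM2r ?powR_ge0// ler_wpM2l// ler_wpM2r// invr_ge0; lra.
  rewrite eE normcM normcV normc_nat.
  have := le_normcD (expi (- (s * r)) * (q s (r - j%:R) - q s r))
    (expi (s * r) * expi (- (2 * s)) ^+ j * (q (- s) (r - j%:R) - q (- s) r)).
  rewrite normcM normc_expi mul1r normcM normcM normcX !normc_expi expr1n !mul1r.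
  by lra.
have -> : binavg K (fun j => expi (- s) ^+ j * cosT a (r - j%:R)) =
   2^-1 * (expi (- (s * r)) * q s r) + (binavg K e +
   2^-1 * (expi (s * r) * q (- s) r) * ((1 + expi (- (2 * s))) / 2) ^+ K).
  rewrite -binavg_geo -binavgZ -binavgD.
  have one : binavg K (fun=> 1 : R[i]) = 1.
    transitivity (binavg K (fun j => (1 : R[i]) ^+ j)).
      by apply: eq_binavg => j; rewrite expr1n.
    by rewrite binavg_geo divff ?expr1n// (pnatr_eq0 _ 2).
  rewrite -[X in X + _]mulr1 -[X in _ * X + _]one -binavgZ -binavgD.
  by apply: eq_binavg => j; rewrite /e; ring.
apply: le_trans (le_normcB _ _).
have g1 : normc (2^-1 * (expi (- (s * r)) * q s r)) = normc (q s r) / 2.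
  by rewrite normcM normcV normc_nat normcM normc_expi mul1r mulrC.
have g2 : normc (binavg K e) <= C2 * (K%:R / r) * r `^ (- p) by exact: binavg_le.
have g3 : normc (2^-1 * (expi (s * r) * q (- s) r) * ((1 + expi (- (2 * s))) / 2) ^+ K) <=
    C1 * r `^ (- p) * cos 1 ^+ K.
  rewrite normcM normcX normc_half_expi.
  have -> : `|cos (- (2 * s) / 2)| = cos 1 :> R.
    have -> : - (2 * s) / 2 = - s by field.
    by rewrite cosN; case: s1 => ->; rewrite ?cosN ger0_norm// ltW// cos1_gt0.
  apply: ler_wpM2r; first by rewrite exprn_ge0// ltW// cos1_gt0.
  rewrite normcM normcV normc_nat normcM normc_expi mul1r /q normcM normc_expi mul1r.
  have [hy hv] := H1 r r1; have nI : normc (0 +i* - s) = 1 by rewrite /normc expr0n add0r s2' sqrtr1.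
  have := le_normcD (y r) ((0 +i* - s) * v r); rewrite normcM nI mul1r; lra.
have g4 := le_normcD (binavg K e) (2^-1 * (expi (s * r) * q (- s) r) * ((1 + expi (- (2 * s))) / 2) ^+ K).
have W := powR_ge0 r (- p).
have k0 : 0 <= K%:R / r by rewrite divr_ge0//; lra.
have z0 : 0 <= cos 1 ^+ K :> R by rewrite exprn_ge0// ltW// cos1_gt0.
rewrite g1; move: g2 g3 g4 hs W k0 z0.
move: (normc _) (normc _) (normc _) (normc _) (r `^ _) (K%:R / r) (cos 1 ^+ K).
move=> n1 n2 n3 n4 w k z g2 g3 g4 hs w0 k0 z0.
have : 0 <= C1 * k * w by rewrite !mulr_ge0.
have : 0 <= C2 * z * w by rewrite !mulr_ge0.
by nra.
Qed.

End BesselAsymptotics.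

(** * Rotation invariance and powers of the distance to the sphere *)

Section Shears.
Context {R : realType}.
Local Notation leb := (@lebesgue_measure R).
Local Notation M := (measurableTypeR R).
Local Open Scope ereal_scope.

Definition shearx (t : R) (p : M * M) : M * M := ((p.1 + t * p.2)%R : M, p.2).
Definition sheary (t : R) (p : M * M) : M * M := (p.1, (p.2 + t * p.1)%R : M).

Lemma measurable_shearx t : measurable_fun setT (shearx t).
Proof.
apply/measurable_fun_pairP; split => /=; last exact: measurable_snd.
by apply: measurable_funD; [exact: measurable_fst|apply: measurable_funM => //; exact: measurable_snd].
Qed.

Lemma measurable_sheary t : measurable_fun setT (sheary t).
Proof.
apply/measurable_fun_pairP; split => /=; first exact: measurable_fst.
by apply: measurable_funD; [exact: measurable_snd|apply: measurable_funM => //; exact: measurable_fst].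
Qed.

Lemma sheary_invariant t (A : set (M * M)) : measurable A ->
  (leb \x leb) A = (leb \x leb) (sheary t @^-1` A).
Proof.
move=> mA; rewrite /product_measure1 /=; apply: eq_integral => x _ /=.
have -> : xsection (sheary t @^-1` A) x =
    (fun s : M => (s + t * x)%R : M) @^-1` (xsection A x).
  by apply/seteqP; split => s; rewrite /xsection/= !inE.
rewrite -lebesgue_measure_shift//; exact: measurable_xsection.
Qed.

Lemma shearx_invariant t (A : set (M * M)) : measurable A ->
  (leb \x leb) A = (leb \x leb) (shearx t @^-1` A).
Proof.
(* This shear acts on horizontal sections, so the product measure is first rewritten with the other
   order of integration. *)
have E B : measurable B -> (leb \x leb) B = (leb \x^ leb) B.
  move=> mB; apply: product_measure_unique => // C D mC mD /=.
  by rewrite product_measure2E.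
move=> mA; have mA' : measurable (shearx t @^-1` A).
  by rewrite -[X in measurable X]setTI; exact: measurable_shearx.
rewrite !E// /product_measure2 /=; apply: eq_integral => y _ /=.
have -> : ysection (shearx t @^-1` A) y =
    (fun s : M => (s + t * y)%R : M) @^-1` (ysection A y).
  by apply/seteqP; split => s; rewrite /ysection/= !inE.
rewrite -lebesgue_measure_shift//; exact: measurable_ysection.
Qed.

End Shears.

Section Rotation.
Context {R : realType}.
Local Notation leb := (@lebesgue_measure R).
Local Notation M := (measurableTypeR R).

Lemma cintegral_shearx t (f : M * M -> R[i]) : cmeasurable setT f ->
  cintegrable (leb \x leb)%E setT f ->
  cintegrable (leb \x leb)%E setT (f \o shearx t) /\
  cintegral (leb \x leb)%E setT f = cintegral (leb \x leb)%E setT (f \o shearx t).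
Proof.
move=> mf intf.
have h := (cintegrable_transport (measurable_shearx t) (@shearx_invariant R t) mf).1 intf.
by split => //; exact: (cintegral_transport (measurable_shearx t) (@shearx_invariant R t) mf h).
Qed.

Lemma cintegral_sheary t (f : M * M -> R[i]) : cmeasurable setT f ->
  cintegrable (leb \x leb)%E setT f ->
  cintegrable (leb \x leb)%E setT (f \o sheary t) /\
  cintegral (leb \x leb)%E setT f = cintegral (leb \x leb)%E setT (f \o sheary t).
Proof.
move=> mf intf.
have h := (cintegrable_transport (measurable_sheary t) (@sheary_invariant R t) mf).1 intf.
by split => //; exact: (cintegral_transport (measurable_sheary t) (@sheary_invariant R t) mf h).
Qed.

Definition rot2 (c d : R) (p : M * M) : M * M :=
  (c * p.1 - d * p.2 : M, d * p.1 + c * p.2 : M).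

(* A plane rotation is a product of three shears. *)
Lemma cintegral_rot2 (c d : R) (f : M * M -> R[i]) : c ^+ 2 + d ^+ 2 = 1 ->
  d != 0 -> cmeasurable setT f -> cintegrable (leb \x leb)%E setT f ->
  cintegrable (leb \x leb)%E setT (f \o rot2 c d) /\
  cintegral (leb \x leb)%E setT f = cintegral (leb \x leb)%E setT (f \o rot2 c d).
Proof.
(* For an angle with cosine c and sine d this is the tangent of the half angle, the parameter of the
   two outer shears. *)
move=> cd d0 mf intf; pose u := (1 - c) / d.
have comp g h : cmeasurable setT g -> measurable_fun setT h ->
    cmeasurable setT ((g : M * M -> R[i]) \o (h : M * M -> M * M)).
  by move=> [g1 g2] mh; split; [exact: (measurableT_comp g1 mh)|exact: (measurableT_comp g2 mh)].
have [i1 e1] := cintegral_shearx (- u) mf intf.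
have m1 := comp _ _ mf (measurable_shearx (- u)).
have [i2 e2] := cintegral_sheary d m1 i1.
have m2 := comp _ _ m1 (measurable_sheary d).
have [i3 e3] := cintegral_shearx (- u) m2 i2.
have E : f \o rot2 c d = ((f \o shearx (- u)) \o sheary d) \o shearx (- u).
  apply/funext => -[x s] /=; congr f; rewrite /rot2 /shearx /sheary /=.
  have ud : u * d = 1 - c by rewrite /u divfK.
  have uc : u * (1 + c) = d.
    rewrite /u mulrAC (_ : (1 - c) * (1 + c) = d * d) ?mulfK//.
    transitivity (1 - c ^+ 2); first by ring.
    by rewrite -[1 in LHS]cd; ring.
  congr pair.
    transitivity ((1 - u * d) * x - u * (1 + (1 - u * d)) * s); last by ring.
    by rewrite ud (_ : 1 - (1 - c) = c) ?uc//; ring.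
  transitivity (d * x + (1 - u * d) * s); last by ring.
  by rewrite ud; ring.
by rewrite E; split => //; rewrite e1 e2 e3.
Qed.

End Rotation.

Section RealKernel.
Context {R : realType}.
Local Notation leb := (@lebesgue_measure R).
Local Notation M := (measurableTypeR R).

Definition rpow (p T : R) : R := if 0 < T then T `^ p else 0.

Lemma rpow_ge0 p T : 0 <= rpow p T.
Proof. by rewrite /rpow; case: ifP => // _; exact: powR_ge0. Qed.

Lemma normc_kpowE (a : R[i]) T : normc (kpow a T) = rpow (Re a) T.
Proof. exact: normc_kpow. Qed.

Lemma Re_kpow p T : Re (kpow p%:C T) = rpow p T.
Proof. by rewrite /kpow /rpow; case: ifPn => // T0; rewrite cpow_real. Qed.

Lemma measurable_rpow d (S : measurableType d) (h : S -> R) p :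
  measurable_fun setT h -> measurable_fun setT (fun x => rpow p (h x)).
Proof.
move=> mh; have [m _] := cmeasurable_kpow p%:C mh.
by move: m; under eq_fun do rewrite Re_kpow.
Qed.

Lemma rpow_sq_integral (p U : R) : -1 < p ->
  leb.-integrable setT (fun s => (rpow p (U - s ^+ 2))%:E) /\
  \int[leb]_s rpow p (U - s ^+ 2) = Re (beta p%:C) * rpow (p + 2^-1) U.
Proof.
move=> pN1; have [[i1 _] e] := @kpow_sq_integral R p%:C U pN1.
split; first by move: i1; under eq_fun do rewrite Re_kpow.
have := congr1 (@complex.Re R) e; rewrite /cintegral [X in X = _]/=.
have -> : \int[leb]_s rpow p (U - s ^+ 2) = \int[leb]_s Re (kpow p%:C (U - s ^+ 2)).
  by apply: eq_Rintegral => s _; rewrite Re_kpow.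
by move=> ->; rewrite -rmorphD beta_real// complex_ReZ Re_kpow.
Qed.

End RealKernel.

(** * Integration in n variables by slicing *)

Section TupleIntegral.
Context {R : realType}.
Local Notation leb := (@lebesgue_measure R).
Local Notation M := (measurableTypeR R).
Local Notation T n := (n.-tuple (measurableTypeR R)).

Definition sqnorm n (t : T n) : R := \sum_(i < n) (tnth t i : R) ^+ 2.

Definition dotp n (e : 'I_n -> R) (t : T n) : R := \sum_(i < n) e i * (tnth t i : R).

Lemma tnth_tcons0 n (p : M * T n) : tnth (tcons p) ord0 = p.1.
Proof. by []. Qed.

Lemma tnth_tconsS n (p : M * T n) i : tnth (tcons p) (lift ord0 i) = tnth p.2 i.
Proof. by rewrite !(tnth_nth p.1). Qed.

Lemma sqnorm_tcons n (p : M * T n) : sqnorm (tcons p) = p.1 ^+ 2 + sqnorm p.2.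
Proof.
rewrite /sqnorm big_ord_recl tnth_tcons0; congr (_ + _).
by apply: eq_bigr => i _; rewrite tnth_tconsS.
Qed.

Lemma dotp_tcons n (e : 'I_n.+1 -> R) (p : M * T n) :
  dotp e (tcons p) = e ord0 * p.1 + dotp (fun i => e (lift ord0 i)) p.2.
Proof.
rewrite /dotp big_ord_recl tnth_tcons0; congr (_ + _).
by apply: eq_bigr => i _; rewrite tnth_tconsS.
Qed.

Lemma measurable_sqnorm n : measurable_fun setT (@sqnorm n).
Proof.
apply: measurable_sum => i; apply: measurable_funX; exact: measurable_tnth.
Qed.

Lemma measurable_dotp n (e : 'I_n -> R) : measurable_fun setT (@dotp n e).
Proof.
apply: measurable_sum => i; apply: measurable_funM => //; exact: measurable_tnth.
Qed.

Lemma integrable_tupleS n (g : T n.+1 -> R) : measurable_fun setT g ->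
  (lebesgue_tuple n.+1).-integrable setT (EFin \o g) <->
  (leb \x lebesgue_tuple n)%E.-integrable setT (EFin \o (g \o @tcons R n)).
Proof.
move=> mg; apply: (integrable_transport (measurable_tcons (n := n))) => //.
exact/measurable_EFinP.
Qed.

Lemma cintegrable_tupleS n (f : T n.+1 -> R[i]) : cmeasurable setT f ->
  cintegrable (lebesgue_tuple n.+1) setT f <->
  cintegrable (leb \x lebesgue_tuple n)%E setT (f \o @tcons R n).
Proof.
by move=> mf; apply: (cintegrable_transport (measurable_tcons (n := n))).
Qed.

Lemma cintegral_tupleS n (f : T n.+1 -> R[i]) :
  cintegrable (lebesgue_tuple n.+1) setT f ->
  cintegrable leb setT
    (fun x => cintegral (lebesgue_tuple n) setT (fun t => f (tcons (x, t)))) /\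
  cintegral (lebesgue_tuple n.+1) setT f =
  cintegral leb setT
    (fun x => cintegral (lebesgue_tuple n) setT (fun t => f (tcons (x, t)))).
Proof.
move=> intf; have mf := cintegrable_cmeasurable intf.
have h := (cintegrable_tupleS mf).1 intf.
have [i1 e1] := cFubini1 h; split => //.
rewrite e1; apply: (cintegral_transport (measurable_tcons (n := n))) => //.
Qed.

Lemma Rintegral_tuple0 (g : T 0 -> R) :
  (lebesgue_tuple 0).-integrable setT (EFin \o g) /\
  \int[lebesgue_tuple 0]_t g t = g [tuple].
Proof.
have E : g = fun=> g [tuple] by apply/funext => t; rewrite tuple0.
have mg : measurable_fun setT (EFin \o g) by rewrite E; exact: measurable_cst.
split; last by rewrite /Rintegral /= integral_dirac// diracT mul1e.
apply/integrableP; split => //.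
rewrite [X in (X < _)%E]integral_dirac//; first by rewrite diracT mul1e ltry.
exact: (measurableT_comp _ mg).
Qed.

(** Induction on the dimension: the slice at first coordinate x is the same integral at level U -
    x^2, and integrating over x raises the exponent by a further 1/2. For p = 0 these are the
    volumes of balls. *)
Lemma rpow_tuple_integral n (p : R) : -1 < p -> exists2 B : R, 0 <= B &
  forall U : R, (lebesgue_tuple n).-integrable setT
    (EFin \o fun t => rpow p (U - sqnorm t)) /\
  \int[lebesgue_tuple n]_t rpow p (U - sqnorm t) = B * rpow (p + n%:R / 2) U.
Proof.
move=> pN1; elim: n => [|n [B B0 IH]].
  exists 1 => // U; have [i1 e1] := Rintegral_tuple0 (fun t => rpow p (U - sqnorm t)).
  split => //; rewrite e1 mul1r mul0r addr0; congr rpow.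
  by rewrite /sqnorm big_ord0 subr0.
have pn : -1 < p + n%:R / 2.
  by rewrite (lt_le_trans pN1)// lerDl divr_ge0.
pose C := Re (beta (p + n%:R / 2)%:C).
have mU k U : measurable_fun setT (fun t : T k => rpow p (U - sqnorm t)).
  apply: measurable_rpow; apply: measurable_funB => //; exact: measurable_sqnorm.
exists (B * C).
  rewrite mulr_ge0// /C beta_real//= Rintegral_ge0// => s _.
  by rewrite Re_kpow rpow_ge0.
move=> U; have [i1 e1] := rpow_sq_integral U pn.
have E x t : rpow p (U - sqnorm (tcons (x, t))) = rpow p (U - x ^+ 2 - sqnorm t).
  by rewrite sqnorm_tcons/= opprD addrA.
have i2 : (leb \x lebesgue_tuple n)%E.-integrable setT
    (EFin \o ((fun t => rpow p (U - sqnorm t)) \o @tcons R n)).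
  apply: (integrable_prod_bound (F := fun x : M => B * rpow (p + n%:R / 2) (U - x ^+ 2))).
  - by apply: measurableT_comp (mU _ _) _; exact: measurable_tcons.
  - by move=> z /=; exact: rpow_ge0.
  - move=> x; have [h1 h2] := IH (U - x ^+ 2); rewrite -h2 /Rintegral fineK.
      by apply: eq_integral => t _; rewrite /= E.
    exact: integrable_fin_num.
  - by rewrite /comp; under eq_fun do rewrite EFinM; exact: integrableZl.
have i3 := (integrable_tupleS (mU _ _)).2 i2.
split => //.
have -> : \int[lebesgue_tuple n.+1]_t rpow p (U - sqnorm t) =
    \int[(leb \x lebesgue_tuple n)%E]_z rpow p (U - sqnorm (tcons z)).
  congr fine; apply: (integral_transport (measurable_tcons (n := n))) => //.
  by apply/measurable_EFinP; exact: mU.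
have [_ <-] := Rintegral_prod1 i2.
transitivity (\int[leb]_x (B * rpow (p + n%:R / 2) (U - x ^+ 2))).
  apply: eq_Rintegral => x _; rewrite -(IH _).2; apply: eq_Rintegral => t _.
  by rewrite /= E.
rewrite RintegralZl// e1 mulrA; congr (_ * rpow _ _).
by rewrite -natr1; field.
Qed.

Lemma kpow_tuple_integrable n (a : R[i]) (U : R) (h : T n -> R[i]) :
  -1 < Re a -> cmeasurable setT h -> (forall t, normc (h t) <= 1) ->
  cintegrable (lebesgue_tuple n) setT (fun t => kpow a (U - sqnorm t) * h t).
Proof.
move=> aN1 mh h1; have [B _ /(_ U) [i1 _]] := rpow_tuple_integral n aN1.
apply: (le_cintegrable _ _ i1) => //.
  apply: cmeasurableM => //; apply: cmeasurable_kpow.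
  by apply: measurable_funB => //; exact: measurable_sqnorm.
by move=> t _; rewrite normcM normc_kpowE -[leRHS]mulr1 ler_wpM2l// rpow_ge0.
Qed.

Lemma kpow_ball_integrable n (a : R[i]) (U : R) : -1 < Re a ->
  cintegrable (lebesgue_tuple n) setT (fun t => kpow a (U - sqnorm t)).
Proof.
move=> aN1; have h := @kpow_tuple_integrable n a U (fun=> 1) aN1.
apply: eq_cintegrable (h _ _) => //; first by move=> t _; rewrite mulr1.
by move=> t; rewrite normc1.
Qed.

End TupleIntegral.

(** * Fourier transforms of truncated powers *)

Section BesselKernel.
Context {R : realType}.
Local Notation leb := (@lebesgue_measure R).
Local Notation M := (measurableTypeR R).
Local Notation T n := (n.-tuple (measurableTypeR R)).

Lemma cmeasurable_expi d (S : measurableType d) (h : S -> R) :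
  measurable_fun setT h -> cmeasurable setT (fun x => expi (h x)).
Proof.
by move=> mh; apply: cmeasurable_cexp; split => //=; exact: measurable_cst.
Qed.

Lemma measurable_affine (U : R) : measurable_fun setT (fun s : M => U - s ^+ 2 : M).
Proof. by apply: measurable_funB => //; exact: measurable_funX. Qed.

Lemma cmeasurable_expi_mul (x : R) : cmeasurable setT (fun s : M => expi (- (x * s))).
Proof.
apply: cmeasurable_expi; apply: measurable_funN; exact: measurable_funM.
Qed.

(** The weight is even, so averaging the integral with its reflection under s -> -s removes the
    sine. *)
Lemma cosT_expi (a : R[i]) (x : R) : -1 < Re a ->
  cintegral leb setT (fun s : M => kpow a (1 - s ^+ 2) * expi (- (x * s))) = cosT a x.
Proof.
move=> aN1.
pose F (s : M) := kpow a (1 - s ^+ 2) * expi (- (x * s)).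
have mF : cmeasurable setT F.
  apply: cmeasurableM; last exact: cmeasurable_expi_mul.
  by apply: cmeasurable_kpow; exact: measurable_affine.
have iF : cintegrable leb setT F.
  rewrite /F; under eq_fun do rewrite mulrC.
  apply: (cintegrableMl (M := 1)) => //; first exact: kpow_unit_integrable.
    exact: cmeasurable_expi_mul.
  by move=> s _; rewrite normc_expi.
have [iN eN] := cintegral_opp mF iF.
have h2 : 2 * cintegral leb setT F = 2 * cosT a x.
  rewrite mulr2n mulrDl mul1r -{1}eN -cintegralD// mulrDl mul1r -cintegralD//; last 2 first.
  - exact: cosT_integrable.
  - exact: cosT_integrable.
  apply: eq_cintegral => s _; rewrite /F sqrrN mulrN opprK.
  have -> : expi (- (x * s)) = (cos (x * s))%:C + (cos (x * s))%:C - expi (x * s).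
    by rewrite !expiE cosN sinN; apply: complex_ext; rewrite !complexRI/=; ring.
  by move: (kpow _ _) (cos _)%:C (expi _) => A B C; ring.
have n2 : (2 : R[i]) != 0 by rewrite (pnatr_eq0 _ 2).
exact: (mulfI n2).
Qed.

(* The one-dimensional kernel; its modulus is governed by cosT through
   the substitution s = sqrt U * s'. *)
Definition ballT (a : R[i]) (U x : R) : R[i] :=
  cintegral leb setT (fun s : M => kpow a (U - s ^+ 2) * expi (- (x * s))).

Lemma ballT_integrable (a : R[i]) (U x : R) : -1 < Re a ->
  cintegrable leb setT (fun s : M => kpow a (U - s ^+ 2) * expi (- (x * s))).
Proof.
move=> aN1; under eq_fun do rewrite mulrC.
apply: (cintegrableMl (M := 1)) => //; first exact: (kpow_sq_integral U aN1).1.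
  exact: cmeasurable_expi_mul.
by move=> s _; rewrite normc_expi.
Qed.

Lemma ballTE (a : R[i]) (U x : R) : -1 < Re a -> 0 < U ->
  ballT a U x = cpow U (a + (2^-1)%:C) * cosT a (x * Num.sqrt U).
Proof.
move=> aN1 U0.
have [] := @kpow_sq_scale R a U (fun s => expi (- (x * s))) 1 aN1 U0.
- exact: cmeasurable_expi_mul.
- by move=> s; rewrite normc_expi.
move=> _ E; rewrite /ballT E; congr (_ * _); rewrite -cosT_expi//.
by apply: eq_cintegral => s _; rewrite (mulrA x).
Qed.

Lemma ballT_le0 (a : R[i]) (U x : R) : U <= 0 -> ballT a U x = 0.
Proof.
move=> U0; rewrite /ballT -[RHS](cintegral0 leb setT); apply: eq_cintegral => s _.
by rewrite kpow_le0 ?mul0r//; have := sqr_ge0 (s : R); lra.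
Qed.

Lemma ballTN (a : R[i]) (U x : R) : -1 < Re a -> ballT a U (- x) = ballT a U x.
Proof.
move=> aN1; have [U0|U0] := leP U 0; first by rewrite !ballT_le0.
by rewrite !ballTE// mulNr cosTN.
Qed.

Lemma ballT_norm (a : R[i]) (U x : R) : -1 < Re a -> ballT a U `|x| = ballT a U x.
Proof.
by move=> aN1; have [x0|x0] := leP 0 x; [rewrite ger0_norm|rewrite ltr0_norm// ballTN].
Qed.

Let F2 (a : R[i]) (U : R) (al be : R) (p : M * M) : R[i] :=
  kpow a (U - (p.1 ^+ 2 + p.2 ^+ 2)) * expi (- (al * p.1 + be * p.2)).

Let mF2 a U al be : cmeasurable setT (F2 a U al be).
Proof.
apply: cmeasurableM.
  apply: cmeasurable_kpow; apply: measurable_funB => //.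
  by apply: measurable_funD; apply: measurable_funX; [exact: measurable_fst|exact: measurable_snd].
apply: cmeasurable_expi; apply: measurable_funN.
by apply: measurable_funD; apply: measurable_funM.
Qed.

Let iF2 a U al be : -1 < Re a -> cintegrable (leb \x leb)%E setT (F2 a U al be).
Proof.
move=> aN1; set p := Re a in aN1 *.
have p1 : -1 < p + 2^-1 by lra.
have [i1 _] := rpow_sq_integral U p1.
have ig : (leb \x leb)%E.-integrable setT
    (EFin \o (fun z : M * M => rpow p (U - (z.1 ^+ 2 + z.2 ^+ 2)))).
  apply: (integrable_prod_bound
    (F := fun x : M => Re (beta p%:C) * rpow (p + 2^-1) (U - x ^+ 2))).
  - apply: measurable_rpow; apply: measurable_funB => //.
    by apply: measurable_funD; apply: measurable_funX; [exact: measurable_fst|exact: measurable_snd].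
  - by move=> z; exact: rpow_ge0.
  - move=> x; have [h1 h2] := rpow_sq_integral (U - x ^+ 2) aN1.
    rewrite -h2 /Rintegral fineK.
      by apply: eq_integral => t _; rewrite /= opprD addrA.
    exact: integrable_fin_num.
  - by rewrite /comp; under eq_fun do rewrite EFinM; exact: integrableZl.
apply: (le_cintegrable _ (mF2 a U al be) ig) => // z _.
by rewrite normcM normc_expi mulr1 normc_kpowE.
Qed.

(* Rotating the plane makes the phase depend on a single coordinate; the other
   one is then integrated out. *)
Lemma ballT_plane (a : R[i]) (U al be : R) : -1 < Re a ->
  cintegral leb setT (fun x : M => expi (- (al * x)) * ballT a (U - x ^+ 2) be) =
  beta a * ballT (a + (2^-1)%:C) U (Num.sqrt (al ^+ 2 + be ^+ 2)).
Proof.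
move=> aN1.
have a2 : -1 < Re (a + (2^-1)%:C) by rewrite complex_ReD /=; lra.
have E1 al' be' : cintegral (leb \x leb)%E setT (F2 a U al' be') =
    cintegral leb setT (fun x : M => expi (- (al' * x)) * ballT a (U - x ^+ 2) be').
  have [_ <-] := cFubini1 (iF2 U al' be' aN1).
  apply: eq_cintegral => x _; rewrite /ballT -cintegralZ//; last exact: ballT_integrable.
  apply: eq_cintegral => s _; rewrite /F2/= opprD addrA opprD expiD.
  by rewrite mulrCA mulrA mulrAC mulrA.
have E0 al' : cintegral leb setT (fun x : M => expi (- (al' * x)) * ballT a (U - x ^+ 2) 0) =
    beta a * ballT (a + (2^-1)%:C) U al'.
  rewrite /ballT -cintegralZ//; last exact: ballT_integrable.
  apply: eq_cintegral => x _.
  have -> : cintegral leb setT (fun s : M => kpow a (U - x ^+ 2 - s ^+ 2) * expi (- (0 * s))) =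
      cintegral leb setT (fun s : M => kpow a (U - x ^+ 2 - s ^+ 2)).
    by apply: eq_cintegral => s _; rewrite mul0r oppr0 expi0 mulr1.
  by rewrite (kpow_sq_integral _ aN1).2; ring.
have [->|be0] := eqVneq be 0.
  by rewrite E0 expr0n addr0 sqrtr_sqr ballT_norm.
set rho := Num.sqrt _.
have rho2 : rho ^+ 2 = al ^+ 2 + be ^+ 2 by rewrite sqr_sqrtr// addr_ge0// sqr_ge0.
have rho0 : rho != 0.
  rewrite sqrtr_eq0 -ltNge ltr_wpDl ?sqr_ge0// lt_neqAle eq_sym sqrf_eq0 be0/=.
  exact: sqr_ge0.
have cd : (al / rho) ^+ 2 + (be / rho) ^+ 2 = 1.
  by rewrite !expr_div_n -mulrDl -rho2 divff// expf_neq0.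
have d0 : be / rho != 0 by rewrite mulf_neq0// invr_neq0.
have [_] := cintegral_rot2 cd d0 (mF2 a U al be) (iF2 U al be aN1).
rewrite -E1 => ->; rewrite -E0 -E1; apply: eq_cintegral => -[x s] _.
rewrite /F2 /rot2 /=; set c := al / rho in cd *; set d := be / rho in cd *.
have alE : al = c * rho by rewrite /c divfK.
have beE : be = d * rho by rewrite /d divfK.
congr (kpow _ (_ - _) * expi (- _)).
  transitivity ((c ^+ 2 + d ^+ 2) * (x ^+ 2 + s ^+ 2)); first by ring.
  by rewrite cd mul1r.
rewrite alE beE; transitivity ((c ^+ 2 + d ^+ 2) * rho * x); first by ring.
by rewrite cd; ring.
Qed.

(** One beta factor for each coordinate integrated out; in dimension n + 1 the last coordinate
    carries the frequency, so n factors remain. *)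
Definition ball_const (n : nat) (a : R[i]) : R[i] :=
  \prod_(j < n) beta (a + (j%:R / 2)%:C).

Lemma ball_const_neq0 n (a : R[i]) : -1 < Re a -> ball_const n a != 0.
Proof.
move=> aN1; apply/prodf_neq0 => j _; apply: beta_neq0.
by rewrite complex_ReD /= (lt_le_trans aN1)// lerDl divr_ge0.
Qed.

(** Induction on the dimension: by hypothesis the transform of a slice depends only on the norm of
    the remaining frequency, and the planar identity [ballT_plane] merges that norm with the
    frequency of the first coordinate. *)
Lemma ball_fourier n (a : R[i]) (U : R) (e : 'I_n.+1 -> R) : -1 < Re a ->
  cintegral (lebesgue_tuple n.+1) setT
    (fun t => kpow a (U - sqnorm t) * expi (- dotp e t)) =
  ball_const n a * ballT (a + (n%:R / 2)%:C) U
    (Num.sqrt (\sum_(i < n.+1) e i ^+ 2)).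
Proof.
move=> aN1.
have intf k V (e' : 'I_k -> R) : cintegrable (lebesgue_tuple k) setT
    (fun t => kpow a (V - sqnorm t) * expi (- dotp e' t)).
  apply: kpow_tuple_integrable => //; last by move=> t; rewrite normc_expi.
  by apply: cmeasurable_expi; apply: measurable_funN; exact: measurable_dotp.
elim: n U e => [|n IH] U e.
  have [_ ->] := cintegral_tupleS (intf 1%N U e).
  rewrite /ball_const big_ord0 mul1r mul0r addr0 big_ord1 sqrtr_sqr ballT_norm//.
  apply: eq_cintegral => x _; apply: complex_ext => /=.
    rewrite (Rintegral_tuple0 _).2 sqnorm_tcons dotp_tcons /=.
    by rewrite /sqnorm /dotp !big_ord0 !addr0.
  rewrite (Rintegral_tuple0 _).2 sqnorm_tcons dotp_tcons /=.
  by rewrite /sqnorm /dotp !big_ord0 !addr0.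
have [_ ->] := cintegral_tupleS (intf n.+2 U e).
have an : -1 < Re (a + (n%:R / 2)%:C).
  by rewrite complex_ReD /= (lt_le_trans aN1)// lerDl divr_ge0.
pose be := Num.sqrt (\sum_(i < n.+1) e (lift ord0 i) ^+ 2).
have i2 x : cintegral (lebesgue_tuple n.+1) setT
    (fun t => kpow a (U - sqnorm (tcons (x, t))) * expi (- dotp e (tcons (x, t)))) =
    ball_const n a * (expi (- (e ord0 * x)) * ballT (a + (n%:R / 2)%:C) (U - x ^+ 2) be).
  rewrite mulrCA -(IH (U - x ^+ 2) (fun i => e (lift ord0 i))) -cintegralZ//.
  apply: eq_cintegral => t _; rewrite sqnorm_tcons dotp_tcons /=.
  by rewrite opprD addrA opprD expiD mulrCA.
under eq_cintegral do rewrite i2.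
(* Fubini gives integrability of the slice transforms including the constant [ball_const n a]; it
   can be divided out because it is nonzero. *)
have iball : cintegrable leb setT (fun x : M =>
    expi (- (e ord0 * x)) * ballT (a + (n%:R / 2)%:C) (U - x ^+ 2) be).
  have c0 := ball_const_neq0 n aN1.
  have [h _] := cintegral_tupleS (intf n.+2 U e).
  have := cintegrableZ (ball_const n a)^-1 measurableT h.
  by apply: eq_cintegrable => // x _; rewrite i2 mulKf.
rewrite cintegralZ// ballT_plane// mulrA.
have -> : ball_const n.+1 a = ball_const n a * beta (a + (n%:R / 2)%:C).
  by rewrite /ball_const big_ord_recr.
have -> : a + (n%:R / 2)%:C + (2^-1)%:C = a + (n.+1%:R / 2)%:C.
  by apply: complex_ext; rewrite !complexRI/= -?natr1; field.
have -> // : (e ord0) ^+ 2 + be ^+ 2 = \sum_(i < n.+2) e i ^+ 2.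
rewrite [in RHS]big_ord_recl /be sqr_sqrtr// sumr_ge0// => i _; exact: sqr_ge0.
Qed.

End BesselKernel.

(** * Superpositions of truncated powers *)

Section Layers.
Context {R : realType}.
Local Notation leb := (@lebesgue_measure R).
Local Notation M := (measurableTypeR R).
Local Notation T n := (n.-tuple (measurableTypeR R)).

Lemma measurable_layer n :
  measurable_fun setT (fun z : M * T n => z.1 - sqnorm z.2 : R).
Proof.
apply: measurable_funB; first exact: measurable_fst.
exact: (measurableT_comp (@measurable_sqnorm R n) (@measurable_snd _ _ M (T n))).
Qed.

Lemma cmeasurable_comp d d' (S : measurableType d) (S' : measurableType d')
    (f : S' -> R[i]) (h : S -> S') :
  cmeasurable setT f -> measurable_fun setT h -> cmeasurable setT (f \o h).
Proof. by move=> [f1 f2] mh; split; [exact: (measurableT_comp f1)|exact: (measurableT_comp f2)]. Qed.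

(* At u = |x|^2: a superposition of the truncated powers (tau - |x|^2)_+^a. *)
Definition layer (a : R[i]) (G : M -> R[i]) (u : R) : R[i] :=
  cintegral leb setT (fun tau : M => G tau * kpow a (tau - u)).

(** The weight tau^(Re a + n/2) is, up to a constant, the integral over x of (tau - |x|^2)_+^(Re a),
    so the hypothesis on [G] is exactly what Tonelli's criterion requires. *)
Lemma layer_integrable_prod n (a : R[i]) (G : M -> R[i]) (h : T n -> R) :
  -1 < Re a -> cmeasurable setT G -> measurable_fun setT h ->
  leb.-integrable setT (fun tau : M => (normc (G tau) * rpow (Re a + n%:R / 2) tau)%:E) ->
  cintegrable (leb \x lebesgue_tuple n)%E setT
    (fun z => G z.1 * (kpow a (z.1 - sqnorm z.2) * expi (h z.2))).
Proof.
move=> aN1 mG mh iG.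
have [B B0 HB] := rpow_tuple_integral n aN1.
have mk : measurable_fun setT (fun z : M * T n => rpow (Re a) (z.1 - sqnorm z.2)).
  by apply: measurable_rpow; exact: measurable_layer.
have mG1 : cmeasurable setT (fun z : M * T n => G z.1).
  exact: (cmeasurable_comp mG (@measurable_fst _ _ _ _)).
have ig : (leb \x lebesgue_tuple n)%E.-integrable setT
    (EFin \o (fun z : M * T n => normc (G z.1) * rpow (Re a) (z.1 - sqnorm z.2))).
  apply: (integrable_prod_bound
    (F := fun x : M => B * (normc (G x) * rpow (Re a + n%:R / 2) x))).
  - by apply: measurable_funM => //; exact: measurable_normc mG1.
  - by move=> z; rewrite mulr_ge0 ?normc_ge0 ?rpow_ge0.
  - move=> x; have [h1 h2] := HB x.
    rewrite mulrCA -h2 EFinM /Rintegral fineK; last exact: integrable_fin_num.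
    rewrite -ge0_integralZl//.
    - exact: (measurable_int (lebesgue_tuple n)).
    - by move=> t _; rewrite lee_fin rpow_ge0.
    - by rewrite lee_fin normc_ge0.
  - by rewrite /comp; under eq_fun do rewrite EFinM; exact: integrableZl.
apply: (le_cintegrable _ _ ig) => //.
  apply: cmeasurableM => //; apply: cmeasurableM.
    by apply: cmeasurable_kpow; exact: measurable_layer.
  by apply: cmeasurable_expi; apply: measurableT_comp mh _; exact: measurable_snd.
by move=> z _; rewrite normcM (normcM (kpow _ _)) normc_expi mulr1 normc_kpowE.
Qed.

Lemma layer_integrable n (a : R[i]) (G : M -> R[i]) :
  -1 < Re a -> cmeasurable setT G ->
  leb.-integrable setT (fun tau : M => (normc (G tau) * rpow (Re a + n%:R / 2) tau)%:E) ->
  cintegrable (lebesgue_tuple n) setT (fun t => layer a G (sqnorm t)).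
Proof.
move=> aN1 mG iG.
have i0 := layer_integrable_prod aN1 mG (@measurable_cst _ _ _ _ setT (0 : R)) iG.
have [h _] := cFubini2 i0.
apply: eq_cintegrable h => // t _; apply: eq_cintegral => tau _ /=.
by rewrite expi0 mulr1.
Qed.

(** Integrating over x first replaces each truncated power by its transform; integrating over tau
    first reassembles the layer, and for that the phase is moved inside the tau-integral at each
    fixed point. *)
Lemma layer_fourier n (a : R[i]) (G : M -> R[i]) (e : 'I_n.+1 -> R) :
  -1 < Re a -> cmeasurable setT G ->
  leb.-integrable setT (fun tau : M => (normc (G tau) * rpow (Re a + n.+1%:R / 2) tau)%:E) ->
  (forall u, cintegrable leb setT (fun tau : M => G tau * kpow a (tau - u))) ->
  cintegrable leb setT (fun tau : M => G tau * (ball_const n a *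
    ballT (a + (n%:R / 2)%:C) tau (Num.sqrt (\sum_(i < n.+1) e i ^+ 2)))) /\
  cintegral (lebesgue_tuple n.+1) setT
    (fun t => layer a G (sqnorm t) * expi (- dotp e t)) =
  cintegral leb setT (fun tau : M => G tau * (ball_const n a *
    ballT (a + (n%:R / 2)%:C) tau (Num.sqrt (\sum_(i < n.+1) e i ^+ 2)))).
Proof.
move=> aN1 mG iG iu.
have me : measurable_fun setT (fun t : T n.+1 => - dotp e t).
  by apply: measurable_funN; exact: measurable_dotp.
have i0 := layer_integrable_prod aN1 mG me iG.
have eB tau : cintegral (lebesgue_tuple n.+1) setT
      (fun t => G tau * (kpow a (tau - sqnorm t) * expi (- dotp e t))) =
    G tau * (ball_const n a *
      ballT (a + (n%:R / 2)%:C) tau (Num.sqrt (\sum_(i < n.+1) e i ^+ 2))).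
  rewrite -ball_fourier// -cintegralZ//.
  apply: kpow_tuple_integrable => //; last by move=> t; rewrite normc_expi.
  exact: cmeasurable_expi.
have [iF eF] := cFubini1 i0.
split; first by apply: eq_cintegrable iF => // tau _; exact: eB.
transitivity (cintegral (leb \x lebesgue_tuple n.+1)%E setT
    (fun z => G z.1 * (kpow a (z.1 - sqnorm z.2) * expi (- dotp e z.2)))).
  have [_ <-] := cFubini2 i0; apply: eq_cintegral => t _.
  rewrite mulrC /layer -cintegralZ//; apply: eq_cintegral => tau _ /=.
  by rewrite mulrC mulrA.
by rewrite -eF; apply: eq_cintegral => tau _; exact: eB.
Qed.

Lemma integrableRmkcond (D : set M) (f : M -> R) : measurable D ->
  leb.-integrable D (EFin \o f) ->
  leb.-integrable setT (EFin \o fun x => f x * \1_D x).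
Proof.
move=> mD /(integrable_mkcond _ mD); apply: eq_integrable => // x _ /=.
by rewrite patchE indicE; case: ifP => _; rewrite ?mulr1 ?mulr0.
Qed.

Lemma powR_unit_integrable (q : R) : 0 < q ->
  leb.-integrable `]0, 1[ (EFin \o (fun x : M => x `^ (q - 1))).
Proof.
move=> q0; have qN0 : q != 0 by rewrite gt_eqF.
apply: (@primitive_bounded_integrable _ 0 1 _ (fun x : R => q^-1 * x `^ q) q^-1) => //.
- by move=> x _; exact: powR_ge0.
- move=> x /andP[x0 x1].
  have := is_derive_powR_comp q (is_derive_id x 1) x0.
  move=> /(@is_deriveZ _ _ _ _ q^-1) h.
  have -> : x `^ (q - 1) = q^-1 *: (1 * (q * x `^ (q - 1))).
    by rewrite mul1r /GRing.scale /= mulrA mulVf// mul1r.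
  exact: h.
- move=> x /andP[x0 x1]; apply: is_derive_continuous.
  exact: is_derive_powR_comp (is_derive_id x 1) x0.
- move=> x /andP[x0 x1]; rewrite ger0_norm ?mulr_ge0 ?powR_ge0 ?invr_ge0 ?(ltW q0)//.
  rewrite -[leRHS]mulr1 ler_wpM2l ?invr_ge0 ?(ltW q0)//.
  have e1 : (1 : R) `^ q = 1 by rewrite powR1.
  rewrite -[leRHS]e1; apply: ge0_ler_powR; rewrite ?nnegrE ?ler01//; exact: ltW.
Qed.

Let lowpow (s tau : R) : R := if (tau < 1)%R then rpow (s - 1) tau else 0.

Let lowpow_ge0 s tau : 0 <= lowpow s tau.
Proof. by rewrite /lowpow; case: ifP => // _; exact: rpow_ge0. Qed.

Let measurable_lowpow s : measurable_fun setT (lowpow s : M -> R).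
Proof.
apply: measurable_fun_ifT => //; first exact: measurable_fun_ltr.
by apply: measurable_rpow.
Qed.

(* Layer cake: u^s = 1 + (-s) * int_u^1 tau^(s-1) dtau reduces this to the
   volumes of balls. *)
Lemma sqnorm_powR_integrable n (s : R) : s < 0 -> 0 < s + n%:R / 2 ->
  (lebesgue_tuple n).-integrable setT
    (EFin \o fun t : T n => if sqnorm t < 1 then rpow s (sqnorm t) else 0).
Proof.
move=> s0 sn.
have [B B0 HB] := rpow_tuple_integral n (ltrN10 R).
pose g (z : M * T n) : R := lowpow s z.1 * rpow 0 (z.1 - sqnorm z.2).
have ig : (leb \x lebesgue_tuple n)%E.-integrable setT (EFin \o g).
  apply: (integrable_prod_bound
    (F := fun x : M => B * (x `^ (s + n%:R / 2 - 1) * \1_(`]0, 1[%classic) x))).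
  - apply: measurable_funM; last by apply: measurable_rpow; exact: measurable_layer.
    by apply: (measurableT_comp (measurable_lowpow s)); exact: measurable_fst.
  - by move=> z; rewrite mulr_ge0 ?lowpow_ge0 ?rpow_ge0.
  - move=> x; have [h1 h2] := HB x; rewrite /g /=.
    under eq_integral do rewrite EFinM.
    rewrite ge0_integralZl//; last 3 first.
    - exact: (measurable_int (lebesgue_tuple n)).
    - by move=> t _; rewrite lee_fin rpow_ge0.
    - by rewrite lee_fin lowpow_ge0.
    rewrite -[X in (_ * X)%E]fineK; last exact: integrable_fin_num.
    rewrite -/(Rintegral _ _ _) h2 -EFinM; congr EFin.
    rewrite add0r /lowpow indicE mem_setE in_itv /= /rpow.
    have [x0|x0] := ltP (0 : R) x; last by rewrite !mulr0.
    case: ifP => x1 /=; last by rewrite !mul0r !mulr0.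
    rewrite mulr1 mulrCA; rewrite -powRD; last by apply/implyP => _; rewrite gt_eqF.
    by congr (_ * _ `^ _); ring.
  - have q0 : 0 < s + n%:R / 2 by [].
    have := integrableRmkcond (measurable_itv _) (powR_unit_integrable q0).
    move=> /(integrableZl measurableT B); exact: eq_integrable.
have [iL _] := Rintegral_prod2 ig.
have eL (t : T n) : 0 < sqnorm t < 1 ->
    \int[leb]_tau g (tau, t) = (1 - sqnorm t `^ s) / s.
  move=> /andP[]; rewrite /g /=; move: (sqnorm t) => U U0 U1.
  have sN0 : s != 0 by rewrite lt_eqF.
  have dF (x : R) : 0 < x -> is_derive x 1 (fun y : R => s^-1 * y `^ s) (x `^ (s - 1)).
    move=> x0; have := is_derive_powR_comp s (is_derive_id x 1) x0.
    move=> /(@is_deriveZ _ _ _ _ s^-1) h.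
    have -> : x `^ (s - 1) = s^-1 *: (1 * (s * x `^ (s - 1))).
      by rewrite mul1r /GRing.scale /= mulrA mulVf// mul1r.
    exact: h.
  have cf (x : R) : 0 < x -> {for x, continuous (fun y : R => y `^ (s - 1))}.
    move=> x0; apply: is_derive_continuous.
    exact: is_derive_powR_comp (is_derive_id x 1) x0.
  have -> : \int[leb]_tau (lowpow s tau * rpow 0 (tau - U)) =
      \int[leb]_(tau in `]U, 1[) (tau `^ (s - 1)).
    rewrite [RHS]Rintegral_mkcond; apply: eq_Rintegral => tau _.
    rewrite patchE mem_setE in_itv /= /lowpow /rpow subr_gt0 powRr0.
    have [Ut|tU] := ltP U (tau : R); last by rewrite mulr0.
    by rewrite mulr1 (lt_trans U0 Ut).
  have oo (x : R) : U <= x <= 1 -> 0 < x by move=> /andP[/(lt_le_trans U0)].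
  rewrite /Rintegral -(integral_itv_bndoo true false); last first.
    apply/measurable_EFinP; apply: open_continuous_measurable_oo => x /andP[x1 x2].
    by apply: cf; exact: lt_trans U0 x1.
  have -> := FTC_cc U1 (fun x h => dF x (oo x h)) (fun x h => cf x (oo x h)).
  by rewrite /= powR1 -mulrBr mulrC.
have iB : (lebesgue_tuple n).-integrable setT
    (EFin \o fun t : T n => - s * (\int[leb]_tau g (tau, t)) + rpow 0 (1 - sqnorm t)).
  have [h _] := HB 1; rewrite /comp; under eq_fun do rewrite EFinD EFinM.
  by apply: integrableD => //; exact: integrableZl.
apply: (le_integrable _ _ _ iB) => //.
  apply/measurable_EFinP; apply: measurable_fun_ifT => //.
    by apply: measurable_fun_ltr => //; exact: measurable_sqnorm.
  by apply: measurable_rpow; exact: measurable_sqnorm.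
move=> t _ /=; rewrite lee_fin.
have L0 : 0 <= \int[leb]_tau g (tau, t).
  by apply: Rintegral_ge0 => tau _; rewrite /g mulr_ge0 ?lowpow_ge0 ?rpow_ge0.
have Ls : 0 <= - s * (\int[leb]_tau g (tau, t)) by rewrite mulr_ge0// oppr_ge0 ltW.
rewrite [leRHS]ger0_norm ?addr_ge0 ?rpow_ge0//.
case: ifP => [t1|_]; last by rewrite normr0 addr_ge0 ?rpow_ge0.
rewrite ger0_norm ?rpow_ge0// /rpow; case: ifP => t0; last first.
  by rewrite addr_ge0//; case: ifP => // _; exact: powR_ge0.
rewrite subr_gt0 t1 powRr0 eL ?t0// mulrCA mulNr divff ?lt_eqF//.
by rewrite mulrN1 opprB subrK.
Qed.

End Layers.

(** * Taylor representation of the remainder *)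

Section ChainTaylor.
Context {R : realType}.
Local Notation leb := (@lebesgue_measure R).
Local Notation M := (measurableTypeR R).
Implicit Types (E psi : nat -> R -> R[i]) (b : R).

Lemma csmooth_is_cderive (D : set R) (f : R -> R[i]) k x : csmooth_on D f -> D x ->
  is_cderive x (cderiv k f) (cderiv k.+1 f x).
Proof.
move=> sf Dx; have [d1 d2] := sf k x Dx.
split.
  change (is_derive x 1 (derive1n k (fun t => Re (f t))) (derive1n k.+1 (fun t => Re (f t)) x)).
  by rewrite derive1nS derive1E; exact: (derivableP d1).
change (is_derive x 1 (derive1n k (fun t => Im (f t))) (derive1n k.+1 (fun t => Im (f t)) x)).
by rewrite derive1nS derive1E; exact: (derivableP d2).
Qed.

(** Successive derivatives are recorded as a family of functions, so that those of a product can be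
    built recursively without a closed Leibniz formula. *)
Definition deriv_chain b N E :=
  forall k x, (k < N)%N -> b < x < 1 -> is_cderive x (E k) (E k.+1 x).

Definition ccontinuous_at x (f : R -> R[i]) :=
  {for x, continuous (fun t => Re (f t))} /\ {for x, continuous (fun t => Im (f t))}.

Lemma ccontinuousM x f g : ccontinuous_at x f -> ccontinuous_at x g ->
  ccontinuous_at x (fun t => f t * g t).
Proof.
move=> [f1 f2] [g1 g2]; split.
  have h : {for x, continuous (fun t => Re (f t) * Re (g t) - Im (f t) * Im (g t))}.
    by apply: cvgB; exact: cvgM.
  by apply: near_eq_continuous_at h; near=> t; rewrite complexRI.
have h : {for x, continuous (fun t => Re (f t) * Im (g t) + Im (f t) * Re (g t))}.
  by apply: cvgD; exact: cvgM.
by apply: near_eq_continuous_at h; near=> t; rewrite complexRI.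
Unshelve. all: by end_near. Qed.

Lemma ccontinuousD x f g : ccontinuous_at x f -> ccontinuous_at x g ->
  ccontinuous_at x (fun t => f t + g t).
Proof.
move=> [f1 f2] [g1 g2]; split.
  have h : {for x, continuous (fun t => Re (f t) + Re (g t))} by exact: cvgD.
  by apply: near_eq_continuous_at h; near=> t; rewrite complexRI.
have h : {for x, continuous (fun t => Im (f t) + Im (g t))} by exact: cvgD.
by apply: near_eq_continuous_at h; near=> t; rewrite complexRI.
Unshelve. all: by end_near. Qed.

Lemma ccontinuous_cst x c : ccontinuous_at x (fun=> c).
Proof. by split; exact: cst_continuous. Qed.

Lemma cmeasurable_oo a b f : (forall x, a < x < b -> ccontinuous_at x f) ->
  cmeasurable (`]a, b[%classic : set M) f.
Proof. by move=> cf; split; apply: open_continuous_measurable_oo => x /cf[]. Qed.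

Lemma is_derive_1B (x : R) : is_derive x 1 (fun t : R => 1 - t) (-1).
Proof. by rewrite -[-1]sub0r; apply: is_deriveB. Qed.

Lemma powR_le1 (x q : R) : 0 <= x <= 1 -> 0 <= q -> x `^ q <= 1.
Proof.
move=> /andP[x0 x1] q0; have e1 : (1 : R) `^ q = 1 by rewrite powR1.
by rewrite -[leRHS]e1; apply: ge0_ler_powR; rewrite ?nnegrE ?ler01.
Qed.

Lemma ccontinuous_cvg x f : ccontinuous_at x f -> normc (f t - f x) @[t --> x] --> 0.
Proof.
move=> [c1 c2].
apply: (@squeeze_cvgr _ _ _ _ (fun=> 0) (fun t => `|Re (f t) - Re (f x)| + `|Im (f t) - Im (f x)|)).
- near=> t; rewrite normc_ge0 /= (le_trans (normc_le_ReIm _))//.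
  by rewrite !complexRI.
- exact: cvg_cst.
- have z (g : R -> R) : {for x, continuous g} -> `|g t - g x| @[t --> x] --> 0.
    move=> cg; rewrite -(normr0 R); apply: cvg_norm.
    by apply/subr_cvg0.
  by rewrite -[X in _ --> X](addr0 0); apply: cvgD; exact: z.
Unshelve. all: by end_near. Qed.

Lemma is_cderive_cpow_1B (x : R) (a : R[i]) : x < 1 ->
  is_cderive x (fun t => cpow (1 - t) a) (- a * cpow (1 - x) (a - 1)).
Proof.
move=> x1; have x0 : 0 < 1 - x by rewrite subr_gt0.
apply: is_cderive_eq (is_cderive_cpow a (is_derive_1B x) x0) _.
by rewrite rmorphN rmorph1 mulN1r.
Qed.

(** An integrable derivative keeps f(x) - f(y) bounded for the fixed point y = (b + 1) / 2 and all x
    between y and 1. *)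
Lemma bounded_at1 b (f f' : R -> R[i]) : b < 1 ->
  (forall x, b < x < 1 -> is_cderive x f (f' x)) ->
  (forall x, b < x < 1 -> ccontinuous_at x f') ->
  cintegrable leb `]b, 1[ f' ->
  exists C : R, forall x, (b + 1) / 2 < x < 1 -> normc (f x) <= C.
Proof.
move=> b1 df cf' i'; set y := (b + 1) / 2.
have by' : b < y by rewrite /y; lra.
have mo a c : measurable (`]a, c[%classic : set M) by exact: measurable_itv.
have in' := integrableRmkcond (mo b 1) (cintegrable_normc (mo b 1) i').
exists (normc (f y) + 2 * \int[leb]_t (normc (f' t) * \1_(`]b, 1[%classic) t)) => x /andP[yx x1].
have sub : `]y, x[ `<=` `]b, 1[%classic.
  by move=> t /=; rewrite !in_itv /= => /andP[yt tx]; rewrite (lt_trans by' yt) (lt_trans tx x1).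
have io (t : R) : y < t < x -> b < t < 1.
  by move=> /andP[yt tx]; rewrite (lt_trans by' yt) (lt_trans tx x1).
have cc (z : R) : b < z < 1 -> normc (f t - f z) @[t --> z] --> 0.
  by move=> /df/is_cderive_continuous; exact: ccontinuous_cvg.
have i2 : cintegrable leb `]y, x[ f'.
  by split; [exact: integrableS i'.1|exact: integrableS i'.2].
have e : cintegral leb `]y, x[ f' = f x - f y.
  apply: (cimproper_FTC (F := f) yx _ _ i2).
  - by move=> t /io/df.
  - by move=> t /io/cf'.
  - apply: cvg_at_right_filter; apply: cc; rewrite by' /=; exact: lt_trans x1.
  - by apply: cvg_at_left_filter; apply: cc; rewrite x1 andbT; exact: lt_trans yx.
have -> : f x = f y + cintegral leb `]y, x[ f' by rewrite e addrC subrK.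
apply: le_trans (le_normcD _ _) _; rewrite lerD2l.
rewrite cintegral_mkcond; apply: (normc_cintegral_le _ _ in') => //.
  exact: cintegrable_mkcond.
move=> t _; rewrite normcM normc_real ger0_norm ?ler_wpM2l ?normc_ge0//.
rewrite !indicE; case: (boolP (t \in (`]y, x[%classic : set M))) => [|_]; last exact: ler0n.
by rewrite inE => /sub h; rewrite mem_set.
Qed.

(* One derivative of (1 - t)^Lambda psi is a combination of functions of the same
   form with data (Lambda - 1, psi) and (Lambda, psi'), whence the induction. *)
Lemma bounded_mul_chain N : forall b Lambda psi, 0 <= b < 1 -> N%:R <= Re Lambda ->
  deriv_chain b N psi -> (forall x, b < x < 1 -> ccontinuous_at x (psi N)) ->
  (forall k, (k <= N)%N -> cintegrable leb `]b, 1[ (psi k)) ->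
  exists E, [/\ (forall t, E 0%N t = cpow (1 - t) Lambda * psi 0%N t),
    deriv_chain b N E,
    (forall x, b < x < 1 -> ccontinuous_at x (E N)),
    (forall k, (k < N)%N -> normc (E k x) @[x --> 1^'-] --> 0) &
    cintegrable leb `]b, 1[ (E N)].
Proof.
elim: N => [|N IH] b Lambda psi /andP[b0 b1] NL dpsi cpsi ipsi.
  have cE x : b < x < 1 ->
      ccontinuous_at x (fun t => cpow (1 - t) Lambda * psi 0%N t).
    move=> bx; apply: ccontinuousM; last exact: cpsi.
    by case/andP: bx => _ x1; apply: is_cderive_continuous (is_cderive_cpow_1B Lambda x1).
  exists (fun _ t => cpow (1 - t) Lambda * psi 0%N t); split => //.
  apply: (cintegrableMl (M := 1)) => //; first exact: ipsi.
    by apply: cmeasurable_cpow; exact: measurable_funB.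
  move=> x hx; have /andP[bx x1] : b < x < 1 by move: hx; rewrite /= in_itv.
  have x0 : 0 < 1 - x by rewrite subr_gt0.
  by rewrite normc_cpow// powR_le1// (ltW x0) gerBl (ltW (le_lt_trans b0 bx)).
have ipsi0 k : (k <= N)%N -> (k <= N.+1)%N by move/leq_trans; apply.
have L1 : N%:R <= Re (Lambda - 1) by rewrite complex_ReD complex_ReN /= lerBrDr natr1.
have L0 : N%:R <= Re Lambda by apply: le_trans NL; rewrite ler_nat.
have b01 : 0 <= b < 1 by rewrite b0.
have d1 : deriv_chain b N psi by move=> k x kN; apply: dpsi; rewrite ltnS ltnW.
have d2 : deriv_chain b N (fun k => psi k.+1) by move=> k x kN; exact: dpsi.
have c1 x : b < x < 1 -> ccontinuous_at x (psi N).
  by move=> bx; apply: is_cderive_continuous (dpsi N x (ltnSn N) bx).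
have [E1 [E10 dE1 cE1 zE1 iE1]] :=
  IH b (Lambda - 1) psi b01 L1 d1 c1 (fun k h => ipsi k (ipsi0 k h)).
have [E2 [E20 dE2 cE2 zE2 iE2]] :=
  IH b Lambda (fun k => psi k.+1) b01 L0 d2 cpsi (fun k h => ipsi k.+1 h).
pose E k := if k is j.+1 then fun t => - Lambda * E1 j t + E2 j t
  else fun t => cpow (1 - t) Lambda * psi 0%N t.
exists E; split; first by [].
- move=> [|k] x kN bx; last first.
    by apply: is_cderiveD; [apply: is_cderiveZ; exact: dE1|exact: dE2].
  have x1 : x < 1 by case/andP: bx.
  apply: is_cderive_eq (is_cderiveM (is_cderive_cpow_1B Lambda x1) (dpsi 0%N x isT bx)) _.
  have -> : E 1%N x = - Lambda * E1 0%N x + E2 0%N x by [].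
  by rewrite E10 E20 -mulrA.
- move=> x bx; apply: ccontinuousD; last exact: cE2.
  by apply: ccontinuousM; [exact: ccontinuous_cst|exact: cE1].
(* At order 0, [psi 0] is bounded near 1 because its derivative is integrable, and the factor (1 -
   t)^Lambda tends to 0 as Re Lambda > 0. At higher orders both inductive families vanish at 1. *)
- move=> [_|k kN].
    have dp (x : R) : b < x < 1 -> is_cderive x (psi 0%N) (psi 1%N x) by exact: dpsi.
    have cp (x : R) : b < x < 1 -> ccontinuous_at x (psi 1%N).
      move=> bx; case: (N) dpsi cpsi => [_ h|N' h _]; first exact: h.
      exact: is_cderive_continuous (h 1%N x isT bx).
    have [C HC] := bounded_at1 b1 dp cp (ipsi 1%N isT).
    apply: (@squeeze_cvgr _ _ _ _ (fun=> 0) (fun t => (1 - t) `^ Re Lambda * C)).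
    + near=> t; rewrite normc_ge0 /=.
      have t1 : t < 1 by near: t; exact: nbhs_left_lt.
      rewrite normcM normc_cpow ?subr_gt0// ler_wpM2l ?powR_ge0// HC// t1 andbT.
      by near: t; apply: nbhs_left_gt; lra.
    + exact: cvg_cst.
    + rewrite -[X in _ --> X](mul0r C); apply: cvgM; last exact: cvg_cst.
      apply: cvg_powR0.
      * by apply: lt_le_trans NL; rewrite ltr0n.
      * by near=> t; rewrite subr_ge0 ltW//; near: t; exact: nbhs_left_lt.
      * rewrite -[X in _ --> X](subrr (1 : R)); apply: cvg_at_left_filter.
        by apply: cvgB; [exact: cvg_cst|exact: cvg_id].
  apply: (@squeeze_cvgr _ _ _ _ (fun=> 0) (fun t => normc Lambda * normc (E1 k t) + normc (E2 k t))).
  + near=> t; rewrite normc_ge0 /= (le_trans (le_normcD _ _))// normcM normcN.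
    done.
  + exact: cvg_cst.
  + rewrite -[X in _ --> X](addr0 0); apply: cvgD; last exact: zE2.
    by rewrite -[X in _ --> X](mulr0 (normc Lambda)); apply: cvgM; [exact: cvg_cst|exact: zE1].
- apply: cintegrableD => //; exact: cintegrableZ.
Unshelve. all: by end_near. Qed.


Lemma is_derive_subX (t x : R) k :
  is_derive x 1 (fun y : R => (y - t) ^+ k.+1) (k.+1%:R * (x - t) ^+ k).
Proof.
have h1 : is_derive x 1 (fun y : R => y - t) 1.
  by rewrite -[X in is_derive _ _ _ X]subr0; apply: is_deriveB.
elim: k => [|k IH].
  by rewrite expr0 mulr1; under eq_fun do rewrite expr1.
under eq_fun do rewrite exprS.
by apply: is_derive_eq; rewrite /GRing.scale /= -[k.+2%:R]natr1 !exprS; ring.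
Qed.

Lemma is_cderive_taylor_term (t x : R) (f : R -> R[i]) f' k : is_cderive x f f' ->
  is_cderive x (fun y => f y * ((y - t) ^+ k.+1 / k.+1`!%:R)%:C)
    (f' * ((x - t) ^+ k.+1 / k.+1`!%:R)%:C + f x * ((x - t) ^+ k / k`!%:R)%:C).
Proof.
move=> df; apply: is_cderiveM => //; apply: is_cderive_real.
have k0 : (k.+1%:R : R) != 0 by rewrite pnatr_eq0.
have f0 : (k`!%:R : R) != 0 by rewrite pnatr_eq0 -lt0n fact_gt0.
have h1 := is_deriveM (is_derive_subX t x k) (is_derive_cst (k.+1`!%:R^-1 : R) x 1).
apply: (is_derive_eq h1); rewrite /GRing.scale /= factS natrM; field.
by rewrite f0 addrC natr1 k0.
Qed.

(** The sum telescopes: differentiating the polynomial factor of one term cancels the differentiated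
    function in the preceding one, and only the top derivative is left. *)
Lemma taylor_primitive b N E t x : deriv_chain b N.+1 E -> b < x < 1 ->
  is_cderive x (fun y => \sum_(k < N.+1) (-1) ^+ k * (E k y * ((y - t) ^+ k / k`!%:R)%:C))
    ((-1) ^+ N * (E N.+1 x * ((x - t) ^+ N / N`!%:R)%:C)).
Proof.
elim: N => [|N IH] dE bx.
  apply: is_cderive_ext (is_cderive_eq (dE 0%N x isT bx) _).
    by move=> y; rewrite big_ord1 !expr0 fact0 divr1 mulr1 mul1r.
  by rewrite !expr0 fact0 divr1 mulr1 mul1r.
have dE' : deriv_chain b N.+1 E by move=> k y kN; apply: dE; exact: ltnW.
have h1 := IH dE' bx.
have h2 := is_cderiveZ ((-1) ^+ N.+1) (is_cderive_taylor_term t N (dE N.+1 x (ltnSn _) bx)).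
apply: is_cderive_ext (is_cderive_eq (is_cderiveD h1 h2) _).
  by move=> y; rewrite [RHS]big_ord_recr.
by rewrite exprS !mulN1r mulrDr !mulNr addrCA subrr addr0.
Qed.

(** Taylor's formula based at the endpoint 1, where [E 0], ..., [E N] all vanish, so that only the
    integral remainder survives. At x = t the primitive reduces to its first term [E 0 t]. *)
Lemma chain_taylor b N E t : 0 <= b -> deriv_chain b N.+1 E ->
  (forall x, b < x < 1 -> ccontinuous_at x (E N.+1)) ->
  (forall k, (k < N.+1)%N -> normc (E k x) @[x --> 1^'-] --> 0) ->
  cintegrable leb `]b, 1[ (E N.+1) -> b < t < 1 ->
  E 0%N t = cintegral leb `]t, 1[
    (fun tau => ((-1) ^+ N.+1 / N`!%:R * E N.+1 tau) * ((tau - t) ^+ N)%:C).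
Proof.
move=> b0 dE cE zE iE /andP[bt t1].
have mo a c : measurable (`]a, c[%classic : set M) by exact: measurable_itv.
pose F y := \sum_(k < N.+1) (-1) ^+ k * (E k y * ((y - t) ^+ k / k`!%:R)%:C).
pose f x := (-1) ^+ N * (E N.+1 x * ((x - t) ^+ N / N`!%:R)%:C).
have io (x : R) : t < x < 1 -> b < x < 1 by move=> /andP[tx ->]; rewrite (lt_trans bt tx).
have sub : `]t, 1[ `<=` `]b, 1[%classic by move=> x /=; rewrite !in_itv; exact: io.
have cpoly (x : R) : ccontinuous_at x (fun x => ((x - t) ^+ N / N`!%:R)%:C).
  split=> /=; last exact: cst_continuous.
  have hX n : {for x, continuous (fun y : R => (y - t) ^+ n)}.
    elim: n => [|n IH]; first exact: cst_continuous.
    under [X in {for x, continuous X}]eq_fun do rewrite exprS.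
    by apply: cvgM => //; apply: cvgB; [exact: cvg_id|exact: cvg_cst].
  by apply: cvgM; [exact: hX|exact: cvg_cst].
have cf (x : R) : b < x < 1 -> ccontinuous_at x f.
  move=> bx; apply: ccontinuousM; first exact: ccontinuous_cst.
  by apply: ccontinuousM; [exact: cE|exact: cpoly].
have if_ : cintegrable leb `]t, 1[ f.
  apply: (eq_cintegrable (f := fun x : M => (-1) ^+ N *
      (((x - t) ^+ N / N`!%:R)%:C * E N.+1 x))) => //.
    by move=> x _; rewrite /f (mulrC _%:C).
  apply: cintegrableZ => //.
  apply: (cintegrableMl (M := 1)) => //.
  - by split; [exact: integrableS iE.1|exact: integrableS iE.2].
  - by apply: cmeasurable_oo => x _; exact: cpoly.
  - move=> x hx; have /andP[tx x1] : t < x < 1 by move: hx; rewrite /= in_itv.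
    have xt0 : 0 <= x - t by rewrite subr_ge0 ltW.
    rewrite normc_real ger0_norm ?divr_ge0 ?exprn_ge0// ler_pdivrMr ?ltr0n ?fact_gt0// mul1r.
    apply: (@le_trans _ _ 1); first by apply: exprn_ile1 => //; lra.
    by rewrite ler1n fact_gt0.
have e : cintegral leb `]t, 1[ f = 0 - E 0%N t.
  apply: (cimproper_FTC (F := F) t1 _ _ if_).
  - by move=> x /io bx; exact: (taylor_primitive t dE bx).
  - by move=> x /io; exact: cf.
  - have Ft : F t = E 0%N t.
      rewrite /F big_ord_recl big1 ?addr0 => [|k _].
        by rewrite !expr0 fact0 divr1 mulr1 mul1r.
      by rewrite /= subrr expr0n /= mul0r mulr0 mulr0.
    rewrite -Ft; apply: cvg_at_right_filter; apply: ccontinuous_cvg.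
    by apply: is_cderive_continuous; apply: (taylor_primitive t dE); rewrite bt.
  - apply: (@squeeze_cvgr _ _ _ _ (fun=> 0) (fun x => \sum_(k < N.+1) normc (E k x))).
    + near=> x; rewrite normc_ge0 /= subr0 (le_trans (le_normc_sum _ _ _))// ler_sum// => k _.
      have tx : t < x by near: x; exact: nbhs_left_gt.
      have x1 : x < 1 by near: x; exact: nbhs_left_lt.
      have xt0 : 0 <= x - t by rewrite subr_ge0 ltW.
      rewrite normcM normcX normcN normc1 expr1n mul1r normcM normc_real.
      rewrite -[leRHS]mulr1 ler_wpM2l ?normc_ge0// ger0_norm ?divr_ge0 ?exprn_ge0//.
      rewrite ler_pdivrMr ?ltr0n ?fact_gt0// mul1r.
      apply: (@le_trans _ _ 1); first by apply: exprn_ile1 => //; lra.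
      by rewrite ler1n fact_gt0.
    + exact: cvg_cst.
    + have z n : (n <= N.+1)%N -> (\sum_(k < n) normc (E k x)) @[x --> 1^'-] --> 0.
        elim: n => [_|n IH nN].
          by under eq_fun do rewrite big_ord0; exact: cvg_cst.
        have -> : (fun x => \sum_(k < n.+1) normc (E k x)) =
            (fun x => \sum_(k < n) normc (E k x) + normc (E n x)).
          by apply/funext => x; rewrite big_ord_recr.
        by rewrite -[X in _ --> X](addr0 0); apply: cvgD; [apply: IH; exact: ltnW|exact: zE].
      exact: z.
have -> : E 0%N t = (-1) * cintegral leb `]t, 1[ f by rewrite e sub0r mulN1r opprK.
rewrite -cintegralZ//; apply: eq_cintegral => x _.
rewrite /f exprS rmorphM fmorphV rmorph_nat.
by rewrite -!mulrA; congr (_ * (_ * _)); rewrite [RHS]mulrC -mulrA.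
Unshelve. all: by end_near. Qed.

(** With N + 1 derivatives available, the Taylor kernel is the N-th power, that is the truncated
    power of exponent N. The density [G] is a constant multiple of the derivative of order N + 1 of
    the whole product. *)
Lemma smooth_remainder_layer b N (Lambda : R[i]) (psi : R -> R[i]) :
  0 <= b < 1 -> N.+1%:R <= Re Lambda -> csmooth_on `]0, 1[%classic psi ->
  (forall k, (k <= N.+1)%N -> cintegrable leb `]b, 1[ (cderiv k psi)) ->
  exists2 G : R -> R[i], cintegrable leb `]b, 1[ G &
    forall t, b < t < 1 -> cpow (1 - t) Lambda * psi t =
      cintegral leb `]t, 1[ (fun tau => G tau * ((tau - t) ^+ N)%:C).
Proof.
move=> /andP[b0 b1] NL sp ip.
have oo (x : R) : b < x < 1 -> `]0, 1[%classic x.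
  by move=> /andP[bx x1]; rewrite /= in_itv /= x1 (le_lt_trans b0 bx).
have b01 : 0 <= b < 1 by rewrite b0.
have d1 : deriv_chain b N.+1 (fun k => cderiv k psi).
  by move=> k x _ /oo; exact: csmooth_is_cderive.
have c1 x : b < x < 1 -> ccontinuous_at x (cderiv N.+1 psi).
  by move=> /oo h; exact: is_cderive_continuous (csmooth_is_cderive _ sp h).
have [E [E0 dE cE zE iE]] := bounded_mul_chain b01 NL d1 c1 ip.
exists (fun tau => (-1) ^+ N.+1 / N`!%:R * E N.+1 tau); first exact: cintegrableZ.
move=> t bt; rewrite -(chain_taylor b0 dE cE zE iE bt) E0; congr (_ * _).
by rewrite /cderiv /=; case: (psi t).
Qed.

(** Absolute continuity of the integral: an interval (d, 1) that is short enough carries little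
    mass. *)
Lemma small_mass_at1 b (G : R -> R[i]) (e : R) : b < 1 -> cintegrable leb `]b, 1[ G -> 0 < e ->
  exists d, [/\ b < d, d < 1 & \int[leb]_x (normc (G x) * \1_(`]d, 1[%classic) x) < e].
Proof.
move=> b1 iG e0.
have mo a c : measurable (`]a, c[%classic : set M) by exact: measurable_itv.
have iG' := integrableRmkcond (mo b 1) (cintegrable_normc (mo b 1) iG).
have [d [d0 Hd]] := integral_normr_continuous iG' e0.
pose c := Num.max ((b + 1) / 2) (1 - d / 2).
have bc : b < c by rewrite lt_max; apply/orP; left; lra.
have c1 : c < 1 by rewrite gt_max; apply/andP; split; lra.
exists c; split => //.
have cd : 1 - c < d.
  have : 1 - d / 2 <= c by rewrite le_max lexx orbT.
  by lra.
pose A : set M := `]c, 1[%classic.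
have mu1 : (leb A < d%:E)%E.
  by rewrite /A lebesgue_measure_itv /= lte_fin c1 -EFinB lte_fin.
have := Hd _ (mo c 1) mu1; apply: le_lt_trans; rewrite [leRHS]Rintegral_mkcond le_eqVlt; apply/orP; left.
apply/eqP; apply: eq_Rintegral => x _; rewrite patchE indicE.
case: ifPn => xc; last by rewrite mulr0.
have -> : \1_`]b, 1[ x = 1 :> R.
  rewrite indicE mem_set//; move: xc; rewrite inE /= !in_itv /= => /andP[cx ->].
  by rewrite (lt_trans bc cx).
by rewrite !mulr1 ger0_norm// normc_ge0.
Qed.

End ChainTaylor.

(** * Measurability and test functions on R^n *)

Section TupleFunctions.
Context {R : realType}.
Local Notation leb := (@lebesgue_measure R).
Local Notation M := (measurableTypeR R).
Local Notation T n := (n.-tuple (measurableTypeR R)).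

Lemma rvE n (t : T n) i : rv t 0 i = tnth t i.
Proof. by rewrite /rv mxE. Qed.

Lemma enorm_rv n (t : T n) : enorm (rv t) = Num.sqrt (sqnorm t).
Proof. by rewrite /enorm /sqnorm; under eq_bigr do rewrite rvE. Qed.

Lemma sqnorm_ge0 n (t : T n) : 0 <= sqnorm t.
Proof. by apply: sumr_ge0 => i _; exact: sqr_ge0. Qed.

(** Tuples carry the product sigma-algebra, whereas [O] is open for the sup norm. The balls of that
    norm are cubes, hence measurable boxes, and [O] is the countable union of the cubes with
    rational centre and radius 1/(k+1) that it contains. *)
Lemma open_rv_measurable n (O : set 'rV[R]_n) : open O -> measurable ((@rv R n) @^-1` O).
Proof.
move=> oO.
pose c (q : n.-tuple rat) : 'rV[R]_n := \row_i ratr (tnth q i).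
pose U (qk : n.-tuple rat * nat) : set (T n) :=
  if `[< ball (c qk.1) (qk.2.+1%:R^-1) `<=` O >] then
    [set t | forall i, ball (ratr (tnth qk.1 i) : R) (qk.2.+1%:R^-1) (tnth t i : R)]
  else set0.
rewrite (_ : _ @^-1` _ = \bigcup_i U i); last first.
  apply/seteqP; split => [t /= Ot|t [[q k] _]].
    have /nbhs_ballP[e /= e0 He] : nbhs (rv t) O by exact: open_nbhs_nbhs.
    have [k ke] : exists k : nat, k.+1%:R^-1 < e / 2.
      have e2 : 0 < e / 2 by rewrite divr_gt0.
      by have [k] := ltr_add_invr e2; rewrite add0r => h; exists k.
    have k0 : (0 : R) < k.+1%:R^-1 by rewrite invr_gt0.
    have ex i : exists q : rat, `|ratr q - (tnth t i : R)| < k.+1%:R^-1.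
      have lt1 : (tnth t i : R) < tnth t i + k.+1%:R^-1 by rewrite ltrDl.
      have [q] := rat_in_itvoo lt1; rewrite in_itv /= => /andP[q1 q2]; exists q.
      by rewrite ger0_norm ?subr_ge0 ?(ltW q1)// ltrBlDl.
    pose q := [tuple xchoose (ex i) | i < n].
    have Hq i : `|ratr (tnth q i) - (tnth t i : R)| < k.+1%:R^-1.
      by rewrite tnth_mktuple; exact: (xchooseP (ex i)).
    exists (q, k) => //; rewrite /U /=.
    case: asboolP => [_ i /=|[]]; first by rewrite -ball_normE /=; exact: Hq.
    move=> y [_ yq]; apply: He; split => // i j; have := yq i j; rewrite /c !mxE.
    rewrite -!ball_normE /= (ord1 i) => h.
    have -> : tnth t j - y 0 j = (ratr (tnth q j) - y 0 j) - (ratr (tnth q j) - tnth t j).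
      by ring.
    apply: le_lt_trans (ler_normB _ _) _.
    by rewrite [ltRHS]splitr ltrD// (lt_trans _ ke)//; exact: Hq.
  rewrite /U; case: asboolP => // qO /= tq; apply: qO; split=> [|i j]; first by rewrite invr_gt0.
  by rewrite /c !mxE; exact: tq.
apply: countable_bigcupT_measurable; first exact: countableP.
move=> [q k]; rewrite /U /=.
case: asboolP => // _.
rewrite (_ : [set _ | _] = \bigcap_(i in [set: 'I_n])
    ((fun t : T n => tnth t i : R) @^-1` ball (ratr (tnth q i) : R) (k.+1%:R^-1))); last first.
  by apply/seteqP; split => t /= h i; [move=> _|]; exact: h.
apply: fin_bigcap_measurable => // i _.
rewrite -[X in measurable X]setTI; apply: (measurable_tnth i) => //.
exact: measurable_ball.
Qed.

Lemma continuous_rv_measurable n (g : 'rV[R]_n -> R) : continuous g ->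
  measurable_fun setT (fun t : T n => g (rv t)).
Proof.
move=> cg; apply: (measurability _ (RGenOInfty.measurableE R)).
move=> _ [_ [x ->] <-]; rewrite setTI.
have oO : open (g @^-1` `]x, +oo[%classic).
  by apply: open_comp; [move=> y _; exact: cg|exact: interval_open].
exact: (open_rv_measurable oO).
Qed.

(** Continuity is available on the open interval only; the values at 0 and 1 are restored by
    indicators of single points. *)
Lemma cmeasurable_01 (F : R -> R[i]) :
  (forall x, 0 < x < 1 -> ccontinuous_at x F) ->
  (forall x, ~~ (0 <= x <= 1) -> F x = 0) -> cmeasurable (setT : set M) F.
Proof.
move=> cF F0.
have m01 : cmeasurable (`]0, 1[%classic : set M) F by exact: cmeasurable_oo.
have [mr mi] := m01.
have mm (g : R -> R) : measurable_fun (`]0, 1[%classic : set M) g ->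
    (forall x, ~~ (0 <= x <= 1) -> g x = 0) -> measurable_fun (setT : set M) g.
  move=> mg g0; pose h := (fun x : M => if (0 < x < 1)%R then g x else 0).
  have mh : measurable_fun setT h.
    have := (measurable_restrictT g (measurable_itv `]0, 1[)).1 mg.
    congr measurable_fun; apply/funext => x; rewrite /h patchE.
    by rewrite mem_setE in_itv.
  have -> : g = (fun x : M => h x + g 0 * \1_[set (0 : M)] x + g 1 * \1_[set (1 : M)] x).
    apply/funext => x; rewrite /h !indicE !in_set1.
    have [->|x0] := eqVneq x 0.
      by rewrite ltxx /= eq_sym oner_eq0 mulr0 mulr1 addr0 add0r.
    have [->|x1] := eqVneq x 1.
      by rewrite ltxx andbF mulr0 mulr1 addr0 add0r.
    rewrite !mulr0 !addr0; case: ifPn => // h1; apply: g0.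
    by move: h1; rewrite !lt_neqAle eq_sym x0 x1.
  apply: measurable_funD; first apply: measurable_funD => //.
    by apply: measurable_funM => //; apply: measurable_indic; exact: measurable_set1.
  by apply: measurable_funM => //; apply: measurable_indic; exact: measurable_set1.
by split; apply: mm => // x /F0 ->.
Qed.

Lemma measurable_enorm_rv n : measurable_fun setT (fun t : T n => enorm (rv t)).
Proof.
under eq_fun do rewrite enorm_rv.
apply: (measurableT_comp (f := @Num.sqrt R)); last exact: measurable_sqnorm.
by apply: continuous_measurable_fun; exact: sqrt_continuous.
Qed.

(** * The distribution of an integrable function supported in the unit ball *)

Section Distribution.
Variables (n : nat) (f : 'rV[R]_n -> R[i]).
Hypothesis fi : cintegrable_rV f.
Hypothesis f0 : forall x, 1 < enorm x -> f x = 0.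

(** A cube in place of the ball: it contains the support of [f], and its compactness is that of a
    product of segments. *)
Let K : set 'rV[R]_n := [set v | forall i, `[-1, 1]%classic (v ord0 i)].

Let K_compact : compact K.
Proof.
exact: (@rV_compact R n (fun=> `[-1, 1]%classic) (fun i => @segment_compact R (-1) 1)).
Qed.

Let enorm_coord (x : 'rV[R]_n) i : `|x 0 i| <= enorm x.
Proof.
rewrite -sqrtr_sqr /enorm ler_sqrt; last by apply: sumr_ge0 => j _; exact: sqr_ge0.
by rewrite (bigD1 i) //= lerDl; apply: sumr_ge0 => j _; exact: sqr_ge0.
Qed.

Let f_out x : ~ K x -> f x = 0.
Proof.
move=> nK; apply: f0; rewrite ltNge; apply/negP => x1; apply: nK => i.
by rewrite /= in_itv /= -ler_norml (le_trans (enorm_coord x i)).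
Qed.

Lemma distribution_integrable g : csmooth g ->
  cintegrable (lebesgue_tuple n) setT (fun t => f (rv t) * g (rv t)).
Proof.
move=> sg; have [cr' ci' _] := sg [::].
have cr : continuous (fun x => Re (g x)) by exact: cr'.
have ci : continuous (fun x => Im (g x)) by exact: ci'.
have mg : cmeasurable setT (fun t : T n => g (rv t)).
  by split; [exact: (continuous_rv_measurable cr)|exact: (continuous_rv_measurable ci)].
have bd (h : 'rV[R]_n -> R) : continuous h -> exists B : R, forall x, K x -> `|h x| <= B.
  move=> ch; have : compact (h @` K).
    by apply: continuous_compact => //; apply: continuous_subspaceT.
  move=> /compact_bounded[B [_ HB]]; exists (B + 1) => x Kx.
  by apply: (HB (B + 1)); [rewrite ltrDl|exists x].
have [B1 H1] := bd _ cr; have [B2 H2] := bd _ ci.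
(* Cutting [g] off outside the unit ball does not change the product with [f] and makes it
   bounded. *)
pose k t := if (enorm (rv t : 'rV[R]_n) <= 1)%R then g (rv t) else 0.
apply: (eq_cintegrable (f := fun t => k t * f (rv t))) => //.
  move=> t _; rewrite /k mulrC; case: ifPn => //; rewrite -ltNge => /f0 ->.
  by rewrite !mul0r.
apply: (cintegrableMl (M := B1 + B2)) => //.
  apply: (cmeasurable_if0 _ mg); apply: measurable_fun_ler => //.
  exact: measurable_enorm_rv.
move=> t _; have KB (x : 'rV[R]_n) : K x -> normc (g x) <= B1 + B2.
  by move=> Kx; rewrite (le_trans (normc_le_ReIm _))// lerD// ?H1 ?H2.
have K0 : K 0 by move=> i; rewrite mxE /= in_itv /=; lra.
rewrite /k; case: ifPn => t1; last first.
  by rewrite normc0 (le_trans _ (KB _ K0))// normc_ge0.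
by apply: KB => i; rewrite /= in_itv /= -ler_norml (le_trans (enorm_coord _ i)).
Qed.

Lemma distribution_compact : compact_distribution (distribution_of f).
Proof.
split=> [a g h sg sh|].
  have ig := distribution_integrable sg; have ih := distribution_integrable sh.
  rewrite /distribution_of -cintegralZ// -cintegralD//; last exact: cintegrableZ.
  by apply: eq_cintegral => t _; rewrite mulrDr mulrCA.
have ifn := cintegrable_normc measurableT fi.
pose I := \int[lebesgue_tuple n]_t normc (f (rv t)).
have I0 : 0 <= I by apply: Rintegral_ge0 => t _; exact: normc_ge0.
(* The 2 is the constant of the complex integral estimate. Adding 1 makes the factor strictly
   positive, so that an infinite seminorm gives an infinite bound even when I = 0. *)
have I1 : 0 < 2 * I + 1 by lra.
exists K, 0%N, (2 * I + 1); split => //; first exact: ltW.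
move=> g sg.
have ig := distribution_integrable sg.
have -> : cseminorm K 0 g = ereal_sup [set (normc (g x))%:E | x in K].
  rewrite /cseminorm big_ord1.
  by rewrite (big_pred1 [tuple])// => s; apply/esym/eqP; exact: tuple0.
set S := ereal_sup _.
have K0 : K 0 by move=> i; rewrite mxE /= in_itv /=; lra.
have S0 : (0 <= S)%E.
  apply: (@le_trans _ _ (normc (g 0))%:E); first by rewrite lee_fin normc_ge0.
  by apply: ereal_sup_ubound; exists 0.
case E : S S0 => [s| |] // s0.
- rewrite -EFinM lee_fin.
  have gs x : K x -> normc (g x) <= s.
    by move=> Kx; rewrite -lee_fin -E; apply: ereal_sup_ubound; exists x.
  have ih : (lebesgue_tuple n).-integrable setT (EFin \o fun t => s * normc (f (rv t))).
    by rewrite /comp; under eq_fun do rewrite EFinM; exact: integrableZl.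
  apply: le_trans (normc_cintegral_le measurableT ig ih _) _.
    move=> t _; rewrite normcM mulrC.
    have [Kt|/f_out ->] := pselect (K (rv t)); last by rewrite normc0 !mulr0.
    by rewrite ler_wpM2r ?normc_ge0// gs.
  rewrite RintegralZl// -/I; rewrite lee_fin in s0; nra.
- by rewrite mulr_infty gtr0_sg ?mul1e ?leey.
Qed.

Lemma fourier_distribution (eta : 'rV[R]_n) :
  fourier (distribution_of f) (map_mx (real_complex R) eta) =
  cintegral (lebesgue_tuple n) setT
    (fun t => f (rv t) * expi (- dotp (fun i => eta 0 i) t)).
Proof.
rewrite /fourier /distribution_of; apply: eq_cintegral => t _; congr (_ * _).
rewrite /expi; congr cexp.
have -> : \sum_(j < n) (map_mx (real_complex R) eta) 0 j * (rv t 0 j)%:C =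
    (dotp (fun i => eta 0 i) t)%:C.
  by rewrite /dotp rmorph_sum; apply: eq_bigr => j _; rewrite rvE mxE rmorphM.
by apply: complex_ext; rewrite !complexRI/=; ring.
Qed.

End Distribution.

End TupleFunctions.

(** * Localising the Fourier transform near the sphere *)

Section FourierTransform.
Context {R : realType}.
Local Notation leb := (@lebesgue_measure R).
Local Notation M := (measurableTypeR R).
Local Notation T n := (n.-tuple (measurableTypeR R)).

Definition ft n (F : T n -> R[i]) (e : 'I_n -> R) : R[i] :=
  cintegral (lebesgue_tuple n) setT (fun t => F t * expi (- dotp e t)).

Section General.
Variable n : nat.
Implicit Types (F : T n -> R[i]) (e w : 'I_n -> R).

Lemma ft_integrable F e : cintegrable (lebesgue_tuple n) setT F ->
  cintegrable (lebesgue_tuple n) setT (fun t => F t * expi (- dotp e t)).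
Proof.
move=> iF; apply: (eq_cintegrable (f := fun t => expi (- dotp e t) * F t)) => //.
  by move=> t _; rewrite mulrC.
apply: (cintegrableMl (M := 1)) => //; last by move=> t _; rewrite normc_expi.
by apply: cmeasurable_expi; apply: measurable_funN; exact: measurable_dotp.
Qed.

Lemma ftD F G e : cintegrable (lebesgue_tuple n) setT F ->
  cintegrable (lebesgue_tuple n) setT G ->
  ft (fun t => F t + G t) e = ft F e + ft G e.
Proof.
move=> iF iG; rewrite /ft -cintegralD//; try exact: ft_integrable.
by apply: eq_cintegral => t _; rewrite mulrDl.
Qed.

Lemma ftZ F c e : cintegrable (lebesgue_tuple n) setT F ->
  ft (fun t => c * F t) e = c * ft F e.
Proof.
move=> iF; rewrite /ft -cintegralZ//; last exact: ft_integrable.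
by apply: eq_cintegral => t _; rewrite mulrA.
Qed.

Lemma ft_sum (I : Type) (s : seq I) (F : I -> T n -> R[i]) e :
  (forall i, cintegrable (lebesgue_tuple n) setT (F i)) ->
  ft (fun t => \sum_(i <- s) F i t) e = \sum_(i <- s) ft (F i) e.
Proof.
move=> iF; rewrite /ft -cintegral_sum//; last by move=> i; exact: ft_integrable.
by apply: eq_cintegral => t _; rewrite mulr_suml.
Qed.

Lemma dotpZ c w (t : T n) : dotp (fun i => c * w i) t = c * dotp w t.
Proof. by rewrite /dotp mulr_sumr; apply: eq_bigr => i _; rewrite mulrA. Qed.

(** Cauchy-Schwarz, from the nonnegativity of |t - (w.t) w|^2. *)
Lemma normr_dotp_le w (t : T n) : \sum_(i < n) w i ^+ 2 = 1 ->
  `|dotp w t| <= Num.sqrt (sqnorm t).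
Proof.
move=> w1; rewrite -sqrtr_sqr ler_sqrt ?sqnorm_ge0//; set y := dotp w t.
have : 0 <= \sum_(i < n) ((tnth t i : R) - y * w i) ^+ 2.
  by apply: sumr_ge0 => i _; exact: sqr_ge0.
have -> : \sum_(i < n) ((tnth t i : R) - y * w i) ^+ 2 = sqnorm t - y ^+ 2; last by rewrite subr_ge0.
transitivity (\sum_(i < n) ((tnth t i : R) ^+ 2 - 2 * y * (w i * tnth t i) + y ^+ 2 * w i ^+ 2)).
  by apply: eq_bigr => i _; ring.
rewrite !big_split /= sumrN -!mulr_sumr w1 -/(dotp w t) -/y -/(sqnorm t); ring.
Qed.

(* Averaging over the frequencies r, r-1, ..., r-K inserts the factor
   cos((w.x - s)/2)^K under the integral, which concentrates F near w.x = s. *)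
Lemma ft_binavg F w r s K : cintegrable (lebesgue_tuple n) setT F ->
  binavg K (fun j => expi (- s) ^+ j * ft F (fun i => (r - j%:R) * w i)) =
  cintegral (lebesgue_tuple n) setT (fun t => F t *
    (expi (- (r * dotp w t)) * ((1 + expi (dotp w t - s)) / 2) ^+ K)).
Proof.
move=> iF; rewrite /binavg /ft.
under eq_bigr => j _.
  rewrite -cintegralZ//; last exact: ft_integrable.
  rewrite -cintegralZ//; last by apply: cintegrableZ => //; exact: ft_integrable.
  over.
rewrite -cintegral_sum//; last first.
  by move=> j; do 2 apply: cintegrableZ => //; exact: ft_integrable.
apply: eq_cintegral => t _; under eq_bigr do rewrite dotpZ.
move: (dotp w t) (F t) => y G.
rewrite -binavg_geo /binavg !mulr_sumr; apply: eq_bigr => j _.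
have -> : expi (- ((r - j%:R) * y)) = expi (- (r * y)) * expi y ^+ j.
  by rewrite -expi_mulrn -expiD mulrBl opprB addrC mulr_natl.
have -> : expi (y - s) ^+ j = expi (- s) ^+ j * expi y ^+ j.
  by rewrite -exprMn -expiD addrC.
move: (_%:C) (expi (- s) ^+ j) (expi (- (r * y))) (expi y ^+ j) => A B C D.
ring.
Qed.

(** On the support of [F] one has |w.x| <= sqrt d, so half of |w.x - s| lies between (1 - sqrt d)/2
    and 1. The cosine is nonnegative and decreasing there because 1 <= pi/2, so its K-th power is
    largest at the left end. *)
Lemma ft_far_bound F w r s K d : cintegrable (lebesgue_tuple n) setT F ->
  0 <= d < 1 -> (forall t, d < sqnorm t -> F t = 0) ->
  \sum_(i < n) w i ^+ 2 = 1 -> s = 1 \/ s = -1 ->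
  normc (binavg K (fun j => expi (- s) ^+ j * ft F (fun i => (r - j%:R) * w i))) <=
  2 * (\int[lebesgue_tuple n]_t normc (F t)) * cos ((1 - Num.sqrt d) / 2) ^+ K.
Proof.
move=> iF /andP[d0 d1] F0 w1 s1; rewrite ft_binavg//.
set th := cos _.
have sd0 : 0 <= Num.sqrt d by rewrite sqrtr_ge0.
have sd1 : Num.sqrt d < 1 by rewrite -sqrtr1 ltr_sqrt.
have p2 : 2 <= pi :> R by exact: pi_ge2.
have cc (x : R) : (1 - Num.sqrt d) / 2 <= `|x| -> `|x| <= 1 -> `|cos x| <= th.
  move=> x1 x2.
  have -> : cos x = cos `|x|.
    by have [x0|x0] := leP 0 x; [rewrite ger0_norm|rewrite ltr0_norm// cosN].
  have c0 : 0 <= cos `|x|.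
    by apply: cos_ge0_pihalf; rewrite (le_trans _ (normr_ge0 x)) ?oppr_le0 ?divr_ge0 ?pi_ge0//=; lra.
  rewrite ger0_norm// /th leNgt ltr_cos ?in_itv /= -?leNgt//.
  - by rewrite normr_ge0 /=; lra.
  - by rewrite divr_ge0 ?subr_ge0 ?(ltW sd1)//=; lra.
have ih : (lebesgue_tuple n).-integrable setT (EFin \o fun t => normc (F t) * th ^+ K).
  rewrite /comp; under eq_fun do rewrite EFinM.
  by apply: integrableZr => //; exact: cintegrable_normc.
rewrite -mulrA -RintegralZr//; last exact: cintegrable_normc.
have th0 : 0 <= th.
  by apply: cos_ge0_pihalf; apply/andP; split; lra.
have mH : cmeasurable setT (fun t : T n =>
    expi (- (r * dotp w t)) * ((1 + expi (dotp w t - s)) / 2) ^+ K).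
  have md := @measurable_dotp R n w.
  apply: cmeasurableM.
    by apply: cmeasurable_expi; apply: measurable_funN; apply: measurable_funM.
  have m1 : cmeasurable setT (fun t : T n => (1 + expi (dotp w t - s)) / 2).
    apply: cmeasurableM; last exact: cmeasurable_cst.
    apply: cmeasurableD; first exact: cmeasurable_cst.
    by apply: cmeasurable_expi; exact: measurable_funB.
  elim: K {ih} => [|K IH].
    by under eq_fun do rewrite expr0; exact: cmeasurable_cst.
  by under eq_fun do rewrite exprS; exact: cmeasurableM.
have bd t : normc (expi (- (r * dotp w t)) * ((1 + expi (dotp w t - s)) / 2) ^+ K) =
    `|cos ((dotp w t - s) / 2)| ^+ K.
  by rewrite normcM normc_expi mul1r normcX normc_half_expi.
apply: normc_cintegral_le => //.
  apply: (eq_cintegrable (f := fun t => expi (- (r * dotp w t)) *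
    ((1 + expi (dotp w t - s)) / 2) ^+ K * F t)) => //.
    by move=> t _; rewrite mulrC.
  apply: (cintegrableMl (M := 1)) => //.
  move=> t _; rewrite bd exprn_ile1// ler_norml cos_le1 andbT; exact: cos_geN1.
move=> t _; rewrite normcM bd.
have [td|/F0 ->] := leP (sqnorm t) d; last by rewrite normc0 !mul0r.
rewrite ler_wpM2l ?normc_ge0// lerXn2r ?nnegrE//.
have yd : `|dotp w t| <= Num.sqrt d.
  by apply: le_trans (normr_dotp_le t w1) _; rewrite ler_sqrt.
move: yd; rewrite ler_norml => /andP[y1 y2].
have nE : `|(dotp w t - s) / 2| = `|dotp w t - s| / 2.
  by rewrite normrM (ger0_norm (x := 2^-1)).
apply: cc; rewrite nE.
  rewrite ler_pM2r//; case: s1 => ->.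
    by rewrite ltr0_norm; lra.
  by rewrite opprK ger0_norm; lra.
case: s1 => ->; rewrite ler_pdivrMr// mul1r.
  by rewrite ltr0_norm; lra.
by rewrite opprK ger0_norm; lra.
Qed.

End General.

Lemma cpow_at1 (a : R[i]) : cpow 1 a = 1.
Proof. by rewrite /cpow ln1 mulr0 cexp0. Qed.

Lemma ft_kpow n (a : R[i]) (w : 'I_n.+1 -> R) (rho : R) : -1 < Re a ->
  \sum_(i < n.+1) w i ^+ 2 = 1 -> 0 <= rho ->
  ft (fun t => kpow a (1 - sqnorm t)) (fun i => rho * w i) =
  ball_const n a * cosT (a + (n%:R / 2)%:C) rho.
Proof.
move=> aN1 w1 r0; rewrite /ft ball_fourier// ballTE//; last first.
  by rewrite complex_ReD /= (lt_le_trans aN1)// lerDl divr_ge0.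
rewrite cpow_at1 mul1r sqrtr1 mulr1; congr (_ * cosT _ _).
under eq_bigr do rewrite exprMn.
by rewrite -mulr_sumr w1 mulr1 sqrtr_sqr ger0_norm.
Qed.

Lemma rpow_le1 (p t : R) : 0 <= p -> t <= 1 -> rpow p t <= 1.
Proof.
move=> p0 t1; rewrite /rpow; case: ifPn => // t0.
by apply: powR_le1 => //; rewrite ltW.
Qed.

(** For tau in [1/4, 1] the Bessel argument rho sqrt(tau) lies in [rho/2, rho], and it is at least 1
    since rho >= 2. Hence the decay of [cosT] holds uniformly in tau and only the mass of [G]
    enters. *)
Lemma ft_layer_bound n (a : R[i]) : 0 <= Re a -> exists2 C : R, 0 <= C &
  forall (G : M -> R[i]) (w : 'I_n.+1 -> R) (rho : R),
    cintegrable leb setT G -> (forall tau, ~~ (4^-1 <= tau <= 1) -> G tau = 0) ->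
    \sum_(i < n.+1) w i ^+ 2 = 1 -> 2 <= rho ->
    cintegrable (lebesgue_tuple n.+1) setT (fun t => layer a G (sqnorm t)) /\
    normc (ft (fun t => layer a G (sqnorm t)) (fun i => rho * w i)) <=
      C * rho `^ (- (Re a + n%:R / 2 + 1)) * \int[leb]_tau normc (G tau).
Proof.
move=> a0; have aN1 : -1 < Re a by lra.
pose al := a + (n%:R / 2)%:C.
have alE : Re al = Re a + n%:R / 2 by rewrite complex_ReD.
have n0 : (0 : R) <= n%:R / 2 by rewrite divr_ge0.
have alN1 : -1 < Re al by rewrite alE; lra.
have [C [C0 HC]] := cosT_upper alN1.
set b := Re a + n%:R / 2 + 1.
have b0 : 0 <= b by rewrite /b; lra.
pose D := normc (ball_const n a) * (C * 2 `^ b).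
have D0 : 0 <= D by rewrite !mulr_ge0 ?normc_ge0 ?powR_ge0.
exists (2 * D); first by rewrite mulr_ge0.
move=> G w rho iG G0 w1 r2.
have mG := cintegrable_cmeasurable iG.
have inG := cintegrable_normc measurableT iG.
have iGr (p : R) : 0 <= p ->
    leb.-integrable setT (fun tau : M => (normc (G tau) * rpow p tau)%:E).
  move=> p0; apply: (le_integrable _ _ _ inG) => //.
    apply/measurable_EFinP; apply: measurable_funM; first exact: measurable_normc.
    by apply: measurable_rpow.
  move=> tau _ /=; rewrite lee_fin !ger0_norm ?mulr_ge0 ?normc_ge0 ?rpow_ge0//.
  have [h|/G0 ->] := boolP (4^-1 <= (tau : R) <= 1); last by rewrite normc0 mul0r.
  rewrite -[leRHS]mulr1 ler_wpM2l ?normc_ge0// rpow_le1//.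
  by case/andP: h.
have iu u : cintegrable leb setT (fun tau : M => G tau * kpow a (tau - u)).
  apply: (eq_cintegrable (f := fun tau : M =>
    (if (tau <= 1)%R then kpow a (tau - u) else 0) * G tau)) => //.
    move=> tau _; rewrite mulrC; case: ifPn => // h.
    by rewrite G0 ?mulr0 ?mul0r// negb_and h orbT.
  apply: (cintegrableMl (M := (1 + `|u|) `^ Re a)) => //.
    apply: cmeasurable_if0; first exact: measurable_fun_ler.
    by apply: cmeasurable_kpow; exact: measurable_funB.
  move=> tau _; case: ifPn => t1; last by rewrite normc0 powR_ge0.
  rewrite normc_kpowE /rpow; case: ifPn => tu; last exact: powR_ge0.
  apply: ge0_ler_powR; rewrite ?nnegrE ?(ltW tu)// ?addr_ge0//.
  by have := ler_norm (- u); rewrite normrN; lra.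
have an : 0 <= Re a + n.+1%:R / 2 by rewrite addr_ge0// divr_ge0.
split; first by apply: layer_integrable => //; exact: iGr.
have [iF eF] := layer_fourier (fun i => rho * w i) aN1 mG (iGr _ an) iu.
have sqw : Num.sqrt (\sum_(i < n.+1) (rho * w i) ^+ 2) = rho.
  under eq_bigr do rewrite exprMn.
  by rewrite -mulr_sumr w1 mulr1 sqrtr_sqr ger0_norm//; lra.
rewrite sqw in iF eF; rewrite /ft eF -/al.
have bd tau : normc (G tau * (ball_const n a * ballT al tau rho)) <=
    D * rho `^ (- b) * normc (G tau).
  rewrite normcM mulrC; have [/andP[t1 t2]|/G0 ->] := boolP (4^-1 <= (tau : R) <= 1); last first.
    by rewrite normc0 !mulr0.
  rewrite ler_wpM2r ?normc_ge0// normcM /D -!mulrA ler_wpM2l ?normc_ge0//.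
  have t0 : 0 < tau by lra.
  rewrite ballTE// normcM normc_cpow//.
  have st : 2^-1 <= Num.sqrt tau.
    rewrite -(ger0_norm (x := 2^-1))// -sqrtr_sqr ler_sqrt; last exact: ltW.
    by apply: le_trans t1; rewrite exprVn; lra.
  have rt : rho / 2 <= rho * Num.sqrt tau by rewrite ler_pM2l//; lra.
  have st1 : Num.sqrt tau <= 1 by rewrite -[leRHS]sqrtr1 ler_sqrt.
  have rt2 : rho * Num.sqrt tau <= rho by rewrite ger_pMr//; lra.
  have tp : tau `^ Re (al + (2^-1)%:C) <= 1.
    apply: powR_le1; first by rewrite t2 andbT ltW.
    by rewrite complex_ReD alE /=; lra.
  apply: (@le_trans _ _ (1 * (C * (rho * Num.sqrt tau) `^ (- (Re al + 1))))).
    apply: ler_pM; rewrite ?powR_ge0 ?normc_ge0//; apply: HC; lra.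
  rewrite mul1r ler_wpM2l//.
  have rho0 : 0 < rho by lra.
  have := @powR_half R rho (rho * Num.sqrt tau) (- (Re al + 1)) rho0.
  rewrite rt rt2 normrN ger0_norm; last by rewrite alE.
  by rewrite alE => /(_ isT).
have ig : leb.-integrable setT (EFin \o fun tau : M => D * rho `^ (- b) * normc (G tau)).
  by rewrite /comp; under eq_fun do rewrite EFinM; exact: integrableZl.
apply: le_trans (normc_cintegral_le measurableT iF ig (fun tau _ => bd tau)) _.
by rewrite RintegralZl// !mulrA.
Qed.

End FourierTransform.

(** * Lower bound for the averaged transform *)

Section RadialLower.
Context {R : realType}.
Local Notation leb := (@lebesgue_measure R).
Local Notation M := (measurableTypeR R).
Local Notation T n := (n.-tuple (measurableTypeR R)).

Lemma powRD_gt0 (x p q : R) : 0 < x -> x `^ (p + q) = x `^ p * x `^ q.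
Proof. by move=> x0; rewrite powRD//; apply/implyP => _; rewrite gt_eqF. Qed.

Lemma ln_le_sqrt (r : R) : 0 < r -> ln r <= 2 * r `^ 2^-1.
Proof.
move=> r0; have s0 : 0 < r `^ 2^-1 by rewrite powR_gt0.
have -> : ln r = 2 * ln (r `^ 2^-1) by rewrite ln_powR mulrA divff ?mul1r.
rewrite ler_pM2l//; have := @le_ln1Dx R (r `^ 2^-1 - 1); rewrite (addrC 1) subrK.
by move=> h; rewrite (le_trans (h _))//; lra.
Qed.

Lemma cvg_powRN_pinfty (p : R) : 0 < p -> r `^ (- p) @[r --> +oo] --> (0 : R).
Proof.
move=> p0; apply/cvgr0Pnorm_le => e e0; near=> r.
have r0 : 0 < r by near: r; exact: nbhs_pinfty_gt.
rewrite ger0_norm ?powR_ge0// powRN.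
have re : (e^-1) `^ p^-1 <= r by near: r; apply: nbhs_pinfty_ge; exact: num_real.
rewrite -[leRHS]invrK lef_pV2 ?posrE ?invr_gt0 ?powR_gt0//.
have := @ge0_ler_powR R p (ltW p0) ((e^-1) `^ p^-1) r.
rewrite !nnegrE powR_ge0 (ltW r0) => /(_ isT isT re).
by rewrite -powRrM mulVf ?gt_eqF// powRr1// invr_ge0 ltW.
Unshelve. all: by end_near. Qed.

Lemma cvg0_sum_ord (F : set_system R) (FF : Filter F) (u : nat -> R -> R) n :
  (forall k, (k < n)%N -> u k x @[x --> F] --> 0) ->
  \sum_(k < n) u k x @[x --> F] --> 0.
Proof.
elim: n => [_|n IH h]; first by under eq_fun do rewrite big_ord0; exact: cvg_cst.
have -> : (fun x => \sum_(k < n.+1) u k x) = (fun x => \sum_(k < n) u k x + u n x).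
  by apply/funext => x; rewrite big_ord_recr.
rewrite -[X in _ --> X](addr0 0); apply: cvgD; last exact: h.
by apply: IH => k kn; apply: h; exact: ltnW.
Qed.

Lemma cvg0_mull (F : set_system R) (FF : Filter F) (u : R -> R) c :
  u x @[x --> F] --> 0 -> c * u x @[x --> F] --> 0.
Proof. by move=> h; rewrite -[X in _ --> X](mulr0 c); apply: cvgM => //; exact: cvg_cst. Qed.

Lemma binavg_sum K (I : Type) (s : seq I) (u : I -> nat -> R[i]) :
  binavg K (fun j => \sum_(i <- s) u i j) = \sum_(i <- s) binavg K (u i).
Proof.
rewrite /binavg exchange_big; apply: eq_bigr => j _; by rewrite mulr_sumr.
Qed.

Lemma exprn_cos_le (th kap b r : R) (K : nat) : 0 < th < 1 ->
  kap = b / - ln th -> 1 <= r -> kap * ln r <= K%:R -> th ^+ K <= r `^ (- b).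
Proof.
move=> /andP[t0 t1] kapE r1 hK; have r0 : 0 < r by lra.
have l0 : ln th < 0 by rewrite ln_lt0// t0.
have l1 : ln th != 0 by rewrite lt_eqF.
rewrite -(@lnK R th) ?posrE// -expRM_natl /powR gt_eqF// ler_expR.
apply: (@le_trans _ _ (kap * ln r * ln th)); first by rewrite ler_nM2r.
by rewrite kapE le_eqVlt; apply/orP; left; apply/eqP; field.
Qed.

(** In the last bound the logarithm is replaced by 2 sqrt(r), so that all later error terms are
    powers of r. *)
Lemma averaging_length (kap r : R) : 0 < kap -> 1 <= r -> exists K : nat,
  [/\ kap * ln r <= K%:R, K%:R <= kap * ln r + 1 &
      K%:R / r <= 2 * kap * r `^ (- 2^-1) + r `^ (-1)].
Proof.
move=> kap0 r1; have r0 : 0 < r by lra.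
have lnr0 : 0 <= ln r by rewrite ln_ge0.
have klnr0 : 0 <= kap * ln r by rewrite mulr_ge0// ltW.
pose K := (Num.trunc (kap * ln r)).+1.
have K2 : K%:R <= kap * ln r + 1.
  by rewrite -natr1 lerD2r Num.Theory.truncn_le.
exists K; split => //; first by rewrite ltW// Num.Theory.truncnS_gt.
rewrite ler_pdivrMr//; apply: le_trans K2 _; rewrite mulrDl.
have -> : r `^ (-1) * r = 1 by rewrite powR_inv1 ?ltW// mulVf ?gt_eqF.
have -> : 2 * kap * r `^ (- 2^-1) * r = kap * (2 * r `^ 2^-1).
  have -> : r `^ 2^-1 = r `^ (- 2^-1) * r.
    rewrite -{3}(powRr1 (ltW r0)) -powRD_gt0//.
    by congr (_ `^ _); lra.
  by ring.
by rewrite lerD2r ler_wpM2l ?(ltW kap0)// ln_le_sqrt.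
Qed.

(** All error terms relative to the leading one are negative powers of r. The bound by 1/2 keeps the
    window of frequencies inside [r/2, r]. *)
Lemma eventually_negligible (kap C MF e : R) (m : nat) (D p : nat -> R) :
  0 < e -> (forall k, (k < m)%N -> 0 < p k) ->
  exists R0 : R, forall r, R0 <= r ->
    [/\ 4 <= r, 2 * kap * r `^ (- 2^-1) + r `^ (-1) <= 2^-1 &
     C * (2 * kap * r `^ (- 2^-1) + r `^ (-1)) + C * r `^ (-1) +
       \sum_(k < m) D k * r `^ (- p k) + MF * r `^ (-1) <= e].
Proof.
move=> e0 p0.
pose kr (r : R) := 2 * kap * r `^ (- 2^-1) + r `^ (-1).
pose err (r : R) := C * kr r + C * r `^ (-1) +
  \sum_(k < m) D k * r `^ (- p k) + MF * r `^ (-1).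
have z1 : r `^ (-1) @[r --> +oo] --> (0 : R) by apply: cvg_powRN_pinfty; lra.
have kr_cvg : kr r @[r --> +oo] --> 0.
  rewrite -[X in _ --> X](addr0 0); apply: cvgD => //.
  by apply: cvg0_mull; apply: cvg_powRN_pinfty; lra.
have err_cvg : err r @[r --> +oo] --> 0.
  rewrite -[X in _ --> X](addr0 0); apply: cvgD; last exact: cvg0_mull.
  rewrite -[X in _ --> X](addr0 0); apply: cvgD; last first.
    apply: (@cvg0_sum_ord _ _ (fun k r => D k * r `^ (- p k)) m) => k km.
    by apply: cvg0_mull; apply: cvg_powRN_pinfty; exact: p0.
  by rewrite -[X in _ --> X](addr0 0); apply: cvgD; apply: cvg0_mull.
have : \forall r \near +oo, [/\ 4 <= r, kr r <= 2^-1 & err r <= e].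
  near=> r; split.
  - by near: r; apply: nbhs_pinfty_ge; exact: num_real.
  - apply: le_trans (ler_norm _) _; near: r.
    by move/cvgr0Pnorm_le : kr_cvg; apply; lra.
  - apply: le_trans (ler_norm _) _; near: r.
    by move/cvgr0Pnorm_le : err_cvg; apply; lra.
by move=> [x [_ Hx]]; exists (x + 1) => r xr; apply: Hx; lra.
Unshelve. all: by end_near. Qed.

Lemma half_range (r : R) (j K : nat) : 4 <= r -> 2 * K%:R <= r -> (j <= K)%N ->
  r / 2 <= r - j%:R <= r /\ 2 <= r - j%:R.
Proof.
move=> r4 K2; rewrite -(@ler_nat R) => jK; have : (0 : R) <= j%:R by [].
by split; [apply/andP; split|]; lra.
Qed.

Lemma ge4 (r : R) : 4 <= r -> [/\ 1 <= r, 0 < r & 2 <= r].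
Proof. by move=> r4; split; lra. Qed.

(** The final budget, in units of r^(-b): of the leading amplitude X, one quarter goes to all
    vanishing errors, one to the remainder and one to the supposed upper bound for the average, so
    three quarters would have to cover the whole. *)
Lemma lower_contra (rb X Y1 Y2 Mr Sg p0 evF f s l : R) : 0 < rb -> 0 < X ->
  Y1 + Y2 + Sg + Mr <= X / 4 -> rb * (X - Y1 - Y2) <= p0 ->
  p0 <= evF + f + s + l -> evF <= X / 4 * rb -> f <= rb * Mr -> s <= rb * Sg ->
  l <= rb * (X / 4) -> False.
Proof.
move=> rb0 X0 h1 h2 h3 h4 h5 h6 h7.
have : rb * (X - Y1 - Y2) <= rb * (X / 4 + Mr + Sg + X / 4).
  apply: le_trans h2 (le_trans h3 _).
  have -> : rb * (X / 4 + Mr + Sg + X / 4) = X / 4 * rb + rb * Mr + rb * Sg + rb * (X / 4).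
    by ring.
  by rewrite !lerD.
by rewrite ler_pM2l//; lra.
Qed.

Lemma far_ratio (d : R) : 0 <= d < 1 ->
  0 < cos ((1 - Num.sqrt d) / 2) < 1 /\ cos 1 <= cos ((1 - Num.sqrt d) / 2).
Proof.
move=> /andP[d0 d1]; have sd0 : 0 <= Num.sqrt d by rewrite sqrtr_ge0.
have sd1 : Num.sqrt d < 1 by rewrite -[ltRHS]sqrtr1 ltr_sqrt.
have p2 : 2 <= pi :> R by exact: pi_ge2.
split; last by rewrite leNgt ltr_cos ?in_itv /= -?leNgt//; lra.
rewrite cos_gt0_pihalf /=; last by apply/andP; split; lra.
by rewrite -[ltRHS]cos0 ltr_cos ?in_itv /= ?lexx ?pi_ge0//; lra.
Qed.

(* Every frequency r w has, at distance O(log r), a frequency in the same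
   direction where the transform is at least a power of 1/r. *)
Definition polynomial_lower n (F : T n -> R[i]) : Prop :=
  exists c B kap R0 : R, [/\ 0 < c, 0 < B, 0 < kap &
    forall (r : R) (w : 'I_n -> R), R0 <= r -> \sum_(i < n) w i ^+ 2 = 1 ->
    exists2 rho : R, r - (kap * ln r + 1) <= rho <= r &
      c * r `^ (- B) <= normc (ft F (fun i => rho * w i))].

Section Main.
Variables (n m N : nat) (lam A : nat -> R[i]).
Hypothesis lam0 : -1 < Re (lam 0%N).
Hypothesis lamS : forall k, (k < m)%N -> Re (lam 0%N) < Re (lam k.+1).
Hypothesis lamN : Re (lam 0%N) <= N%:R.
Hypothesis A0 : A 0%N != 0.

Let al k := lam k + (n%:R / 2)%:C.
Let be k := Re (lam k) + n%:R / 2 + 1.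
Let b := be 0.
Let bL := N%:R + n%:R / 2 + 1 : R.

Let n2 : (0 : R) <= n%:R / 2. Proof. by rewrite divr_ge0. Qed.

Let lamN1 k : (k <= m)%N -> -1 < Re (lam k).
Proof. by case: k => // k km; apply: lt_trans (lamS km). Qed.

Let alE k : Re (al k) + 1 = be k.
Proof. by rewrite complex_ReD. Qed.

Let alN1 k : (k <= m)%N -> -1 < Re (al k).
Proof. by move=> /lamN1 h; rewrite complex_ReD /=; move: n2 h; move: (Re (lam k)) (n%:R / 2) => x y; lra. Qed.

Let pw k (t : T n.+1) := kpow (lam k) (1 - sqnorm t).

Let pw_int k : (k <= m)%N -> cintegrable (lebesgue_tuple n.+1) setT (pw k).
Proof. by move=> /lamN1; exact: kpow_ball_integrable. Qed.

(** The admissible mass [eta] precedes [G] and [d] because shrinking the mass moves [d] towards 1,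
    and with it the averaging length. Here N is the exponent of the layer kernel, so [lamN] only
    yields b <= bL, with equality allowed. *)
Lemma radial_lower : exists2 eta : R, 0 < eta &
  forall (Ffar : T n.+1 -> R[i]) (G : M -> R[i]) (d : R),
  cintegrable (lebesgue_tuple n.+1) setT Ffar -> 0 <= d < 1 ->
  (forall t, d < sqnorm t -> Ffar t = 0) ->
  cintegrable leb setT G ->
  (forall tau, ~~ (4^-1 <= tau <= 1) -> G tau = 0) ->
  \int[leb]_tau normc (G tau) <= eta ->
  polynomial_lower (fun t => Ffar t +
    (\sum_(k < m.+1) A k * kpow (lam k) (1 - sqnorm t) +
     layer N%:R G (sqnorm t))).
Proof.
have [c [C [c0 C0 HL]]] := cosT_binavg_lower (alN1 (leq0n m)).
have /choice[Ck HCk] : forall k, exists C : R, (k <= m)%N -> 0 <= C /\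
    forall x, 1 <= x -> normc (cosT (al k) x) <= C * x `^ (- be k).
  move=> k; have [km|km] := leqP k m; last by exists 0.
  by have [C' H] := cosT_upper (alN1 km); exists C' => _; rewrite -alE.
have N0 : 0 <= Re (N%:R : R[i]) by rewrite complex_Re_nat.
have [CL CL0 HLay] := ft_layer_bound n N0.
pose a0 := normc (A 0%N) * normc (ball_const n (lam 0%N)).
have a00 : 0 < a0 by rewrite mulr_gt0 ?normc_gt0// ball_const_neq0.
pose S := CL * 2 `^ bL.
have S0 : 0 <= S by rewrite mulr_ge0 ?powR_ge0.
have ac0 : 0 < a0 * c by rewrite mulr_gt0.
(* This mass keeps the remainder below a quarter of the leading constant a0 c; the added 1 covers
   the case S = 0. *)
exists (a0 * c / 4 / (S + 1)); first by rewrite !divr_gt0//; lra.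
move=> Ffar G d iF d01 Fd iG Gs Ge.
pose D k := normc (A k) * normc (ball_const n (lam k)) * Ck k * 2 `^ `|- be k|.
have Dk0 k : (k <= m)%N -> 0 <= D k.
  by move=> /HCk[h _]; rewrite /D !mulr_ge0 ?normc_ge0 ?powR_ge0.
pose th := cos ((1 - Num.sqrt d) / 2).
have [th01 th1] := far_ratio d01.
rewrite -/th in th01 th1.
have cos10 : 0 <= cos 1 :> R by rewrite ltW// cos1_gt0.
have b0 : 0 < b by rewrite /b /be; move: lam0 n2; lra.
(* With this factor th^K <= r^(-b-1), so the far part is smaller than the leading term by a factor
   of order 1/r. *)
pose kap := (b + 1) / - ln th.
have kap0 : 0 < kap by rewrite divr_gt0 ?oppr_gt0 ?ln_lt0//; lra.
pose MF := 2 * \int[lebesgue_tuple n.+1]_t normc (Ffar t).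
have MF0 : 0 <= MF by rewrite mulr_ge0// Rintegral_ge0// => t _; exact: normc_ge0.
have pk k : (k < m)%N -> 0 < be k.+1 - b.
  by move=> /lamS h; rewrite subr_gt0 /b /be !ltrD2r.
have ac4 : 0 < a0 * c / 4 by rewrite divr_gt0.
have [R0 HR0] := eventually_negligible kap (a0 * C) MF (fun k => D k.+1) ac4 pk.
exists (a0 * c / 4), b, kap, R0; split => //.
move=> r w /HR0[r4 krr errr] w1.
have [r1 r0 r2] := ge4 r4.
have [K [K1 K2 Kr]] := averaging_length kap0 r1.
move: (2 * kap * r `^ (- 2^-1) + r `^ (-1)) krr errr Kr => kr krr errr Kr.
have K2r : 2 * K%:R <= r.
  move: (le_trans Kr krr); rewrite ler_pdivrMr// => h.
  by rewrite -ler_pdivlMl.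
have [s [s1 Hs]] := HL r K r2 K2r.
have rj j : (j <= K)%N -> r / 2 <= r - j%:R <= r.
  by move=> jK; have [] := half_range r4 K2r jK.
have rj2 j : (j <= K)%N -> 2 <= r - j%:R.
  by move=> jK; have [] := half_range r4 K2r jK.
have hpow q j : (j <= K)%N -> (r - j%:R) `^ q <= 2 `^ `|q| * r `^ q.
  by move=> /rj; exact: powR_half.
pose F t := Ffar t + (\sum_(k < m.+1) A k * pw k t + layer N%:R G (sqnorm t)).
pose ev (H : T n.+1 -> R[i]) := binavg K (fun j => expi (- s) ^+ j * ft H (fun i => (r - j%:R) * w i)).
have ipw (k : 'I_m.+1) : cintegrable (lebesgue_tuple n.+1) setT (fun t => A k * pw k t).
  by apply: cintegrableZ => //; apply: pw_int; rewrite -ltnS.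
have iL := (HLay G w 2 iG Gs w1 (lexx 2)).1.
have evD H1 H2 : cintegrable (lebesgue_tuple n.+1) setT H1 ->
    cintegrable (lebesgue_tuple n.+1) setT H2 ->
    ev (fun t => H1 t + H2 t) = ev H1 + ev H2.
  move=> i1 i2; rewrite /ev -binavgD; apply: eq_binavg => j.
  by rewrite ftD// mulrDr.
have evZ z H : cintegrable (lebesgue_tuple n.+1) setT H ->
    ev (fun t => z * H t) = z * ev H.
  move=> iH; rewrite /ev -binavgZ; apply: eq_binavg => j.
  by rewrite ftZ// mulrCA.
have evE : ev F = ev Ffar + (A 0%N * ev (pw 0%N) +
    \sum_(k < m) A k.+1 * ev (pw k.+1) + ev (fun t => layer N%:R G (sqnorm t))).
  have iS : cintegrable (lebesgue_tuple n.+1) setT (fun t => \sum_(k < m.+1) A k * pw k t).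
    exact: cintegrable_sum.
  rewrite /F evD//; last exact: cintegrableD.
  rewrite evD//; congr (_ + (_ + _)).
  have -> : ev (fun t => \sum_(k < m.+1) A k * pw k t) = \sum_(k < m.+1) A k * ev (pw k).
    rewrite /ev.
    under eq_binavg do rewrite ft_sum// mulr_sumr.
    rewrite binavg_sum; apply: eq_bigr => k _; rewrite -[RHS]evZ//.
    by apply: pw_int; rewrite -ltnS.
  by rewrite big_ord_recl.
have thK : th ^+ K <= r `^ (- b) * r `^ (-1).
  apply: le_trans (exprn_cos_le th01 (erefl kap) r1 K1) _.
  rewrite -powRD_gt0//.
  by rewrite opprD.
have rb0 : 0 < r `^ (- b) by rewrite powR_gt0.
have bFar : normc (ev Ffar) <= r `^ (- b) * (MF * r `^ (-1)).
  apply: le_trans (ft_far_bound r K iF d01 Fd w1 s1) _.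
  by rewrite -/MF -/th mulrCA ler_wpM2l.
have bLay : normc (ev (fun t => layer N%:R G (sqnorm t))) <= r `^ (- b) * (a0 * c / 4).
  apply: binavg_le => j jK; rewrite normcM normcX normc_expi expr1n mul1r.
  apply: le_trans (HLay G w _ iG Gs w1 (rj2 j jK)).2 _; rewrite complex_Re_nat -/bL.
  have G0 : 0 <= \int[leb]_tau normc (G tau) by apply: Rintegral_ge0 => t _; exact: normc_ge0.
  have h1 : CL * (r - j%:R) `^ (- bL) <= S * r `^ (- b).
    rewrite /S -mulrA ler_wpM2l//; apply: le_trans (hpow _ _ jK) _.
    have bL0 : 0 <= bL by rewrite /bL !addr_ge0.
    rewrite normrN (ger0_norm bL0) ler_wpM2l ?powR_ge0//.
    by apply: ler_powR => //; rewrite lerN2 /b /be /bL !lerD2r.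
  apply: (@le_trans _ _ (S * r `^ (- b) * (a0 * c / 4 / (S + 1)))).
    by apply: ler_pM => //; rewrite mulr_ge0 ?powR_ge0.
  have -> : S * r `^ (- b) * (a0 * c / 4 / (S + 1)) = r `^ (- b) * (a0 * c / 4) * (S / (S + 1)).
    by ring.
  rewrite -[leRHS]mulr1 ler_wpM2l//; first by rewrite mulr_ge0 ?powR_ge0 ?(ltW ac4).
  by rewrite ler_pdivrMr ?mul1r ?lerDl ?ltr_wpDl.
have ftpw k j : (k <= m)%N -> (j <= K)%N ->
    ft (pw k) (fun i => (r - j%:R) * w i) = ball_const n (lam k) * cosT (al k) (r - j%:R).
  by move=> km jK; apply: ft_kpow => //; [exact: lamN1|exact: le_trans (rj2 j jK)].
have bk k : (k < m)%N -> normc (A k.+1 * ev (pw k.+1)) <= r `^ (- b) * (D k.+1 * r `^ (- (be k.+1 - b))).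
  move=> km; have [Ck0 HC] := HCk k.+1 km.
  have -> : r `^ (- b) * (D k.+1 * r `^ (- (be k.+1 - b))) = normc (A k.+1) *
      (normc (ball_const n (lam k.+1)) * (Ck k.+1 * (2 `^ `|- be k.+1| * r `^ (- be k.+1)))).
    have -> : r `^ (- be k.+1) = r `^ (- b) * r `^ (- (be k.+1 - b)).
      rewrite -powRD_gt0//.
      by congr (_ `^ _); ring.
    by rewrite /D; ring.
  rewrite normcM ler_wpM2l ?normc_ge0//.
  apply: binavg_le => j jK; rewrite normcM normcX normc_expi expr1n mul1r.
  rewrite ftpw// normcM ler_wpM2l ?normc_ge0//; apply: le_trans (HC _ _) _.
    by apply: le_trans (rj2 j jK); rewrite ler1n.
  by rewrite ler_wpM2l// hpow.
have b00 : r `^ (- b) * (a0 * c - a0 * C * kr - a0 * C * r `^ (-1)) <= normc (A 0%N * ev (pw 0%N)).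
  have -> : ev (pw 0%N) = ball_const n (lam 0%N) *
      binavg K (fun j => expi (- s) ^+ j * cosT (al 0%N) (r - j%:R)).
    rewrite -binavgZ; apply: eq_bigr => j _; congr (_ * _).
    by rewrite ftpw ?leq0n -1?ltnS// mulrCA.
  rewrite mulrA normcM normcM -/a0.
  apply: le_trans (ler_wpM2l (ltW a00) Hs); rewrite alE -/b mulrCA ler_wpM2l ?(ltW rb0)//.
  have aC : 0 <= a0 * C by rewrite mulr_ge0// ltW.
  have h1 := ler_wpM2l aC Kr.
  (* Since (1 - sqrt d)/2 <= 1, one has cos 1 <= th, and the choice of K also disposes of the second
     oscillation. *)
  have h2 : a0 * C * cos 1 ^+ K <= a0 * C * r `^ (-1).
    rewrite ler_wpM2l//; apply: (@le_trans _ _ (th ^+ K)).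
      by rewrite lerXn2r ?nnegrE// (le_trans cos10).
    apply: le_trans thK _; rewrite -[leRHS]mul1r ler_wpM2r ?powR_ge0//.
    by rewrite -[leRHS](powRr0 r); apply: ler_powR => //; rewrite oppr_le0 ltW.
  have -> : a0 * (c - C * (K%:R / r) - C * cos 1 ^+ K) =
    a0 * c - a0 * C * (K%:R / r) - a0 * C * cos 1 ^+ K by ring.
  by apply: lerB => //; apply: lerB.
(* Otherwise every frequency of the window lies below the threshold a0 c r^(-b) / 4, and then so
   does the average of [F]. *)
apply: contrapT => nex.
have up : normc (ev F) <= a0 * c / 4 * r `^ (- b).
  apply: binavg_le => j jK; rewrite normcM normcX normc_expi expr1n mul1r.
  rewrite leNgt; apply/negP => h; apply: nex; exists (r - j%:R); last exact: ltW.
  have jK' : j%:R <= K%:R :> R by rewrite ler_nat.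
  by rewrite lerD2l lerN2 (le_trans jK' K2) gerBl ler0n.
have sumle : normc (\sum_(k < m) A k.+1 * ev (pw k.+1)) <=
    r `^ (- b) * \sum_(k < m) D k.+1 * r `^ (- (be k.+1 - b)).
  by rewrite mulr_sumr (le_trans (le_normc_sum _ _ _))// ler_sum// => k _; exact: bk.
have p0E : A 0%N * ev (pw 0%N) = ev F - ev Ffar -
    \sum_(k < m) A k.+1 * ev (pw k.+1) - ev (fun t => layer N%:R G (sqnorm t)).
  by rewrite evE (addrC (ev Ffar)) addrK [RHS]addrAC !addrK.
have tri : normc (A 0%N * ev (pw 0%N)) <= normc (ev F) + normc (ev Ffar) +
    normc (\sum_(k < m) A k.+1 * ev (pw k.+1)) + normc (ev (fun t => layer N%:R G (sqnorm t))).
  rewrite p0E; apply: le_trans (le_normcD _ _) _; rewrite normcN lerD2r.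
  apply: le_trans (le_normcD _ _) _; rewrite normcN lerD2r.
  by apply: le_trans (le_normcD _ _) _; rewrite normcN.
exact: (lower_contra rb0 ac0 errr b00 tri up bFar sumle bLay).
Qed.

End Main.
End RadialLower.

(** * Invertibility *)

Section Assembly.
Context {R : realType}.
Local Notation leb := (@lebesgue_measure R).
Local Notation M := (measurableTypeR R).
Local Notation T n := (n.-tuple (measurableTypeR R)).

Lemma sphere_measurable n : measurable [set t : T n | sqnorm t = 1].
Proof.
have -> : [set t : T n | sqnorm t = 1] = setT `&` (@sqnorm R n) @^-1` [set 1].
  by rewrite setTI.
exact: measurable_sqnorm.
Qed.

(** The sphere lies in the shell 1 <= |x|^2 < U, a difference of two balls whose volume is a
    constant times U^p - 1; choosing U^p = 1 + e makes it arbitrarily small. *)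
Lemma sphere_null n : lebesgue_tuple n.+1 [set t : T n.+1 | sqnorm t = 1] = 0%E.
Proof.
have [B B0 HB] := rpow_tuple_integral n.+1 (ltrN10 R).
set S := [set t | _]; have mS : measurable S by exact: sphere_measurable.
pose p : R := n.+1%:R / 2.
have p0 : 0 < p by rewrite divr_gt0.
have key (e : R) : 0 < e -> (lebesgue_tuple n.+1 S <= (B * e)%:E)%E.
  move=> e0; have [U U1 Up] : exists2 U, 1 < U & U `^ p = 1 + e.
    exists ((1 + e) `^ p^-1); last by rewrite -powRrM mulVf ?gt_eqF// powRr1; lra.
    have e1 : (1 : R) `^ p^-1 = 1 by rewrite powR1.
    rewrite -[ltLHS]e1; apply: gt0_ltr_powR; rewrite ?invr_gt0 ?nnegrE//; lra.
  have U0 : 0 < U by exact: lt_trans U1.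
  have [i1 e1] := HB 1; have [iU eU] := HB U.
  have E (V : R) : 0 < V -> rpow (0 + n.+1%:R / 2) V = V `^ p by rewrite /rpow add0r => ->.
  have <- : \int[lebesgue_tuple n.+1]_t (rpow 0 (U - sqnorm t) - rpow 0 (1 - sqnorm t)) = B * e.
    rewrite RintegralB// e1 eU (E _ U0) (E 1 ltr01) Up powR1.
    by rewrite -mulrBr addrC addKr.
  rewrite -[X in (_ X <= _)%E](setIT S) -integral_indic//.
  rewrite /Rintegral fineK; last first.
    have := integrableB measurableT iU i1; move/integrable_fin_num => /(_ measurableT).
    by congr (_ \is a _); apply: eq_integral => t _; rewrite /= EFinB.
  have mr (V : R) : measurable_fun setT (fun t : T n.+1 => rpow 0 (V - sqnorm t)).
    by apply: measurable_rpow; apply: measurable_funB => //; exact: measurable_sqnorm.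
  have rE (V : R) : rpow 0 V = if 0 < V then 1 else 0 by rewrite /rpow powRr0.
  apply: ge0_le_integral => //.
  - by apply/measurable_EFinP; exact: measurable_indic.
  - by apply/measurable_EFinP; exact: measurable_funB.
  - move=> t _; rewrite lee_fin indicE; case: (boolP (t \in S)) => [|_].
      rewrite inE /S /= => ->; rewrite !rE subrr ltxx subr0 subr_gt0 U1.
      by [].
    rewrite subr_ge0 !rE; case: ifPn => t1; last by case: ifP.
    by rewrite (lt_trans t1)// ltrD2r.
apply/eqP; rewrite eq_le measure_ge0 andbT.
apply/lee_addgt0Pr => e e0; rewrite add0e.
have B1 : 0 < B + 1 by lra.
apply: le_trans (key (e / (B + 1)) _) _; first by rewrite divr_gt0.
rewrite lee_fin mulrCA -[leRHS]mulr1 ler_wpM2l ?(ltW e0)// ler_pdivrMr// mul1r; lra.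
Qed.

Lemma unit_direction n (x : 'rV[R]_n.+1) : exists2 w : 'rV[R]_n.+1,
  \sum_(i < n.+1) w 0 i ^+ 2 = 1 & x = enorm x *: w.
Proof.
have [x0|x0] := eqVneq (enorm x) 0.
  exists (delta_mx 0 0).
    rewrite (bigD1 ord0)//= big1 ?addr0 => [|i i0]; first by rewrite mxE !eqxx expr1n.
    by rewrite mxE eqxx (negbTE i0) expr0n.
  rewrite x0 scale0r; apply/rowP => i; rewrite mxE; apply/eqP; rewrite -sqrf_eq0.
  move/eqP: x0; rewrite sqrtr_eq0 => h.
  rewrite eq_le sqr_ge0 andbT; apply: le_trans h.
  by rewrite (bigD1 i) //= lerDl; apply: sumr_ge0 => j _; exact: sqr_ge0.
exists ((enorm x)^-1 *: x); last by rewrite scalerA divff// scale1r.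
under eq_bigr do rewrite mxE exprMn.
rewrite -mulr_sumr exprVn sqr_sqrtr; last by apply: sumr_ge0 => i _; exact: sqr_ge0.
rewrite mulVf//; apply: contraNneq x0 => h; by rewrite /enorm h sqrtr0.
Qed.

Lemma enorm_scale n (w : 'rV[R]_n) (k : R) : \sum_(i < n) w 0 i ^+ 2 = 1 ->
  enorm (k *: w) = `|k|.
Proof.
move=> w1; rewrite /enorm; under eq_bigr do rewrite mxE exprMn.
by rewrite -mulr_sumr w1 mulr1 sqrtr_sqr.
Qed.

(** The lower bound is known for large r only, whereas invertibility concerns every frequency. Small
    x are moved to the threshold; this bounded displacement fits into A ln(2 + x) because ln(2 + x)
    >= ln 2 > 0. *)
Lemma invertibility_constant (c B kap R0 : R) : 0 < c -> 0 < B -> 0 < kap ->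
  exists2 A : R, 0 < A & forall x, 0 <= x -> exists2 r : R, R0 <= r &
    forall rho, r - (kap * ln r + 1) <= rho <= r ->
    `|rho - x| < A * ln (2 + x) /\ (A + x) `^ (- A) < c * r `^ (- B).
Proof.
move=> c0 B0 kap0.
have [R1 R01 R11] : exists2 R1 : R, R0 <= R1 & 1 <= R1.
  by exists (Num.max R0 1); rewrite le_max lexx ?orbT.
have l20 : 0 < ln (2 : R) by rewrite ln_gt0// ltr1n.
have klR : 0 <= kap * ln R1 by rewrite mulr_ge0 ?(ltW kap0)// ln_ge0.
have [A0 A00 HA0] : exists2 A0 : R, 0 < A0 & forall L, ln 2 <= L ->
    kap * ln R1 + 1 + R1 + kap * L <= A0 * L.
  have h : 0 < kap * ln R1 + 1 + R1 by lra.
  exists ((kap * ln R1 + 1 + R1) / ln 2 + kap); first by rewrite addr_gt0// divr_gt0.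
  by move=> L hL; rewrite mulrDl lerD2r mulrAC ler_pdivlMr// ler_wpM2l ?(ltW h).
have ic : 0 < c^-1 by rewrite invr_gt0.
(* The first condition controls the distance and the second gives r <= A + x. The last two turn (A +
   x)^(-A) into at most r^(-B) times (A + x)^(-1), whose last factor is smaller than c. *)
have [A [A1 A2 A3 A4]] : exists A : R, [/\ A0 < A, R1 <= A, B + 1 <= A & c^-1 < A].
  by exists (A0 + R1 + B + c^-1 + 1); split; lra.
have A_0 : 0 < A by exact: lt_trans A1.
exists A => // x x0; exists (Num.max x R1); first by rewrite le_max R01 orbT.
have [xr Rr rA] : [/\ x <= Num.max x R1, R1 <= Num.max x R1 & Num.max x R1 <= x + R1].
  by rewrite !le_max !lexx orbT ge_max lerDl lerDr x0 (le_trans ler01 R11).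
move: (Num.max x R1) xr Rr rA => r xr Rr rA rho /andP[rho1 rho2].
have r0 : 0 < r by apply: lt_le_trans Rr; exact: lt_le_trans R11.
have R10 : 0 < R1 by exact: lt_le_trans R11.
have x20 : 0 < 2 + x by rewrite ltr_wpDr.
have L2 : ln 2 <= ln (2 + x) by rewrite ler_ln ?posrE// lerDl.
have L0 : 0 < ln (2 + x) by exact: lt_le_trans L2.
have lnr : ln r <= ln R1 + ln (2 + x).
  rewrite -lnM ?posrE// ler_ln ?posrE ?mulr_gt0//; apply: le_trans rA _.
  by rewrite mulrDr addrC lerD//; [rewrite -[leLHS]mulr1 ler_wpM2l ?(ltW R10)//; lra|rewrite -[leLHS]mul1r ler_wpM2r].
split.
  have := HA0 _ L2; have : A0 * ln (2 + x) < A * ln (2 + x) by rewrite ltr_pM2r.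
  have : kap * ln r <= kap * ln R1 + kap * ln (2 + x) by rewrite -mulrDr ler_pM2l.
  have : 0 <= kap * ln (2 + x) by rewrite mulr_ge0 ?ltW.
  move: (A * _) (A0 * _) (kap * ln (2 + x)) (kap * ln r) (kap * ln R1) rho1 klR => *.
  by rewrite ltr_norml; apply/andP; split; lra.
have X0 : 0 < A + x by rewrite ltr_wpDr.
have X1 : 1 <= A + x by apply: le_trans (le_trans R11 A2) _; rewrite lerDl.
apply: (@le_lt_trans _ _ ((A + x) `^ (- B) * (A + x) `^ (-1))).
  by rewrite -powRD_gt0//; apply: ler_powR => //; rewrite -opprD lerN2.
have h1 : (A + x) `^ (- B) <= r `^ (- B).
  rewrite !powRN lef_pV2 ?posrE ?powR_gt0//.
  apply: ge0_ler_powR; rewrite ?nnegrE ?(ltW B0) ?(ltW X0) ?(ltW r0)//.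
  by apply: le_trans rA _; rewrite addrC lerD2r.
have h2 : (A + x) `^ (-1) < c.
  rewrite powR_inv1 ?(ltW X0)// -[ltRHS]invrK ltf_pV2 ?posrE//.
  by apply: lt_le_trans A4 _; rewrite lerDl.
apply: (@le_lt_trans _ _ (r `^ (- B) * (A + x) `^ (-1))).
  by rewrite ler_wpM2r// powR_ge0.
by rewrite mulrC ltr_pM2r// powR_gt0.
Qed.

Lemma invertible_of_lower n (f : 'rV[R]_n.+1 -> R[i]) :
  polynomial_lower (fun t : T n.+1 => f (rv t)) -> invertible (distribution_of f).
Proof.
move=> [c [B [kap [R0 [c0 B0 kap0 H]]]]].
have [A A0 HA] := invertibility_constant R0 c0 B0 kap0.
exists A => // xi; have [w w1 xiE] := unit_direction xi.
have [r rR Hr] := HA (enorm xi) (sqrtr_ge0 _).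
have [rho hrho Hrho] := H r (fun i => w 0 i) rR w1.
have [near_xi small] := Hr rho hrho.
have FE : fourier (distribution_of f) (map_mx (real_complex R) (rho *: w)) =
    ft (fun t : T n.+1 => f (rv t)) (fun i => rho * w 0 i).
  rewrite fourier_distribution /ft; congr cintegral; apply/funext => t.
  by congr (_ * expi (- dotp _ t)); apply/funext => i; rewrite mxE.
apply: (@lt_le_trans _ _ (normc (fourier (distribution_of f)
    (map_mx (real_complex R) (rho *: w))))%:E).
  by rewrite lte_fin FE; exact: lt_le_trans Hrho.
apply: ereal_sup_ubound; exists (rho *: w) => //=.
by rewrite {1}xiE -scalerBl enorm_scale.
Qed.

End Assembly.

(** * The radial profile near the origin and the splitting of f *)

Section Profile.
Context {R : realType}.
Local Notation leb := (@lebesgue_measure R).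
Local Notation M := (measurableTypeR R).
Local Notation T n := (n.-tuple (measurableTypeR R)).

Lemma segment_bounded (g : R -> R) (a b : R) :
  (forall x, a <= x <= b -> {for x, continuous g}) ->
  exists B : R, forall x, a <= x <= b -> `|g x| <= B.
Proof.
move=> cg; have : compact (g @` `[a, b]%classic).
  apply: continuous_compact; last exact: segment_compact.
  apply: continuous_in_subspaceT => x; rewrite inE /= in_itv /=; exact: cg.
move=> /compact_bounded[B [_ HB]]; exists (B + 1) => x xab.
by apply: (HB (B + 1)); [rewrite ltrDl|exists x => //; rewrite /= in_itv].
Qed.

Lemma csegment_bounded (f : R -> R[i]) (a b : R) :
  (forall x, a <= x <= b -> ccontinuous_at x f) ->
  exists B : R, forall x, a <= x <= b -> normc (f x) <= B.
Proof.
move=> cf; have [B1 H1] := segment_bounded (fun x h => (cf x h).1).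
have [B2 H2] := segment_bounded (fun x h => (cf x h).2).
exists (B1 + B2) => x xab; apply: le_trans (normc_le_ReIm _) _.
by rewrite lerD ?H1 ?H2.
Qed.

(** The case M = 0 of the expansion: the sum is empty and only the order of growth at 0 is left. *)
Lemma asymp_bound (f : R -> R[i]) (mu : R[i]) (c : nat -> R[i]) :
  asymp_expansion_at0 0 (cderiv 0 f) mu c ->
  exists C s1 : R, [/\ 0 <= C, 0 < s1 &
    forall s, 0 < s < s1 -> normc (f s) <= C * s `^ Re mu].
Proof.
move=> /(_ 0%N)/eqO_exP[k k0]; rewrite near_simpl => -[e /= e0 He].
exists k, e; split => //; first exact: ltW.
move=> s /andP[s0 se]; have := He s; rewrite /= sub0r normrN (gtr0_norm s0) => /(_ se s0).
rewrite big_ord0 subr0 addr0 subr0 !ger0_norm ?powR_ge0 ?normc_ge0//.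
by have -> : cderiv 0 f s = f s by rewrite /cderiv /=; case: (f s).
Qed.

(** The bound is stated in powers of s^2 = |x|^2 so that the singular part is covered by
    [sqnorm_powR_integrable]; the constant part is covered by the volume of the unit ball. *)
Lemma inner_part_integrable n (P : R -> R[i]) (q C1 C2 d : R) :
  cmeasurable (setT : set M) P -> P 0 = 0 -> 0 <= C1 -> 0 <= C2 ->
  (forall s, 0 < s -> s ^+ 2 <= d -> normc (P s) <= C1 * (s ^+ 2) `^ q + C2) ->
  q < 0 -> 0 < q + n%:R / 2 -> d < 1 ->
  cintegrable (lebesgue_tuple n) setT
    (fun t => if sqnorm t <= d then P (Num.sqrt (sqnorm t)) else 0).
Proof.
move=> mP P0 C10 C20 HP q0 qn d1.
have mPt : cmeasurable setT (fun t : T n => P (Num.sqrt (sqnorm t))).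
  apply: (cmeasurable_comp (h := fun t : T n => Num.sqrt (sqnorm t) : M) mP).
  by have := @measurable_enorm_rv R n; under eq_fun do rewrite enorm_rv.
have [B B0 HB] := rpow_tuple_integral n (ltrN10 R).
have [i1 _] := HB 1.
have ih : (lebesgue_tuple n).-integrable setT (EFin \o fun t =>
    C1 * (if sqnorm t < 1 then rpow q (sqnorm t) else 0) + C2 * rpow 0 (1 - sqnorm t)).
  rewrite /comp; under eq_fun do rewrite EFinD !EFinM.
  apply: integrableD => //; apply: integrableZl => //.
  exact: sqnorm_powR_integrable.
apply: (le_cintegrable measurableT _ ih).
  apply: cmeasurable_if0 => //; apply: measurable_fun_ler => //.
  exact: measurable_sqnorm.
move=> t _; have u0 := sqnorm_ge0 t; case: ifPn => ud; last first.
  rewrite normc0 addr_ge0 ?mulr_ge0 ?rpow_ge0//.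
  by case: ifP => // _; exact: rpow_ge0.
have u1 : sqnorm t < 1 by exact: le_lt_trans d1.
have [t0|tN0] := eqVneq (sqnorm t) 0.
  rewrite t0 sqrtr0 P0 normc0 addr_ge0 ?mulr_ge0 ?rpow_ge0//.
  by case: ifP => // _; exact: rpow_ge0.
have tp : 0 < sqnorm t by rewrite lt_neqAle eq_sym tN0.
have := HP (Num.sqrt (sqnorm t)); rewrite sqr_sqrtr// sqrtr_gt0 => /(_ tp ud).
by rewrite u1 /rpow tp subr_gt0 u1 powRr0 mulr1.
Qed.

End Profile.

Section Decomposition.
Context {R : realType}.
Local Notation leb := (@lebesgue_measure R).
Local Notation M := (measurableTypeR R).
Local Notation T n := (n.-tuple (measurableTypeR R)).

Lemma layer_ge1 (a : R[i]) (G : M -> R[i]) (u : R) :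
  (forall tau, 1 <= tau -> G tau = 0) -> 1 <= u -> layer a G u = 0.
Proof.
move=> G1 u1; rewrite /layer -[RHS](cintegral0 leb setT); apply: eq_cintegral => tau _.
have [t1|t1] := leP 1 (tau : R); first by rewrite G1 ?mul0r.
by rewrite kpow_le0 ?mulr0// subr_le0 (le_trans (ltW t1)).
Qed.

(* The mass of G can be made small because the N-th derivative of
   (1 - t)^Lambda psi is integrable at 1. *)
Lemma smooth_remainder_small b N (Lambda : R[i]) (psi : R -> R[i]) (e : R) :
  0 <= b < 1 -> N.+1%:R <= Re Lambda -> csmooth_on `]0, 1[%classic psi ->
  (forall k, (k <= N.+1)%N -> cintegrable leb `]b, 1[ (cderiv k psi)) -> 0 < e ->
  exists (d : R) (G : M -> R[i]), [/\ b < d < 1, cintegrable leb setT G,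
    (forall tau, ~~ (d < tau < 1) -> G tau = 0),
    \int[leb]_tau normc (G tau) <= e &
    forall u, d < u < 1 -> layer N%:R G u = cpow (1 - u) Lambda * psi u].
Proof.
move=> b01 NL sp ip e0; have [b0 b1] := andP b01.
have [G0 iG0 G0E] := smooth_remainder_layer b01 NL sp ip.
have [d [bd d1 Gd]] := small_mass_at1 b1 iG0 e0.
have mo a c : measurable (`]a, c[%classic : set M) by exact: measurable_itv.
have sub : `]d, 1[ `<=` `]b, 1[%classic.
  by move=> x /=; rewrite !in_itv /= => /andP[dx ->]; rewrite (lt_trans bd dx).
pose G (tau : M) := G0 tau * (\1_(`]d, 1[%classic) tau)%:C.
have inE (tau : R) : \1_(`]d, 1[%classic) tau = if d < tau < 1 then 1 else 0 :> R.
  by rewrite indicE mem_setE in_itv /=; case: ifP.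
exists d, G; split.
- by rewrite bd.
- apply: cintegrable_mkcond => //.
  by split; [exact: integrableS iG0.1|exact: integrableS iG0.2].
- by move=> tau h; rewrite /G inE (negbTE h) mulr0.
- apply: ltW; apply: le_lt_trans Gd; rewrite le_eqVlt; apply/orP; left; apply/eqP.
  apply: eq_Rintegral => tau _; rewrite /G normcM normc_real inE.
  by case: ifP => _; rewrite ?normr1 ?normr0.
- move=> u /andP[du u1]; rewrite G0E ?u1 ?(lt_trans bd du)//.
  rewrite cintegral_mkcond /layer; apply: eq_cintegral => tau _.
  rewrite /G inE indicE mem_setE in_itv /=.
  have [ut|tu] := ltP u (tau : R); last by rewrite kpow_le0 ?subr_le0// !mulr0.
  rewrite (lt_trans du ut) kpow_gt0 ?subr_gt0// cpow_nat ?subr_gt0//.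
  by case: ifP => _; rewrite ?mulr1 ?mulr0 ?mul0r.
Qed.

Variables (n : nat) (varphi : R -> R[i]) (mu : R[i]) (c : nat -> R[i]).
Hypothesis sphi : csmooth_on `]0, 1[%classic varphi.
Hypothesis muN : 0 < Re mu + n.+1%:R / 2.
Hypothesis asy : asymp_expansion_at0 0 (cderiv 0 varphi) mu c.

Definition radial_profile (s : R) : R[i] :=
  (s `^ (- (n.+1%:R / 2)))%:C * varphi s * (\1_(`[0, 1]%classic) s)%:C.

Local Notation P := radial_profile.

Lemma radial_profile_in s : 0 <= s <= 1 -> P s = (s `^ (- (n.+1%:R / 2)))%:C * varphi s.
Proof. by move=> s01; rewrite /P indicE mem_setE in_itv /= s01 mulr1. Qed.

Lemma radial_profile_out s : ~~ (0 <= s <= 1) -> P s = 0.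
Proof. by move=> s01; rewrite /P indicE mem_setE in_itv /= (negbTE s01) mulr0. Qed.

(** A power of 0 with nonzero exponent is 0 by convention, negative exponents included. *)
Lemma radial_profile_at0 : P 0 = 0.
Proof. by rewrite /P powR0 ?mul0r// oppr_eq0 mulf_neq0// invr_eq0. Qed.

Lemma radial_profile_continuous x : 0 < x < 1 -> ccontinuous_at x P.
Proof.
move=> x01; have /andP[x0 x1] := x01.
have c1 : ccontinuous_at x (fun s => (s `^ (- (n.+1%:R / 2)))%:C * varphi s).
  apply: ccontinuousM.
    apply: is_cderive_continuous; apply: is_cderive_real.
    exact: is_derive_powR_comp (is_derive_id x 1) x0.
  have Dx : `]0, 1[%classic x by rewrite /= in_itv.
  have [h1 h2] := is_cderive_continuous (csmooth_is_cderive 0%N sphi Dx).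
  by split.
have near01 : \forall s \near x, P s = (s `^ (- (n.+1%:R / 2)))%:C * varphi s.
  have : \forall s \near x, 0 < s < 1.
    have : nbhs x (`]0, 1[%classic : set R).
      by apply: open_nbhs_nbhs; split; [exact: interval_open|rewrite /= in_itv].
    by apply: filterS => s /=; rewrite in_itv.
  by apply: filterS => s /andP[s0 s1]; rewrite radial_profile_in// (ltW s0) (ltW s1).
by split; [apply: near_eq_continuous_at c1.1|apply: near_eq_continuous_at c1.2];
  apply: filterS near01 => s ->.
Qed.

Lemma radial_profile_measurable : cmeasurable (setT : set M) P.
Proof.
by apply: cmeasurable_01; [exact: radial_profile_continuous|exact: radial_profile_out].
Qed.

Lemma radial_profile_rv_measurable :
  cmeasurable setT (fun t : T n.+1 => P (enorm (rv t))).
Proof.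
apply: (cmeasurable_comp (h := fun t : T n.+1 => enorm (rv t) : M)).
  exact: radial_profile_measurable.
exact: measurable_enorm_rv.
Qed.

Lemma radial_profile_inner (d : R) : 0 <= d < 1 ->
  cintegrable (lebesgue_tuple n.+1) setT
    (fun t => if sqnorm t <= d then P (Num.sqrt (sqnorm t)) else 0).
Proof.
move=> /andP[d0 d1].
have [C [s1 [C0 s10 Hs]]] := asymp_bound asy.
have sd1 : Num.sqrt d < 1 by rewrite -[ltRHS]sqrtr1 ltr_sqrt.
have [|B HB] := @csegment_bounded R P s1 (Num.sqrt d).
  move=> x /andP[sx xd]; apply: radial_profile_continuous.
  by rewrite (lt_le_trans s10 sx) (le_lt_trans xd sd1).
pose q0 := (Re mu - n.+1%:R / 2) / 2.
(* Since s^(Re mu - dim/2) = (s^2)^q0, the natural exponent is q0, and q0 + dim/2 > 0 is the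
   hypothesis on mu. The minimum makes the exponent negative; lowering it only enlarges the bound,
   as s^2 <= 1, and -1/4 + dim/2 is still positive. *)
pose q := Num.min q0 (- 4^-1).
have n1 : (1 : R) <= n.+1%:R by rewrite ler1n.
have qN : q < 0 by rewrite gt_min; apply/orP; right; lra.
have qn : 0 < q + n.+1%:R / 2.
  have h : 0 < q0 + n.+1%:R / 2.
    by rewrite /q0; move: muN; move: (Re mu) (n.+1%:R : R) => x y; lra.
  by rewrite /q minElt; case: ifP => _ //; lra.
apply: (@inner_part_integrable _ _ P q C `|B| d) => //.
- exact: radial_profile_measurable.
- exact: radial_profile_at0.
move=> s s0 sd; have s2 : 0 < s ^+ 2 by rewrite exprn_gt0.
have s1' : s <= Num.sqrt d by rewrite -(ger0_norm (ltW s0)) -sqrtr_sqr ler_sqrt.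
have [ss|ss] := leP s1 s.
  apply: le_trans (HB s _) _; first by rewrite ss.
  by rewrite -[leLHS]add0r lerD ?mulr_ge0 ?powR_ge0 ?ler_norm.
rewrite -[leLHS]addr0 lerD// radial_profile_in; last first.
  by rewrite (ltW s0) (le_trans s1' (ltW sd1)).
rewrite normcM normc_real ger0_norm ?powR_ge0//.
apply: (@le_trans _ _ (s `^ (- (n.+1%:R / 2)) * (C * s `^ Re mu))).
  by rewrite ler_wpM2l ?powR_ge0// Hs// s0.
rewrite mulrCA ler_wpM2l// -powRD_gt0//.
have -> : - (n.+1%:R / 2) + Re mu = 2%:R * q0 by rewrite /q0; field.
rewrite powRrM powR_mulrn ?(ltW s0)//.
rewrite ger_powR ?s2//; last by rewrite /q ge_min lexx.
by rewrite (le_trans sd (ltW d1)).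
Qed.

End Decomposition.

Theorem theorem4p5 (R : realType) (n : nat) (eps : R)
    (varphi phi : R -> R[i]) (mu : R[i]) (c : nat -> R[i])
    (N m : nat) (lambda : nat -> R[i]) (Lambda : R[i]) (a : nat -> R[i])
    (psi : R -> R[i]) :
  (2 <= n)%N ->
  0 < eps < 3^-1 ->
  csmooth_on `]0, 1[%classic varphi ->
  (forall s : R, 0 < s < 1 ->
     varphi s = (s `^ (n%:R / 2))%:C * phi (s ^+ 2)) ->
  -1 < complex.Re (mu + (n%:R / 2 - 1 : R)%:C) ->
  c 0%N != 0 ->
  (forall j : nat, asymp_expansion_at0 j (cderiv j varphi) mu c) ->
  -1 < complex.Re (lambda 0%N) ->
  (forall k : nat, (k < m)%N ->
     complex.Re (lambda k) < complex.Re (lambda k.+1)) ->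
  complex.Re (lambda m) < complex.Re Lambda ->
  N%:R <= complex.Re Lambda ->
  complex.Re (lambda 0%N) <= N%:R - 1 ->
  a 0%N != 0 ->
  csmooth_on `]0, 1[%classic psi ->
  (forall k : nat, (k <= N)%N ->
     cintegrable lebesgue_measure `](1 - 2 * eps), 1[%classic (cderiv k psi)) ->
  (forall t : R, 1 - 2 * eps < t < 1 ->
     phi t = \sum_(k < m.+1) a k * cpow (1 - t) (lambda k) +
             cpow (1 - t) Lambda * psi t) ->
  let f := fun x : 'rV[R]_n =>
    (enorm x `^ (- (n%:R / 2)))%:C * varphi (enorm x) *
    (\1_(`[0, 1]%classic) (enorm x))%:C in
  [/\ forall x : 'rV[R]_n, enorm x != 0 -> enorm x != 1 ->
        f x = phi (enorm x ^+ 2) * (\1_(`[0, 1]%classic) (enorm x))%:C,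
      cintegrable_rV f,
      compact_distribution (distribution_of f) &
      invertible (distribution_of f)].
Proof.
case: n => [//|n] n2 /andP[e0 e1] sphi phiE muN _ asy l0 lS _ NL lN a0 spsi ipsi phi1 f.
(* N = 0 would contradict -1 < Re lambda_0 <= N - 1. From here on N stands for the original value
   minus one, the exponent of the layer kernel. *)
case: N NL lN ipsi => [|N] NL lN ipsi; first by exfalso; move: l0 lN; rewrite sub0r => h1 /(lt_le_trans h1); rewrite ltxx.
have lN' : complex.Re (lambda 0%N) <= N%:R by move: lN; rewrite -natr1 addrK.
have muN' : 0 < complex.Re mu + n.+1%:R / 2.
  by move: muN; rewrite complex_ReD /=; move: (complex.Re mu) (n.+1%:R / 2) => x y h; lra.
have lam k : (k < m)%N -> complex.Re (lambda 0%N) < complex.Re (lambda k.+1).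
  by elim: k => [|k IH] km; [exact: lS|exact: lt_trans (IH (ltnW km)) (lS _ km)].
have fP x : f x = radial_profile n varphi (enorm x) by [].
have Pphi s : 0 < s < 1 -> radial_profile n varphi s = phi (s ^+ 2).
  move=> /andP[s0 s1]; rewrite radial_profile_in ?(ltW s0) ?(ltW s1)// phiE ?s0//.
  by rewrite mulrA -rmorphM -powRD_gt0// addNr powRr0 rmorph1 mul1r.
pose b := 1 - 2 * eps.
(* From eps < 1/3 one gets b > 1/3, so a density supported in (d, 1) with d > b meets the support
   condition tau >= 1/4. *)
have [b3 b1] : 3^-1 < b /\ b < 1 by rewrite /b; split; lra.
have b01 : 0 <= b < 1 by rewrite b1 andbT; lra.
have [eta eta0 H] := radial_lower n l0 lam lN' a0.
have [d [G [/andP[bd d1] iG Gs Ge layE]]] :=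
  smooth_remainder_small b01 NL spsi ipsi eta0.
have d01 : 0 <= d < 1 by rewrite d1 andbT; lra.
have Gs' tau : ~~ (4^-1 <= tau <= 1) -> G tau = 0.
  move=> h; apply: Gs; apply: contra h => /andP[dt t1].
  by rewrite (ltW t1) andbT; lra.
have lay1 u : 1 <= u -> layer N%:R G u = 0.
  by apply: layer_ge1 => tau t1; apply: Gs; rewrite negb_and -!leNgt t1 orbT.
pose S (t : n.+1.-tuple (measurableTypeR R)) : R[i] := \sum_(k < m.+1) a k * kpow (lambda k) (1 - sqnorm t) + layer N%:R G (sqnorm t).
have iS : cintegrable (lebesgue_tuple n.+1) setT S.
  apply: cintegrableD => //.
    apply: (eq_cintegrable (f := fun t => \sum_(k < m.+1) a k * kpow (lambda k) (1 - sqnorm t))) => //.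
    apply: cintegrable_sum => // k; apply: cintegrableZ => //.
    apply: kpow_ball_integrable.
    by case: k => -[|k] //= km; exact: lt_trans (lam k km).
  have N0 : 0 <= complex.Re (N%:R : R[i]) by rewrite complex_Re_nat.
  have [CL _ HL] := ft_layer_bound n N0.
  (* An arbitrary unit vector and the frequency 2 are supplied in order to extract the integrability
     half of the layer bound. *)
  have [w w1 _] := unit_direction (0 : 'rV[R]_n.+1).
  exact: (HL G (fun i => w 0 i) 2 iG Gs' w1 (lexx 2)).1.
(* The singular model S is defined on all of space, so its inner part is subtracted from f here.
   What remains is integrable and supported in |x|^2 <= d, and its sum with S is f away from the
   sphere. *)
pose Ffar (t : n.+1.-tuple (measurableTypeR R)) : R[i] := (if sqnorm t <= d then radial_profile n varphi (Num.sqrt (sqnorm t)) else 0)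
  - (if sqnorm t <= d then 1 else 0) * S t.
have iFar : cintegrable (lebesgue_tuple n.+1) setT Ffar.
  apply: cintegrableB => //; first exact: (radial_profile_inner sphi muN' (asy 0%N) d01).
  apply: (cintegrableMl (M := 1)) => //.
    apply: cmeasurable_if0; last exact: cmeasurable_cst.
    by apply: measurable_fun_ler => //; exact: measurable_sqnorm.
  by move=> t _; case: ifP => _; rewrite ?normc1 ?normc0.
have Fd t : d < sqnorm t -> Ffar t = 0.
  by move=> h; rewrite /Ffar leNgt h /= mul0r subr0.
have pl := H Ffar G d iFar d01 Fd iG Gs' Ge.
(* On the unit sphere f involves varphi(1), about which nothing is assumed; the sphere is removed as
   a null set. *)
have FE t : sqnorm t != 1 -> Ffar t + S t = f (rv t).
  move=> t1; rewrite fP enorm_rv /Ffar; have [td|td] := leP (sqnorm t) d.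
    by rewrite mul1r subrK.
  rewrite mul0r subrr add0r /S.
  have u0 : 0 < sqnorm t by rewrite (le_lt_trans _ td)//; case/andP: d01.
  have [tl|tl] := ltP (sqnorm t) 1.
    have s01 : 0 < Num.sqrt (sqnorm t) < 1.
      by rewrite sqrtr_gt0 u0 -[ltRHS]sqrtr1 ltr_sqrt.
    rewrite (Pphi _ s01) sqr_sqrtr ?(ltW u0)// phi1; last by rewrite -/b tl (lt_trans bd td).
    rewrite layE ?td//; congr (_ + _); apply: eq_bigr => k _.
    by rewrite kpow_gt0// subr_gt0.
  have tg : 1 < sqnorm t by rewrite lt_neqAle eq_sym t1.
  rewrite lay1// addr0 big1 => [|k _]; last by rewrite kpow_le0 ?mulr0// subr_le0.
  rewrite radial_profile_out// negb_and -!ltNge; apply/orP; right.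
  by rewrite -[ltLHS]sqrtr1 ltr_sqrt.
have mf : cmeasurable setT (fun t => f (rv t)).
  exact: (radial_profile_rv_measurable n sphi).
have nul : exists Z, [/\ measurable Z, lebesgue_tuple n.+1 Z = 0%E &
    forall t, ~ Z t -> Ffar t + S t = f (rv t)].
  exists [set t | sqnorm t = 1]; split; [exact: sphere_measurable|exact: sphere_null|].
  by move=> t /= /eqP/FE.
have iF : cintegrable (lebesgue_tuple n.+1) setT (fun t => Ffar t + S t).
  exact: cintegrableD.
have if_ : cintegrable_rV f by exact: (cintegral_ae_eq iF mf nul).1.
have f0 x : 1 < enorm x -> f x = 0.
  by move=> x1; rewrite fP radial_profile_out// negb_and -!ltNge x1 orbT.
have ftE e : ft (fun t => f (rv t)) e = ft (fun t => Ffar t + S t) e.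
  have [Z [mZ Z0 ZE]] := nul.
  apply: (cintegral_ae_eq (ft_integrable e iF) _ _).2.
    exact: cintegrable_cmeasurable (ft_integrable e if_).
  by exists Z; split => // t /ZE ->.
split => //.
- move=> x x0 x1; rewrite fP.
  have xp : 0 < enorm x by rewrite lt_neqAle eq_sym x0 sqrtr_ge0.
  have [xl|xl] := ltP (enorm x) 1.
    rewrite Pphi ?xp// indicE mem_set ?mulr1//.
    by rewrite /= in_itv /= (ltW xp) (ltW xl).
  have xg : 1 < enorm x by rewrite lt_neqAle eq_sym x1.
  rewrite radial_profile_out; last by rewrite negb_and -!ltNge xg orbT.
  by rewrite indicE mem_setE in_itv /= (leNgt (enorm x)) xg andbF mulr0.
- exact: distribution_compact.
- apply: invertible_of_lower; move: pl => [c' [B [kap [R0 [h1 h2 h3 h4]]]]].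
  exists c', B, kap, R0; split => // r w rR w1.
  by have [rho hr hl] := h4 r w rR w1; exists rho => //; rewrite ftE.
Qed.
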